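(* Let $R\to S$ be a homomorphism of (not necessarily commutative) associative unital rings. Equip each term of the Amitsur cosimplicial $R$-bimodule $\bigotimes_RS$ with Nuss' product, and $K\Omega_RS$ with the product $(a\otimes x)(b\otimes y)=ab\otimes x\wedge y$. Then the canonical Dold-Kan isomorphism $\bigotimes_RS\cong K\Omega_RS$ is an isomorphism of cosimplicial rings.
   Context: $\bigotimes_RS$ is the Amitsur cosimplicial $R$-bimodule $[n]\mapsto\bigotimes_{i=0}^n{}_R\,S$ ($n+1$ factors); the coface $\partial_i$ inserts $1$ in position $i$ and the codegeneracy $\mu_j$ multiplies the factors in positions $j$ and $j+1$. Nuss' product: let $\tau:S\otimes_RS\to S\otimes_RS$, $\tau(s\otimes t)=st\otimes1+1\otimes st-s\otimes t$. It is an involution satisfying the Yang-Baxter equation. The product on $S^{\otimes_R(n+1)}$ is the braided tensor product obtained by the standard iterative procedure: on $S\otimes_RS$ it is $(m\otimes m)\circ(1\otimes\tau\otimes1)$, with $m$ the multiplication of $S$, and in general it is the composite of the map $S^{\otimes_R(n+1)}\otimes_RS^{\otimes_R(n+1)}\to(S\otimes_RS)^{\otimes_R(n+1)}$ built from $\tau$'s applied to adjacent factors, which moves $a_0\otimes\dots\otimes a_n\otimes b_0\otimes\dots\otimes b_n$ to the order $a_0,b_0,a_1,b_1,\dots,a_n,b_n$, with $m^{\otimes(n+1)}$. Thus it is the associative product in which, writing $\delta_i(a)$ for the tensor with $a$ in position $i$ and $1$ elsewhere, $s_0\otimes\dots\otimes s_n=\delta_0(s_0)\cdots\delta_n(s_n)$,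 $\delta_i(a)\delta_i(b)=\delta_i(ab)$, and $\delta_i(a)\delta_j(b)=-\delta_j(a)\delta_i(b)+\delta_i(ab)+\delta_j(ab)$ for $i>j$. $\Omega_RS$ is the cochain DG-ring of relative noncommutative differential forms: $\Omega_R^nS=S\otimes_R(S/R)^{\otimes_Rn}$, with $s_0\otimes\bar s_1\otimes\dots\otimes\bar s_n$ corresponding to $s_0ds_1\cdots ds_n$. The functor $K$: $V^n=\ker(\bigoplus_{i=0}^n\mathbb{Z}\to\mathbb{Z})$ (kernel of the sum map), with basis $v_1,\dots,v_n$, $v_i=e_i-e_0$ (so $v_0=0$), and $\alpha v_i=v_{\alpha(i)}-v_{\alpha(0)}$ for $\alpha:[n]\to[m]$. For a cochain complex $(A,d)$, $K^nA=\bigoplus_{i\ge0}A^i\otimes\Lambda^iV^n$ with $\alpha(a\otimes x)=a\otimes\alpha x+da\otimes v_{\alpha(0)}\wedge\alpha x$. For a cosimplicial group $C$, $NC$ is the normalized complex $N^nC=C^n/\sum_{i=1}^n\partial_iC^{n-1}$ with coboundary induced by $\partial_0$. One has $NKA=A$ through $N^nKA=A^n\otimes v_1\wedge\dots\wedge v_n\cong A^n$, and $N(\bigotimes_RS)=\Omega_RS$ (the class of $s_0\otimes\dots\otimes s_n$ corresponds to $s_0ds_1\cdots ds_n$). $N$ and $K$ are inverse equivalences between cosimplicial abelian groups and non-negatively graded cochain complexes (Dold-Kan); the canonical isomorphism $\bigotimes_RS\cong K\Omega_RS$ is the isomorphism of cosimplicial $R$-bimodules which induces the identity of $\Omega_RS$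 on normalized complexes. *)

(* Defs.v *)
From HB Require Import structures.
From mathcomp Require Import all_boot all_order all_algebra.
From mathcomp Require Import boolp zify.
From mathcomp.multinomials Require Import freeg.
Set Implicit Arguments.
Unset Strict Implicit.
Unset Printing Implicit Defensive.
Import GRing.Theory.
Local Open Scope ring_scope.
Local Open Scope quotient_scope.

Section Quotient.
Variables (G : zmodType) (P : G -> Prop).

Inductive span : G -> Prop :=
| span0 : span 0
| span_mem x : P x -> span x
| spanB x y : span x -> span y -> span (x - y).

Definition span_pred : {pred G} := fun x => `[< span x >].

Lemma span_pred_closed : zmod_closed span_pred.
Proof.
split=> [|x y]; first by apply/asboolP; exact: span0.
by move=> /asboolP Px /asboolP Py; apply/asboolP; exact: spanB.
Qed.

HB.instance Definition _ := GRing.isZmodClosed.Build G span_pred span_pred_closed.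

Definition quotient : Type := Quotient.quot span_pred.
HB.instance Definition _ := GRing.Zmodule.on quotient.

Definition cls (x : G) : quotient := \pi_(Quotient.quot span_pred) x.

Lemma cls_is_zmod_morphism : zmod_morphism cls.
Proof. by move=> x y; rewrite /cls raddfB. Qed.
HB.instance Definition _ :=
  GRing.isZmodMorphism.Build G quotient cls cls_is_zmod_morphism.

Lemma cls_eq (x y : G) : cls x = cls y <-> span (x - y).
Proof.
split=> [/eqP|xy]; last apply/eqP.
  by rewrite -Quotient.idealrBE => /asboolP.
by rewrite -Quotient.idealrBE; apply/asboolP.
Qed.

Definition rep (u : quotient) : G := repr (u : Quotient.quot span_pred).

Lemma repK : cancel rep cls.
Proof. by move=> u; rewrite /cls /rep reprK. Qed.

Lemma cls_surj (u : quotient) : exists x, u = cls x.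
Proof. by exists (rep u); rewrite repK. Qed.

Variable H : zmodType.

(* The homomorphism induced by g on the quotient; it is 0 by convention when
   g is not a homomorphism killing P. *)
Definition descends (g : G -> H) : Prop :=
  zmod_morphism g /\ forall x, P x -> g x = 0.

Definition qlift (g : G -> H) (u : quotient) : H :=
  if `[< descends g >] then g (rep u) else 0.

Lemma qliftE (g : G -> H) x : descends g -> qlift g (cls x) = g x.
Proof.
move=> dg; rewrite /qlift; case: asboolP => // -[gB gP].
have g0 : g 0 = 0 by rewrite -[X in g X](subrr 0) gB subrr.
have gs z : span z -> g z = 0.
  by elim=> [//|z' /gP//|z1 z2 _ g1 _ g2]; rewrite gB g1 g2 subrr.
apply/eqP; rewrite -subr_eq0 -gB; apply/eqP/gs; apply/cls_eq.
by rewrite repK.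
Qed.

Lemma qlift_is_zmod_morphism g : zmod_morphism (qlift g).
Proof.
have [dg|ndg] := pselect (descends g); last first.
  by move=> x y; rewrite /qlift (asboolF ndg) subrr.
move=> u v; have [x ->] := cls_surj u; have [y ->] := cls_surj v.
by rewrite -raddfB !qliftE //; case: dg => ->.
Qed.
HB.instance Definition _ g :=
  GRing.isZmodMorphism.Build quotient H (qlift g) (qlift_is_zmod_morphism g).

End Quotient.

(* The abelian group with generators X subject to the relations rel = 0. *)
Section Presentation.
Variables (X : Type) (rel : {freeg {classic X} / int} -> Prop).

Definition pres : Type := quotient rel.
HB.instance Definition _ := GRing.Zmodule.on pres.

Definition gen (x : X) : pres := cls rel << (x : {classic X}) >>.

Variable H : zmodType.

Definition fext (g : X -> H) : {freeg {classic X} / int} -> H :=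
  fglift (M := zmodule H) (g : {classic X} -> zmodule H).

Definition plift (g : X -> H) : pres -> H := qlift (P := rel) (fext g).
HB.instance Definition _ g := GRing.Additive.on (plift g).

Lemma plift0 g : plift g 0 = 0. Proof. exact: raddf0. Qed.
Lemma pliftB g : {morph plift g : u v / u - v}. Proof. exact: raddfB. Qed.

Lemma fext_is_zmod_morphism (g : X -> H) : zmod_morphism (fext g).
Proof.
move=> x y.
exact: (lift_is_additive (M := zmodule H) (g : {classic X} -> zmodule H)).
Qed.
HB.instance Definition _ g := GRing.isZmodMorphism.Build {freeg {classic X} / int} H (fext g) (fext_is_zmod_morphism g).

Lemma fextU (g : X -> H) x : fext g << (x : {classic X}) >> = g x.
Proof. by rewrite /fext liftU scale1r. Qed.

Definition respects (g : X -> H) : Prop := forall w, rel w -> fext g w = 0.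

Lemma pliftE (g : X -> H) x : respects g -> plift g (gen x) = g x.
Proof. 
by move=> rg; rewrite /plift /gen qliftE ?fextU //; split=> //; apply: raddfB.
Qed.

End Presentation.

Lemma pres_ind (X : Type) (rel : {freeg {classic X} / int} -> Prop)
    (Q : pres rel -> Prop) :
  Q 0 -> (forall u v, Q u -> Q v -> Q (u - v)) -> (forall x, Q (gen rel x)) ->
  forall u, Q u.
Proof.
move=> Q0 QB Qg u; have [D ->] := cls_surj u.
have QN v : Q v -> Q (- v) by move=> Qv; rewrite -sub0r; exact: QB.
have QD v w : Q v -> Q w -> Q (v + w).
  by move=> Qv Qw; rewrite -[w]opprK; apply/QB/QN.
have QM v (m : int) : Q v -> Q (v *~ m).
  have Qn k : Q v -> Q (v *+ k).
    by move=> Qv; elim: k => [//|k IH]; rewrite mulrS; exact: QD.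
  case: m => m Qv; first by rewrite -pmulrn; exact: (Qn m Qv).
  by rewrite NegzE mulrNz -pmulrn; exact: QN (Qn m.+1 Qv).
rewrite -(freeg_sumE D) raddf_sum; elim/big_ind: _ => //= x _.
by rewrite -[coeff x D]intz -freegU_mulz raddfMz; apply: QM; exact: Qg.
Qed.

Section Dfwith.
Variables (I : eqType) (T : I -> Type).
Implicit Types x : forall i, T i.

Lemma dfwith_id x i (u v : T i) : dfwith (dfwith x u) v = dfwith x v.
Proof.
apply: functional_extensionality_dep => j.
by case: (dfwithP x v j) => [|k ik]; rewrite ?dfwith_in ?dfwith_out.
Qed.

Lemma dfwith_self x i : dfwith x (x i) = x.
Proof.
by apply: functional_extensionality_dep => j; case: (dfwithP x (x i) j).
Qed.

Lemma dfwithC x i j (u : T i) (v : T j) :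
  i != j -> dfwith (dfwith x u) v = dfwith (dfwith x v) u.
Proof.
move=> ij; apply: functional_extensionality_dep => k.
have [<-|ik] := eqVneq i k.
  by rewrite dfwith_in dfwith_out ?dfwith_in // eq_sym.
rewrite (dfwith_out _ u) //; have [<-|jk] := eqVneq j k.
  by rewrite !dfwith_in.
by rewrite !dfwith_out.
Qed.

End Dfwith.

Section Multiadditive.
Variables (n : nat) (T : 'I_n -> zmodType) (H : zmodType).

Definition multiadditive (g : (forall i, T i) -> H) : Prop :=
  forall x i (u v : T i), g (dfwith x (u + v)) = g (dfwith x u) + g (dfwith x v).

End Multiadditive.

(* R-R-bimodules. *)
Record bimodule_axioms (R : pzRingType) (M : zmodType)
    (l : R -> M -> M) (r : M -> R -> M) : Prop := BimoduleAxioms {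
  lactDr : forall a, {morph l a : x y / x + y};
  lactDl : forall x, {morph l^~ x : a b / a + b};
  lactA : forall a b x, l a (l b x) = l (a * b) x;
  lact1 : forall x, l 1 x = x;
  ractDr : forall x, {morph r x : a b / a + b};
  ractDl : forall a, {morph r^~ a : x y / x + y};
  ractA : forall a b x, r (r x a) b = r x (a * b);
  ract1 : forall x, r x 1 = x;
  lractA : forall a b x, r (l a x) b = l a (r x b)
}.

Record bimodule (R : pzRingType) := Bimodule {
  bmod :> zmodType;
  lact : R -> bmod -> bmod;
  ract : bmod -> R -> bmod;
  bimoduleP : bimodule_axioms lact ract
}.

(* M_0 (x)_R ... (x)_R M_(n-1), for a finite sequence of bimodules. *)
Section Tensor.
Variables (R : pzRingType) (n : nat) (M : 'I_n -> bimodule R).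

Inductive tensor_rel : {freeg {classic forall i, M i} / int} -> Prop :=
| tensor_add (x : forall i, M i) i (u v : M i) :
    tensor_rel (<< (dfwith x (u + v) : {classic _}) >>
                - << (dfwith x u : {classic _}) >>
                - << (dfwith x v : {classic _}) >>)
| tensor_bal (x : forall i, M i) (i j : 'I_n) (a : R) : j = i.+1 :> nat ->
    tensor_rel (<< (dfwith x (ract (x i) a) : {classic _}) >>
                - << (dfwith x (lact a (x j)) : {classic _}) >>).

Definition tensor : Type := pres tensor_rel.
HB.instance Definition _ := GRing.Zmodule.on tensor.

Definition tens (x : forall i, M i) : tensor := gen tensor_rel x.

Definition balanced (H : zmodType) (g : (forall i, M i) -> H) : Prop :=
  forall x (i j : 'I_n) a, j = i.+1 :> nat ->
  g (dfwith x (ract (x i) a)) = g (dfwith x (lact a (x j))).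

Lemma tensor_respects (H : zmodType) (g : (forall i, M i) -> H) :
  multiadditive g -> balanced g -> respects tensor_rel g.
Proof.
move=> gD gb _ [x i u v|x i j a ij]; rewrite !raddfB /= !fextU.
  by rewrite gD -addrA -opprD subrr.
by rewrite (gb _ _ _ _ ij) subrr.
Qed.

Lemma tens_multiadditive : multiadditive tens.
Proof.
move=> x i u v; apply/eqP; rewrite -subr_eq0 opprD addrA /tens /gen -!raddfB.
by apply/eqP; rewrite -[RHS](raddf0 (cls _)); apply/cls_eq; rewrite subr0; apply/span_mem/tensor_add.
Qed.

Lemma tens_balanced : balanced tens.
Proof. by move=> x i j a ij; apply/cls_eq/span_mem/tensor_bal. Qed.

End Tensor.

Section TensorBimodule.
Variables (R : pzRingType) (n : nat) (M : 'I_n.+1 -> bimodule R).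
Local Notation T := (tensor M).

Definition tensor_lact (a : R) : T -> T :=
  plift (fun x => tens (dfwith x (lact a (x ord0)))).
Definition tensor_ract (u : T) (a : R) : T :=
  plift (fun x => tens (dfwith x (ract (x ord_max) a))) u.

Lemma tensor_lactE a x :
  tensor_lact a (tens x) = tens (dfwith x (lact a (x ord0))).
Proof.
have P := bimoduleP; apply: pliftE; apply: tensor_respects => {}x i.
  have [<-|i0] := eqVneq ord0 i => u v.
    by rewrite !dfwith_in !dfwith_id (lactDr (P _ _)) tens_multiadditive.
  rewrite !(dfwith_out _ _ (i := i)) 1?eq_sym //.
  by rewrite !(dfwithC x _ _ (i := i)) 1?eq_sym // tens_multiadditive.
move=> j b ij; have j0 : j != ord0 by rewrite -val_eqE /= ij.
rewrite (dfwith_out _ _ j0) (dfwithC _ _ _ j0).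
have [i0|i0] := eqVneq ord0 i.
  move: ij; rewrite -{i}i0 => ij.
  rewrite dfwith_in dfwith_id -(lractA (P _ _)).
  have := tens_balanced (dfwith x (lact a (x ord0))) b ij.
  by rewrite dfwith_in dfwith_id (dfwith_out _ _ (j := j)) // eq_sym.
rewrite (dfwith_out _ _ (i := i)) 1?eq_sym // (dfwithC _ _ _ (i := i)) 1?eq_sym //.
have := tens_balanced (dfwith x (lact a (x ord0))) b ij.
by rewrite !dfwith_out // eq_sym.
Qed.

Lemma tensor_ractE x a :
  tensor_ract (tens x) a = tens (dfwith x (ract (x ord_max) a)).
Proof.
have P := bimoduleP; apply: pliftE; apply: tensor_respects => {}x i.
  have [<-|i0] := eqVneq ord_max i => u v.
    by rewrite !dfwith_in !dfwith_id (ractDl (P _ _)) tens_multiadditive.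
  rewrite !(dfwith_out _ _ (i := i)) 1?eq_sym //.
  by rewrite !(dfwithC x _ _ (i := i)) 1?eq_sym // tens_multiadditive.
move=> j b ij; have i0 : i != ord_max.
  by rewrite -val_eqE /=; have := ltn_ord j; rewrite ij ltnS; case: ltngtP.
rewrite (dfwith_out _ _ i0) (dfwithC _ _ _ i0).
have [j0|j0] := eqVneq ord_max j.
  move: ij; rewrite -{j}j0 => ij.
  rewrite dfwith_in dfwith_id (lractA (P _ _)).
  have := tens_balanced (dfwith x (ract (x ord_max) a)) b ij.
  by rewrite dfwith_in dfwith_id (dfwith_out _ _ (j := i)) // eq_sym.
rewrite (dfwith_out _ _ (i := j)) 1?eq_sym // (dfwithC _ _ _ (i := j)) 1?eq_sym //.
have := tens_balanced (dfwith x (ract (x ord_max) a)) b ij.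
by rewrite !dfwith_out // eq_sym.
Qed.

Lemma tensor_bimoduleP : bimodule_axioms tensor_lact tensor_ract.
Proof.
have P := bimoduleP; split.
- by move=> a; exact: raddfD.
- move=> u a b; elim/pres_ind: u => [|u v hu hv|x] /=.
  + by rewrite /tensor_lact !plift0 addr0.
  + by move: hu hv; rewrite /tensor_lact !pliftB => -> ->; rewrite opprD addrACA.
  + by rewrite !tensor_lactE (lactDl (P _ _)) tens_multiadditive.
- move=> a b u; elim/pres_ind: u => [|u v hu hv|x].
  + by rewrite /tensor_lact !plift0.
  + by move: hu hv; rewrite /tensor_lact !pliftB => -> ->.
  + by rewrite !tensor_lactE dfwith_id dfwith_in (lactA (P _ _)).
- move=> u; elim/pres_ind: u => [|u v hu hv|x].
  + by rewrite /tensor_lact !plift0.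
  + by move: hu hv; rewrite /tensor_lact !pliftB => -> ->.
  + by rewrite !tensor_lactE (lact1 (P _ _)) dfwith_self.
- move=> u a b; elim/pres_ind: u => [|u v hu hv|x] /=.
  + by rewrite /tensor_ract !plift0 addr0.
  + by move: hu hv; rewrite /tensor_ract !pliftB => -> ->; rewrite opprD addrACA.
  + by rewrite !tensor_ractE (ractDr (P _ _)) tens_multiadditive.
- by move=> a; exact: raddfD.
- move=> a b u; elim/pres_ind: u => [|u v hu hv|x].
  + by rewrite /tensor_ract !plift0.
  + by move: hu hv; rewrite /tensor_ract !pliftB => -> ->.
  + by rewrite !tensor_ractE dfwith_id dfwith_in (ractA (P _ _)).
- move=> u; elim/pres_ind: u => [|u v hu hv|x].
  + by rewrite /tensor_ract !plift0.
  + by move: hu hv; rewrite /tensor_ract !pliftB => -> ->.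
  + by rewrite !tensor_ractE (ract1 (P _ _)) dfwith_self.
- move=> a b u; elim/pres_ind: u => [|u v hu hv|x].
  + by rewrite /tensor_ract /tensor_lact !plift0.
  + by move: hu hv; rewrite /tensor_ract /tensor_lact !pliftB => -> ->.
  + rewrite tensor_lactE !tensor_ractE tensor_lactE.
    have [m0|m0] := eqVneq (ord_max : 'I_n.+1) ord0.
      move: m0 => m0; rewrite m0 !dfwith_in !dfwith_id.
      by rewrite (lractA (P _ _)).
    rewrite (dfwith_out _ _ (j := ord_max)) 1?eq_sym // (dfwith_out _ _ m0).
    by rewrite dfwithC // eq_sym.
Qed.

Definition tensor_bimodule : bimodule R := Bimodule tensor_bimoduleP.

End TensorBimodule.

Section Amitsur.
Variables (R S : pzRingType) (f : {rmorphism R -> S}).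

Lemma ring_bimoduleP :
  bimodule_axioms (fun a (s : S) => f a * s) (fun (s : S) a => s * f a).
Proof.
split=> [a x y|x a b|a b x|x|x a b|a x y|a b x|x|a b x].
- exact: mulrDr.
- by rewrite rmorphD mulrDl.
- by rewrite rmorphM mulrA.
- by rewrite rmorph1 mul1r.
- by rewrite rmorphD mulrDr.
- exact: mulrDl.
- by rewrite rmorphM mulrA.
- by rewrite rmorph1 mulr1.
- by rewrite mulrA.
Qed.

Definition ring_bimodule : bimodule R := Bimodule ring_bimoduleP.

(* S/R is the cokernel of f, a bimodule. *)
Definition from_base (s : S) : Prop := exists a, s = f a.

Local Notation SR := (quotient from_base).
Local Notation pr := (cls from_base).

Definition SR_lact (a : R) : SR -> SR := qlift (fun s => pr (f a * s)).
Definition SR_ract (u : SR) (a : R) : SR := qlift (fun s => pr (s * f a)) u.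

Lemma pr_base a : pr (f a) = 0.
Proof.
rewrite -[RHS](raddf0 pr); apply/cls_eq; rewrite subr0.
by apply: span_mem; exists a.
Qed.

Lemma SR_lactE a s : SR_lact a (pr s) = pr (f a * s).
Proof.
apply: qliftE; split=> [x y|_ [b ->]]; first by rewrite mulrBr raddfB.
by rewrite -rmorphM pr_base.
Qed.

Lemma SR_ractE s a : SR_ract (pr s) a = pr (s * f a).
Proof.
apply: (qliftE (g := fun s => pr (s * f a))).
split=> [x y|_ [b ->]]; first by rewrite mulrBl raddfB.
by rewrite -rmorphM pr_base.
Qed.

Lemma SR_bimoduleP : bimodule_axioms SR_lact SR_ract.
Proof.
have P := ring_bimoduleP; split.
- by move=> a; exact: raddfD.
- move=> u a b; have [s ->] := cls_surj u.
  by rewrite !SR_lactE (lactDl P) raddfD.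
- by move=> a b u; have [s ->] := cls_surj u; rewrite !SR_lactE (lactA P).
- by move=> u; have [s ->] := cls_surj u; rewrite !SR_lactE (lact1 P).
- move=> u a b; have [s ->] := cls_surj u.
  by rewrite !SR_ractE (ractDr P) raddfD.
- by move=> a; exact: raddfD.
- by move=> a b u; have [s ->] := cls_surj u; rewrite !SR_ractE (ractA P).
- by move=> u; have [s ->] := cls_surj u; rewrite !SR_ractE (ract1 P).
- move=> a b u; have [s ->] := cls_surj u.
  by rewrite SR_lactE !SR_ractE SR_lactE (lractA P).
Qed.

Definition SR_bimodule : bimodule R := Bimodule SR_bimoduleP.

End Amitsur.

Section Words.
Variable S : pzRingType.

(* Insert 1 in position i, for i <= n + 1. *)
Definition insert1 n (i : nat) (s : 'I_n.+1 -> S) : 'I_n.+2 -> S := fun k =>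
  if (k < i)%N then s (inord k) else if k == i :> nat then 1 else s (inord k.-1).

(* Multiply the entries in positions j and j + 1, for j <= n. *)
Definition merge n (j : nat) (s : 'I_n.+2 -> S) : 'I_n.+1 -> S := fun k =>
  if (k < j)%N then s (inord k)
  else if k == j :> nat then s (inord k) * s (inord k.+1) else s (inord k.+1).

Definition juxt n m (s : 'I_n.+1 -> S) (t : 'I_m.+1 -> S) : 'I_(n + m).+2 -> S :=
  fun k => if (k <= n)%N then s (inord k) else t (inord (k - n.+1)%N).

Definition mulpairs n (s : 'I_(n + n).+2 -> S) : 'I_n.+1 -> S :=
  fun k => s (inord k.*2) * s (inord k.*2.+1).

Definition upd n (s : 'I_n -> S) (i : 'I_n) (w : S) : 'I_n -> S :=
  @dfwith _ (fun=> S) s i w.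

Lemma updE n s (i : 'I_n) w k : upd s i w k = if i == k :> nat then w else s k.
Proof.
rewrite /upd; case: (dfwithP s w k) => [|j ij]; first by rewrite eqxx.
by rewrite (negPf (ij : (val i != val j))).
Qed.

Lemma inord_at n (s : 'I_n.+1 -> S) (i : 'I_n.+1) (k : nat) :
  k = i -> s (inord k) = s i.
Proof. by move->; rewrite inord_val. Qed.

Lemma insert1_upd n p (s : 'I_n.+1 -> S) i w : (p <= n.+1)%N ->
  insert1 p (upd s i w) = upd (insert1 p s) (inord (bump p i)) w.
Proof.
move=> pn; apply: funext => k; have := ltn_ord k; have := ltn_ord i => i_n kn.
rewrite /insert1 !updE (inordK (_ : bump p i < n.+2)%N) /bump; last by lia.
have [kp|kp] := ltnP k p.
  by rewrite inordK; [repeat case: ifP => ?; (done || lia)|lia].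
have [kp'|kp'] := eqVneq (k : nat) p.
  by repeat case: ifP => ?; (done || lia).
by rewrite inordK; [repeat case: ifP => ?; (done || lia)|lia].
Qed.


Lemma insert1_at n p (s : 'I_n.+1 -> S) (i : 'I_n.+1) : (p <= n.+1)%N ->
  insert1 p s (inord (bump p i)) = s i.
Proof.
have := ltn_ord i => i_n pn; rewrite /insert1 (inordK (_ : _ < n.+2)%N) /bump.
  by repeat case: ifP => ?; (lia || (by rewrite (inord_at s (i := i)) //; lia)).
by lia.
Qed.

Lemma insert1_at1 n p (s : 'I_n.+1 -> S) : (p <= n.+1)%N ->
  insert1 p s (inord p) = 1.
Proof. by move=> pn; rewrite /insert1 inordK // ltnn eqxx. Qed.

Lemma merge_upd n p (s : 'I_n.+2 -> S) i w : (p <= n)%N ->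
  merge p (upd s i w) = upd (merge p s) (inord (unbump p i))
    (if i == p :> nat then w * s (inord p.+1)
     else if i == p.+1 :> nat then s (inord p) * w else w).
Proof.
move=> pn; apply: funext => k; have := ltn_ord k; have := ltn_ord i => i_n kn.
rewrite /merge !updE (inordK (_ : unbump p i < n.+1)%N) /unbump; last by lia.
have [kp|kp] := ltnP k p.
  by rewrite inordK; [repeat case: ifP => ?; (done || lia)|lia].
have [kp'|kp'] := eqVneq (k : nat) p; last first.
  by rewrite inordK; [repeat case: ifP => ?; (done || lia)|lia].
rewrite !inordK; try lia.
by rewrite kp'; repeat case: ifP => ?; (done || lia).
Qed.

Lemma merge_at n p (s : 'I_n.+2 -> S) (i : 'I_n.+2) : (p <= n)%N ->
  merge p s (inord (unbump p i)) =
    if i == p :> nat then s i * s (inord p.+1)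
    else if i == p.+1 :> nat then s (inord p) * s i else s i.
Proof.
move=> pn; have := ltn_ord i => i_n.
rewrite /merge (inordK (_ : unbump p i < n.+1)%N) /unbump; last by lia.
repeat case: ifP => ?; try lia; try (congr (_ * _));
  first [by rewrite (inord_at s (i := i)) //; lia | by congr (s (inord _)); lia].
Qed.

Lemma juxt_updl n m (s : 'I_n.+1 -> S) (t : 'I_m.+1 -> S) i w :
  juxt (upd s i w) t = upd (juxt s t) (inord i) w.
Proof.
apply: funext => k; have := ltn_ord k; have := ltn_ord i => i_n kn.
rewrite /juxt !updE (inordK (_ : i < (n + m).+2)%N); last by lia.
have [kp|kp] := leqP k n; last by case: ifP => ?; (done || lia).
by rewrite inordK.
Qed.

Lemma juxt_updr n m (s : 'I_n.+1 -> S) (t : 'I_m.+1 -> S) i w :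
  juxt s (upd t i w) = upd (juxt s t) (inord (n.+1 + i)) w.
Proof.
apply: funext => k; have := ltn_ord k; have := ltn_ord i => i_n kn.
rewrite /juxt !updE (inordK (_ : n.+1 + i < (n + m).+2)%N); last by lia.
have [kp|kp] := leqP k n; first by case: ifP => ?; (done || lia).
by rewrite inordK; [repeat case: ifP => ?; (done || lia)|lia].
Qed.

Lemma juxt_atl n m (s : 'I_n.+1 -> S) (t : 'I_m.+1 -> S) (i : 'I_n.+1) :
  juxt s t (inord i) = s i.
Proof.
have := ltn_ord i => i_n; rewrite /juxt inordK; last by lia.
by case: ifP => ?; [rewrite (inord_at s (i := i))|lia].
Qed.

Lemma juxt_atr n m (s : 'I_n.+1 -> S) (t : 'I_m.+1 -> S) (i : 'I_m.+1) :
  juxt s t (inord (n.+1 + i)) = t i.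
Proof.
have := ltn_ord i => i_n; rewrite /juxt inordK; last by lia.
by case: ifP => ?; [lia|rewrite (inord_at t (i := i)) //; lia].
Qed.

Lemma mulpairs_upd n (s : 'I_(n + n).+2 -> S) (i : 'I_(n + n).+2) w :
  mulpairs (upd s i w) = upd (mulpairs s) (inord i./2)
    (if odd i then s (inord i.-1) * w else w * s (inord i.+1)).
Proof.
apply: funext => k; have := ltn_ord k; have := ltn_ord i => i_n kn.
rewrite /mulpairs !updE; do !rewrite inordK; try lia.
case: (ifP (odd i)) => ?; repeat case: ifP => ?; try (done || lia);
  by congr (_ * _); congr (s (inord _)); lia.
Qed.

End Words.

Section Amitsur.
Variables (R S : pzRingType) (f : {rmorphism R -> S}).

Section Conditions.
Variables (H : zmodType) (n : nat) (g : ('I_n -> S) -> H).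

Definition madd : Prop :=
  forall s i u v, g (upd s i (u + v)) = g (upd s i u) + g (upd s i v).
Definition bal : Prop := forall s (i j : 'I_n) a, j = i.+1 :> nat ->
  g (upd s i (s i * f a)) = g (upd s j (f a * s j)).
Definition vanish (P : pred nat) : Prop :=
  forall s (i : 'I_n) a, P i -> g (upd s i (f a)) = 0.

End Conditions.

Lemma madd_insert1 (H : zmodType) n (g : ('I_n.+2 -> S) -> H) p : (p <= n.+1)%N ->
  madd g -> madd (fun s => g (insert1 p s)).
Proof. by move=> pn gD s i u v; rewrite !insert1_upd // gD. Qed.

Lemma bal_insert1 (H : zmodType) n (g : ('I_n.+2 -> S) -> H) p : (p <= n.+1)%N ->
  bal g -> bal (fun s => g (insert1 p s)).
Proof.
move=> pn gb s i j a ij; have := ltn_ord j => jn; rewrite !insert1_upd //.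
rewrite -{1}(insert1_at s i pn) -(insert1_at s j pn).
have [pj|pj] := eqVneq p j; last first.
  by apply: gb; rewrite !inordK /bump; lia.
have pE : inord (bump p i) = inord i :> 'I_n.+2 by congr inord; rewrite /bump; lia.
have jE : inord (bump p j) = inord j.+1 :> 'I_n.+2 by congr inord; rewrite /bump; lia.
rewrite pE jE (gb _ _ (inord p)); last by rewrite !inordK; lia.
have := gb (insert1 p s) (inord p) (inord j.+1) a.
rewrite insert1_at1 // mul1r mulr1; apply.
by rewrite !inordK; lia.
Qed.

Lemma madd_merge (H : zmodType) n (g : ('I_n.+1 -> S) -> H) p : (p <= n)%N ->
  madd g -> madd (fun s => g (merge p s)).
Proof.
move=> pn gD s i u v; rewrite !merge_upd //.
by case: ifP => _; [|case: ifP => _]; rewrite ?mulrDl ?mulrDr gD.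
Qed.

Lemma bal_merge (H : zmodType) n (g : ('I_n.+1 -> S) -> H) p : (p <= n)%N ->
  bal g -> bal (fun s => g (merge p s)).
Proof.
move=> pn gb s i j a ij; have := ltn_ord j => jn; rewrite !merge_upd //.
have [ip|ip] := eqVneq (i : nat) p.
  have -> : (j == p :> nat) = false by lia.
  have -> : j == p.+1 :> nat by lia.
  rewrite (inord_at s (i := j)) 1?(inord_at s (i := i)) //; last by lia.
  by congr (g (upd _ (inord _) _)); rewrite ?mulrA // /unbump; lia.
have -> : (j == p.+1 :> nat) = false by lia.
transitivity (g (upd (merge p s) (inord (unbump p i))
    (merge p s (inord (unbump p i)) * f a))).
  by rewrite merge_at // (negPf ip); case: ifP => _; rewrite ?mulrA.
rewrite (gb _ _ (inord (unbump p j))); last by rewrite !inordK /unbump; lia.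
rewrite merge_at //; case: ifP => _; rewrite ?mulrA //.
by have -> : (j == p.+1 :> nat) = false by lia.
Qed.

Lemma madd_juxtl (H : zmodType) n m (g : ('I_(n + m).+2 -> S) -> H) t :
  madd g -> madd (fun s : 'I_n.+1 -> S => g (juxt s t)).
Proof. by move=> gD s i u v; rewrite !juxt_updl gD. Qed.

Lemma madd_juxtr (H : zmodType) n m (g : ('I_(n + m).+2 -> S) -> H) s :
  madd g -> madd (fun t : 'I_m.+1 -> S => g (juxt s t)).
Proof. by move=> gD t i u v; rewrite !juxt_updr gD. Qed.

Lemma bal_juxtl (H : zmodType) n m (g : ('I_(n + m).+2 -> S) -> H) t :
  bal g -> bal (fun s : 'I_n.+1 -> S => g (juxt s t)).
Proof.
move=> gb s i j a ij; have := ltn_ord j => jn; rewrite !juxt_updl.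
rewrite -{1}(juxt_atl s t i) -(juxt_atl s t j).
by apply: gb; rewrite !inordK; lia.
Qed.

Lemma bal_juxtr (H : zmodType) n m (g : ('I_(n + m).+2 -> S) -> H) s :
  bal g -> bal (fun t : 'I_m.+1 -> S => g (juxt s t)).
Proof.
move=> gb t i j a ij; have := ltn_ord j => jn; rewrite !juxt_updr.
rewrite -{1}(juxt_atr s t i) -(juxt_atr s t j).
by apply: gb; rewrite !inordK; lia.
Qed.

Lemma madd_mulpairs (H : zmodType) n (g : ('I_n.+1 -> S) -> H) :
  madd g -> madd (fun s => g (mulpairs s)).
Proof.
move=> gD s i u v; rewrite !mulpairs_upd.
by case: ifP => _; rewrite ?mulrDl ?mulrDr gD.
Qed.

Lemma bal_mulpairs (H : zmodType) n (g : ('I_n.+1 -> S) -> H) :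
  bal g -> bal (fun s => g (mulpairs s)).
Proof.
move=> gb s i j a ij; have := ltn_ord j => jn; rewrite !mulpairs_upd.
case: (boolP (odd i)) => oi; last first.
  have -> : odd j by rewrite ij /= oi.
  rewrite (inord_at s (i := j)) // (inord_at s (i := i)); last by lia.
  by rewrite mulrA; congr (g (upd _ (inord _) _)); lia.
have -> : odd j = false by rewrite ij /= oi.
transitivity (g (upd (mulpairs s) (inord i./2)
    (mulpairs s (inord i./2) * f a))).
  rewrite /mulpairs inordK ?mulrA; last by lia.
  rewrite [s (inord i./2.*2.+1)](inord_at s (i := i)); last by lia.
  by congr (g (upd _ _ (s (inord _) * _ * _))); lia.
rewrite (gb _ _ (inord j./2)); last by rewrite !inordK; lia.
rewrite /mulpairs (inordK (_ : j./2 < n.+1)%N) ?mulrA; last by lia.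
rewrite (inord_at s (i := j)); last by lia.
by congr (g (upd _ _ (_ * s (inord _)))); lia.
Qed.

Definition amitsur n : bimodule R :=
  tensor_bimodule (fun _ : 'I_n.+1 => ring_bimodule f).

Definition am n (s : 'I_n.+1 -> S) : amitsur n :=
  @tens R n.+1 (fun=> ring_bimodule f) s.

Definition am_lift n (H : zmodType) (g : ('I_n.+1 -> S) -> H) : amitsur n -> H :=
  plift g.
HB.instance Definition _ n H g := GRing.Additive.on (@am_lift n H g).

Lemma am_madd n : madd (@am n).
Proof. exact: (@tens_multiadditive R n.+1 (fun=> ring_bimodule f)). Qed.

Lemma am_bal n : bal (@am n).
Proof. exact: (@tens_balanced R n.+1 (fun=> ring_bimodule f)). Qed.

Lemma am_liftE n H g (s : 'I_n.+1 -> S) :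
  madd g -> bal g -> @am_lift n H g (am s) = g s.
Proof. by move=> gD gb; apply: pliftE; exact: (@tensor_respects R n.+1 (fun=> ring_bimodule f)). Qed.

Definition am_coface n (i : nat) : amitsur n -> amitsur n.+1 :=
  am_lift (fun s => am (insert1 i s)).

Definition am_codeg n (j : nat) : amitsur n.+1 -> amitsur n :=
  am_lift (fun s => am (merge j s)).

Lemma am_cofaceE n i s : (i <= n.+1)%N ->
  @am_coface n i (am s) = am (insert1 i s).
Proof.
move=> i_n; apply: am_liftE; first exact/madd_insert1/am_madd.
exact/bal_insert1/am_bal.
Qed.

Lemma am_codegE n j s : (j <= n)%N -> @am_codeg n j (am s) = am (merge j s).
Proof.
move=> jn; apply: am_liftE; first exact/madd_merge/am_madd.
exact/bal_merge/am_bal.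
Qed.

(* tau applied to the factors in positions j and j + 1. *)
Definition nuss_tau n (j : nat) (u : amitsur n.+1) : amitsur n.+1 :=
  am_coface j.+1 (am_codeg j u) + am_coface j (am_codeg j u) - u.

(* The adjacent transpositions, in the order in which they are applied, which
   bring a_0 ... a_n b_0 ... b_n to the order a_0 b_0 ... a_n b_n: for
   k = 0, ..., n, move b_k from position n + 1 + k to position 2 k + 1. *)
Definition shuffle n : seq nat :=
  flatten [seq rev (iota k.*2.+1 (n - k)) | k <- iota 0 n.+1].

Definition nuss_shuffle n (u : amitsur (n + n).+1) : amitsur (n + n).+1 :=
  foldl (fun v j => nuss_tau j v) u (shuffle n).

Definition am_juxt n m (u : amitsur n) (v : amitsur m) : amitsur (n + m).+1 :=
  am_lift (fun s => am_lift (fun t => am (juxt s t)) v) u.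

Definition am_mulpairs n : amitsur (n + n).+1 -> amitsur n :=
  am_lift (fun s => am (mulpairs s)).

Definition nuss_mul n (u v : amitsur n) : amitsur n :=
  am_mulpairs (nuss_shuffle (am_juxt u v)).

Definition nuss_one n : amitsur n := am (fun=> 1).

Lemma am_juxtE n m (s : 'I_n.+1 -> S) (t : 'I_m.+1 -> S) :
  am_juxt (am s) (am t) = am (juxt s t).
Proof.
have E s' : am_lift (fun t => am (juxt s' t)) (am t) = am (juxt s' t).
  apply: am_liftE; first exact/madd_juxtr/am_madd.
  exact/bal_juxtr/am_bal.
rewrite /am_juxt am_liftE ?E // => s'; first by move=> i x y; rewrite !E; exact: (madd_juxtl t (@am_madd _)).
by move=> i j a ij; rewrite !E; exact: (bal_juxtl t (@am_bal _)).
Qed.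

Lemma am_mulpairsE n (s : 'I_(n + n).+2 -> S) :
  am_mulpairs (am s) = am (mulpairs s).
Proof.
apply: am_liftE; first exact/madd_mulpairs/am_madd.
exact/bal_mulpairs/am_bal.
Qed.

End Amitsur.

Definition biadditive (A B H : zmodType) (g : A -> B -> H) : Prop :=
  (forall b, {morph g^~ b : x y / x + y}) /\ (forall a, {morph g a : x y / x + y}).

Lemma multiadditive0 n (T : 'I_n -> zmodType) (H : zmodType)
    (g : (forall i, T i) -> H) x i : multiadditive g -> g (dfwith x (0 : T i)) = 0.
Proof.
by move=> gD; apply: (addrI (g (dfwith x (0 : T i)))); rewrite -gD !addr0.
Qed.

Section Forms.
Variables (R S : pzRingType) (f : {rmorphism R -> S}).

(* The factors of S (x)_R (S/R) (x)_R ... (x)_R (S/R). *)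
Definition om_factor (i : nat) : bimodule R :=
  if i is 0 then ring_bimodule f else SR_bimodule f.

Definition om_cls (i : nat) : S -> om_factor i :=
  if i is 0 then id else cls (from_base f).

Definition om_rep (i : nat) : om_factor i -> S :=
  match i return om_factor i -> S with
  | 0 => id
  | _.+1 => fun u => @rep S (from_base f) u
  end.

Definition omega n : bimodule R := tensor_bimodule (fun i : 'I_n.+1 => om_factor i).

(* s_0 ds_1 ... ds_n *)
Definition form n (s : 'I_n.+1 -> S) : omega n :=
  tens (fun i : 'I_n.+1 => om_cls i (s i)).

Lemma om_repK i : cancel (@om_rep i) (@om_cls i).
Proof. by case: i => [|i] u //=; exact: repK. Qed.

Lemma om_clsD i : {morph om_cls i : x y / x + y}.
Proof. by case: i => [|i] x y //=; exact: raddfD. Qed.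

Lemma om_clsl i a s : om_cls i (f a * s) = lact a (om_cls i s).
Proof. by case: i => [|i] //=; rewrite SR_lactE. Qed.

Lemma om_clsr i s a : om_cls i (s * f a) = ract (om_cls i s) a.
Proof. by case: i => [|i] //=; rewrite SR_ractE. Qed.

Lemma om_cls_upd n (s : 'I_n.+1 -> S) i w :
  (fun k : 'I_n.+1 => om_cls k (upd s i w k)) =
  dfwith (fun k : 'I_n.+1 => om_cls k (s k)) (om_cls i w).
Proof.
apply: functional_extensionality_dep => k; rewrite updE.
case: dfwithP => [|j ij]; first by rewrite eqxx.
by rewrite (negPf (ij : (val i != val j))).
Qed.

Lemma form_madd n : madd (@form n).
Proof.
by move=> s i u v; rewrite /form !om_cls_upd om_clsD tens_multiadditive.
Qed.

Lemma form_bal n : bal f (@form n).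
Proof.
move=> s i j a ij; rewrite /form !om_cls_upd om_clsl om_clsr.
exact: (tens_balanced (M := fun i : 'I_n.+1 => om_factor i)).
Qed.

Lemma form_vanish n : vanish f (@form n) (fun k => 0 < k)%N.
Proof.
move=> s i a /= i0; rewrite /form om_cls_upd.
suff -> : om_cls i (f a) = 0 by apply: multiadditive0; exact: tens_multiadditive.
by case: (nat_of_ord i) i0 => // k _; exact: pr_base.
Qed.

Section Lift.
Variables (n : nat) (H : zmodType) (F : ('I_n.+1 -> S) -> H).

Definition om_lift : omega n -> H :=
  plift (fun x => F (fun i => om_rep (x i))).
HB.instance Definition _ := GRing.Additive.on om_lift.

Hypotheses (FD : madd F) (Fb : bal f F) (F0 : vanish f F (fun k => 0 < k)%N).

Let F_cls1 s (i : 'I_n.+1) u v :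
  om_cls i u = om_cls i v -> F (upd s i u) = F (upd s i v).
Proof.
have E0 : F (upd s i 0) = 0 by apply: (addrI (F (upd s i 0))); rewrite -FD !addr0.
have EB x y : F (upd s i (x - y)) = F (upd s i x) - F (upd s i y).
  by apply/eqP; rewrite eq_sym subr_eq -FD subrK.
have : forall a, (0 < i)%N -> F (upd s i (f a)) = 0 by move=> a; apply: F0.
case: (nat_of_ord i) => [_ /= -> //|k] Fi /= /cls_eq uv.
apply/eqP; rewrite -subr_eq0 -EB; apply/eqP.
elim: uv => [//|_ [a ->]|x y _ Fx _ Fy]; first exact: Fi.
by rewrite EB Fx Fy subrr.
Qed.

Let F_cls s t :
  (forall i : 'I_n.+1, om_cls i (s i) = om_cls i (t i)) -> F s = F t.
Proof.
move=> st; pose mix m : 'I_n.+1 -> S := fun k => if (k < m)%N then t k else s k.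
have -> : t = mix n.+1 by apply: funext => k; rewrite /mix ltn_ord.
have {1}-> : s = mix 0%N by apply: funext => k.
suff mixE m : (m <= n.+1)%N -> F (mix 0%N) = F (mix m) by exact: mixE.
elim: m => [//|m IH] mn; rewrite {}IH; last by lia.
have mE : inord m = m :> nat := inordK mn.
have -> : mix m = upd (mix m) (inord m) (s (inord m)).
  apply: funext => k; rewrite updE mE /mix; case: eqP => // mk.
  by rewrite -mk ltnn (inord_at s (i := k)).
have -> : mix m.+1 = upd (mix m) (inord m) (t (inord m)).
  apply: funext => k; rewrite updE mE /mix; case: eqP => mk.
    by rewrite -mk ltnSn (inord_at t (i := k)).
  by repeat case: ifP => ?; (done || lia).
exact: F_cls1.
Qed.

Lemma om_liftE s : om_lift (form s) = F s.
Proof.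
have repU (x : forall i : 'I_n.+1, om_factor i) i u :
    (fun k => om_rep (dfwith x u k)) =
    upd (fun k : 'I_n.+1 => om_rep (x k)) i (om_rep (u : om_factor i)).
  apply: funext => k; rewrite updE.
  case: dfwithP => [|j ij]; first by rewrite eqxx.
  by rewrite (negPf (ij : (val i != val j))).
rewrite /om_lift pliftE; first by apply: F_cls => i; rewrite om_repK.
apply: tensor_respects => [x i u v|x i j a ij]; rewrite !repU.
  by rewrite -FD; apply: F_cls1; rewrite om_clsD !om_repK.
transitivity (F (upd (fun k : 'I_n.+1 => om_rep (x k)) i (om_rep (x i) * f a))).
  by apply: F_cls1; rewrite om_clsr !om_repK.
by rewrite (Fb _ _ ij); apply: F_cls1; rewrite om_clsl !om_repK.
Qed.

End Lift.

Definition om_d n : omega n -> omega n.+1 :=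
  om_lift (fun s => form (insert1 0 s)).

Lemma om_dE n (s : 'I_n.+1 -> S) : om_d (form s) = form (insert1 0 s).
Proof.
apply: om_liftE; [exact/madd_insert1/form_madd|exact/bal_insert1/form_bal|].
move=> t i a /= i0; rewrite insert1_upd //; apply: form_vanish.
by rewrite inordK /bump; have := ltn_ord i; lia.
Qed.

(* (s_0 ds_1 ... ds_n) (s_(n+1) ds_(n+2) ... ds_(n+m+1)) =
   sum_(i <= n) (-1)^(n-i) s_0 ds_1 ... d(s_i s_(i+1)) ... ds_(n+m+1),
   where the summand for i = 0 is (-1)^n s_0 s_1 ds_2 ... ds_(n+m+1). *)
Definition om_mul_form n m (u : 'I_(n + m).+2 -> S) : omega (n + m) :=
  \sum_(i < n.+1) form (merge i u) *~ (-1) ^+ (n - i).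

Definition om_mul n m (w : omega n) (z : omega m) : omega (n + m) :=
  om_lift (fun s => om_lift (fun t => om_mul_form (juxt s t)) z) w.

Definition om_one : omega 0 := form (fun=> 1).

Lemma om_mul_form_madd n m : madd (@om_mul_form n m).
Proof.
move=> s i u v; rewrite /om_mul_form -big_split; apply: eq_bigr => k _ /=.
rewrite -mulrzDl; congr (_ *~ _).
by apply: madd_merge; [have := ltn_ord k; lia|exact: form_madd].
Qed.

Lemma om_mul_form_bal n m : bal f (@om_mul_form n m).
Proof.
move=> s i j a ij; apply: eq_bigr => k _ /=; congr (_ *~ _).
by apply: bal_merge ij; [have := ltn_ord k; lia|exact: form_bal].
Qed.

Lemma om_mul_form_vanish n m :
  vanish f (@om_mul_form n m) (fun j => (0 < j)%N && (j != n.+1)).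
Proof.
move=> u j a /= /andP[j0 jn]; have := ltn_ord j => jnm.
have V (i : 'I_n.+1) : i != j :> nat -> i.+1 != j :> nat ->
    form (merge i (upd u j (f a))) = 0.
  move=> ij i1j; have := ltn_ord i => i_n; rewrite merge_upd; last by lia.
  rewrite eq_sym (negPf ij) eq_sym (negPf i1j).
  by apply: form_vanish; rewrite inordK /unbump; lia.
have [jn1|jn1] := ltnP n j.
  rewrite /om_mul_form big1 // => i _; have := ltn_ord i => i_n.
  by rewrite V ?mul0rz //; lia.
pose i1 : 'I_n.+1 := inord j; pose i2 : 'I_n.+1 := inord j.-1.
have i1E : i1 = j :> nat by rewrite inordK.
have i2E : i2 = j.-1 :> nat by rewrite inordK //; lia.
have i21 : i2 != i1 by rewrite -val_eqE /= i1E i2E; lia.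
rewrite /om_mul_form (bigD1 i1) // (bigD1 i2) //= big1 ?addr0; last first.
  move=> i /andP[]; rewrite -!val_eqE /= i1E i2E => ii1 ii2.
  by rewrite V ?mul0rz //; lia.
have -> : (n - i2)%N = (n - i1).+1 by rewrite i1E i2E; lia.
rewrite exprS mulN1r mulrNz.
suff -> : form (merge i1 (upd u j (f a))) = form (merge i2 (upd u j (f a))).
  by rewrite subrr.
pose z : 'I_(n + m).+1 -> S := fun k => u (inord (bump j k)).
have z1 : z (inord j) = u (inord j.+1).
  by rewrite /z /bump inordK; [congr (u (inord _)); lia|lia].
have z2 : z (inord j.-1) = u (inord j.-1).
  by rewrite /z /bump inordK; [congr (u (inord _)); lia|lia].
transitivity (form (upd z (inord j) (f a * z (inord j)))).
  congr form; rewrite i1E merge_upd ?eqxx ?z1; last by lia.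
  apply: funext => k; rewrite !updE /merge /z /bump /unbump !inordK; try lia.
  by repeat case: ifP => ?; try (done || lia); congr (u (inord _)); lia.
rewrite -(form_bal z (i := inord j.-1)) ?z2; last by rewrite !inordK; lia.
congr form; rewrite i2E merge_upd; last by lia.
have -> : (j == j.-1 :> nat) = false by lia.
have -> : (j == j.-1.+1 :> nat) by lia.
apply: funext => k; rewrite !updE /merge /z /bump /unbump !inordK; try lia.
by repeat case: ifP => ?; try (done || lia); congr (u (inord _)); lia.
Qed.

Lemma omega_ind n (Q : omega n -> Prop) :
  Q 0 -> (forall u v, Q u -> Q v -> Q (u - v)) -> (forall s, Q (form s)) ->
  forall u, Q u.
Proof.
move=> Q0 QB Qf; apply: pres_ind => // x.
have -> : gen _ x = form (fun i => om_rep (x i)) by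
  congr tens; apply: functional_extensionality_dep => i; rewrite om_repK.
exact: Qf.
Qed.

Section MulCond.
Variables n m : nat.
Local Notation F z := (fun s : 'I_n.+1 -> S =>
  om_lift (fun t : 'I_m.+1 -> S => om_mul_form (juxt s t)) z).

Let om_mul_formE s t : F (form t) s = om_mul_form (juxt s t).
Proof.
apply: om_liftE; [exact/madd_juxtr/om_mul_form_madd|exact/bal_juxtr/om_mul_form_bal|].
move=> t' i a /= i0; rewrite juxt_updr; apply: om_mul_form_vanish.
by rewrite inordK; have := ltn_ord i; lia.
Qed.

Let om_mul_cond z : [/\ madd (F z), bal f (F z) & vanish f (F z) (fun k => 0 < k)%N].
Proof.
elim/omega_ind: z => [|z z' [D b v] [D' b' v']|t].
- by split=> [s i x y|s i j a ij|s i a i0]; rewrite !raddf0 ?addr0.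
- split=> [s i x y|s i j a ij|s i a i0]; rewrite !raddfB /=.
  + by rewrite D D' opprD addrACA.
  + by rewrite (b _ _ _ _ ij) (b' _ _ _ _ ij).
  + by rewrite v ?v' ?subrr.
split=> [s i x y|s i j a ij|s i a /= i0]; rewrite !om_mul_formE.
- exact: (madd_juxtl t (@om_mul_form_madd _ _)).
- exact: (bal_juxtl t (@om_mul_form_bal _ _)).
rewrite juxt_updl; apply: om_mul_form_vanish.
by rewrite inordK; have := ltn_ord i; lia.
Qed.

Let om_mul_l s z : @om_mul n m (form s) z = F z s.
Proof. by have [D b v] := om_mul_cond z; rewrite /om_mul om_liftE. Qed.

Lemma om_mulE (s : 'I_n.+1 -> S) (t : 'I_m.+1 -> S) :
  om_mul (form s) (form t) = om_mul_form (juxt s t).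
Proof. by rewrite om_mul_l om_mul_formE. Qed.

Lemma om_mul_biadditive : biadditive (@om_mul n m).
Proof.
split=> [z w w'|w z z']; first exact: raddfD.
elim/omega_ind: w => [|w w' hw hw'|s].
- by rewrite /om_mul !raddf0 addr0.
- by move: hw hw'; rewrite /om_mul !raddfB /= => -> ->; rewrite opprD addrACA.
- by rewrite !om_mul_l raddfD.
Qed.

End MulCond.

End Forms.

(* A (x)_Z B *)
Section TensorZ.
Variables A B : zmodType.

Inductive ztensor_rel : {freeg {classic A * B} / int} -> Prop :=
| ztensor_addl (a a' : A) (b : B) :
    ztensor_rel (<< ((a + a', b) : {classic _}) >>
                 - << ((a, b) : {classic _}) >> - << ((a', b) : {classic _}) >>)
| ztensor_addr (a : A) (b b' : B) :
    ztensor_rel (<< ((a, b + b') : {classic _}) >>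
                 - << ((a, b) : {classic _}) >> - << ((a, b') : {classic _}) >>).

Definition ztensor : Type := pres ztensor_rel.
HB.instance Definition _ := GRing.Zmodule.on ztensor.

Definition ztens (a : A) (b : B) : ztensor := gen ztensor_rel (a, b).

Definition zlift (H : zmodType) (g : A -> B -> H) : ztensor -> H :=
  plift (fun p => g p.1 p.2).
HB.instance Definition _ H g := GRing.Additive.on (@zlift H g).

Lemma ztens_biadditive : biadditive ztens.
Proof.
split=> [b a a'|a b b']; apply/eqP; rewrite -subr_eq0 opprD addrA /ztens /gen.
  rewrite -!raddfB; apply/eqP; rewrite -[RHS](raddf0 (cls _)); apply/cls_eq.
  by rewrite subr0; apply/span_mem/ztensor_addl.
rewrite -!raddfB; apply/eqP; rewrite -[RHS](raddf0 (cls _)); apply/cls_eq.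
by rewrite subr0; apply/span_mem/ztensor_addr.
Qed.

Lemma zliftE (H : zmodType) (g : A -> B -> H) a b :
  biadditive g -> zlift g (ztens a b) = g a b.
Proof.
move=> [gl gr]; apply: (pliftE (g := fun p => g p.1 p.2)).
by move=> _ [x x' y|x y y']; rewrite !raddfB /= !fextU /= ?gl ?gr -addrA -opprD subrr.
Qed.

Lemma ztensor_ind (Q : ztensor -> Prop) :
  Q 0 -> (forall u v, Q u -> Q v -> Q (u - v)) -> (forall a b, Q (ztens a b)) ->
  forall u, Q u.
Proof. by move=> Q0 QB Qt; apply: pres_ind => // -[a b]; exact: Qt. Qed.

End TensorZ.

(* Lambda^i V, for an abelian group V. *)
Section Exterior.
Variables (V : zmodType) (i : nat).

Inductive ext_rel : {freeg {classic 'I_i -> V} / int} -> Prop :=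
| ext_add (x : 'I_i -> V) (k : 'I_i) (u v : V) :
    ext_rel (<< (@dfwith _ (fun=> V) x k (u + v) : {classic _}) >>
             - << (@dfwith _ (fun=> V) x k u : {classic _}) >>
             - << (@dfwith _ (fun=> V) x k v : {classic _}) >>)
| ext_alt (x : 'I_i -> V) (k l : 'I_i) : k != l -> x k = x l ->
    ext_rel << (x : {classic _}) >>.

Definition ext : Type := pres ext_rel.
HB.instance Definition _ := GRing.Zmodule.on ext.

(* x_0 /\ ... /\ x_(i-1) *)
Definition wedges (x : 'I_i -> V) : ext := gen ext_rel x.

Definition ext_lift (H : zmodType) (g : ('I_i -> V) -> H) : ext -> H := plift g.
HB.instance Definition _ H g := GRing.Additive.on (@ext_lift H g).

Definition alternating (H : zmodType) (g : ('I_i -> V) -> H) : Prop :=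
  @multiadditive i (fun=> V) H g /\
  forall x k l, k != l -> x k = x l -> g x = 0.

Lemma wedges_alternating : alternating wedges.
Proof.
split=> [x k u v|x k l kl xkl]; last first.
  rewrite -[RHS](raddf0 (cls _)); apply/cls_eq; rewrite subr0.
  by apply: span_mem; exact: ext_alt kl xkl.
apply/eqP; rewrite -subr_eq0 opprD addrA /wedges /gen -!raddfB; apply/eqP.
rewrite -[RHS](raddf0 (cls _)); apply/cls_eq; rewrite subr0.
exact/span_mem/ext_add.
Qed.

Lemma ext_liftE (H : zmodType) (g : ('I_i -> V) -> H) x :
  alternating g -> ext_lift g (wedges x) = g x.
Proof.
move=> [gD ga]; apply: pliftE => _ [y k u v|y k l kl ykl].
  by rewrite !raddfB /= !fextU gD -addrA -opprD subrr.
by rewrite fextU (ga _ _ _ kl ykl).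
Qed.

End Exterior.

Section ExteriorMaps.

Definition ext_map (V W : zmodType) (h : V -> W) i : ext V i -> ext W i :=
  ext_lift (fun x => wedges (h \o x)).
HB.instance Definition _ V W h i := GRing.Additive.on (@ext_map V W h i).

Definition fjuxt (T : Type) i j (x : 'I_i -> T) (y : 'I_j -> T) : 'I_(i + j) -> T :=
  fun k => match split k with inl a => x a | inr b => y b end.

Definition wedge (V : zmodType) i j (u : ext V i) (v : ext V j) : ext V (i + j) :=
  ext_lift (fun x => ext_lift (fun y => wedges (fjuxt x y)) v) u.

Lemma ext_mapE (V W : zmodType) (h : V -> W) i (x : 'I_i -> V) :
  zmod_morphism h -> ext_map h (wedges x) = wedges (h \o x).
Proof.
move=> hB; have [wD wa] := @wedges_alternating W i; apply: ext_liftE; split.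
  move=> y k u v; have hE w : h \o @dfwith _ (fun=> V) y k w =
                              @dfwith _ (fun=> W) (h \o y) k (h w).
    apply: funext => l /=.
    case: (@dfwithP _ (fun=> V) y k w l) => [|l' kl']; first by rewrite dfwith_in.
    by rewrite (@dfwith_out _ (fun=> W)).
  rewrite !hE -wD; congr (wedges (@dfwith _ (fun=> W) _ k _)).
  have h0 : h 0 = 0 by rewrite -(subrr 0) hB subrr.
  by rewrite -[v in LHS]opprK hB -[- v]sub0r hB h0 sub0r opprK.
by move=> y k l kl ykl; apply: wa kl _ => /=; rewrite ykl.
Qed.

Section Wedge.
Variables (V : zmodType) (i j : nat).
Implicit Types (x : 'I_i -> V) (y : 'I_j -> V).

Let fjuxt_l x y k : fjuxt x y (lshift j k) = x k.
Proof. by rewrite /fjuxt (unsplitK (inl k)). Qed.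

Let fjuxt_r x y k : fjuxt x y (rshift i k) = y k.
Proof. by rewrite /fjuxt (unsplitK (inr k)). Qed.

Lemma fjuxt_altl y : alternating (fun x => wedges (fjuxt x y)).
Proof.
have [wD wa] := @wedges_alternating V (i + j).
split=> [z k u v|z k l kl zkl]; last first.
  by apply: (wa _ (lshift j k) (lshift j l)); rewrite ?fjuxt_l // (inj_eq (@lshift_inj _ _)).
have EU w : fjuxt (@dfwith _ (fun=> V) z k w) y =
            @dfwith _ (fun=> V) (fjuxt z y) (lshift j k) w.
  apply: funext => l; rewrite /fjuxt; case: (split_ordP l) => a ->.
    have [<-|ka] := eqVneq k a; first by rewrite !(@dfwith_in _ (fun=> V)).
    by rewrite !(@dfwith_out _ (fun=> V)) ?(inj_eq (@lshift_inj _ _)) // (unsplitK (inl a)).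
  by rewrite (@dfwith_out _ (fun=> V)) ?eq_lrshift // (unsplitK (inr a)).
by rewrite !EU wD.
Qed.

Lemma fjuxt_altr x : alternating (fun y => wedges (fjuxt x y)).
Proof.
have [wD wa] := @wedges_alternating V (i + j).
split=> [z k u v|z k l kl zkl]; last first.
  by apply: (wa _ (rshift i k) (rshift i l)); rewrite ?fjuxt_r // (inj_eq (@rshift_inj _ _)).
have EU w : fjuxt x (@dfwith _ (fun=> V) z k w) =
            @dfwith _ (fun=> V) (fjuxt x z) (rshift i k) w.
  apply: funext => l; rewrite /fjuxt; case: (split_ordP l) => a ->.
    by rewrite (@dfwith_out _ (fun=> V)) ?eq_rlshift // (unsplitK (inl a)).
  have [<-|ka] := eqVneq k a; first by rewrite !(@dfwith_in _ (fun=> V)).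
  by rewrite !(@dfwith_out _ (fun=> V)) ?(inj_eq (@rshift_inj _ _)) // (unsplitK (inr a)).
by rewrite !EU wD.
Qed.

Let wedge_alt (v : ext V j) :
  alternating (fun x => ext_lift (fun y => wedges (fjuxt x y)) v).
Proof.
elim/pres_ind: v => [|v v' [vD va] [vD' va']|y].
- by split=> [z k u v|*]; rewrite !raddf0 ?addr0.
- split=> [z k a b|z k l kl zkl]; rewrite !raddfB /=.
    by rewrite vD vD' opprD addrACA.
  by rewrite (va _ _ _ kl zkl) (va' _ _ _ kl zkl) subrr.
have [yD ya] := fjuxt_altl y.
have E x : ext_lift (fun y => wedges (fjuxt x y)) (wedges y) = wedges (fjuxt x y).
  exact: ext_liftE (fjuxt_altr x).
by split=> [z k a b|z k l kl zkl]; rewrite !E; [exact: yD|exact: ya kl zkl].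
Qed.

Lemma wedgeE x y : wedge (wedges x) (wedges y) = wedges (fjuxt x y).
Proof.
rewrite /wedge ext_liftE; last exact: wedge_alt.
exact: ext_liftE (fjuxt_altr x).
Qed.

Lemma wedge_biadditive : biadditive (@wedge V i j).
Proof.
split=> [v u u'|u v v']; first exact: raddfD.
elim/pres_ind: u => [|u u' hu hu'|x].
- by rewrite /wedge !raddf0 addr0.
- by move: hu hu'; rewrite /wedge !raddfB /= => -> ->; rewrite opprD addrACA.
- by rewrite /wedge !(ext_liftE _ (wedge_alt _)) raddfD.
Qed.

End Wedge.

End ExteriorMaps.

(* The direct sum of the G i over all i : nat. *)
Section DirectSum.
Variable G : nat -> zmodType.

Inductive dsum_rel : {freeg {classic {i : nat & G i}} / int} -> Prop :=
| dsum_add i (a b : G i) :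
    dsum_rel (<< (existT (fun i => G i : Type) i (a + b) : {classic _}) >>
              - << (existT (fun i => G i : Type) i a : {classic _}) >>
              - << (existT (fun i => G i : Type) i b : {classic _}) >>).

Definition dsum : Type := pres dsum_rel.
HB.instance Definition _ := GRing.Zmodule.on dsum.

Definition inj i (a : G i) : dsum := gen dsum_rel (existT _ i a).

Definition dlift (H : zmodType) (g : forall i, G i -> H) : dsum -> H :=
  plift (fun p => g (tag p) (tagged p)).
HB.instance Definition _ H g := GRing.Additive.on (@dlift H g).

Lemma inj_is_zmod_morphism i : zmod_morphism (@inj i).
Proof.
have injD (a b : G i) : inj (a + b) = inj a + inj b.
  apply/eqP; rewrite -subr_eq0 opprD addrA /inj /gen -!raddfB; apply/eqP.
  rewrite -[RHS](raddf0 (cls _)); apply/cls_eq; rewrite subr0.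
  exact/span_mem/dsum_add.
by move=> a b; rewrite -{2}(subrK b a) [in RHS]injD addrK.
Qed.
HB.instance Definition _ i :=
  GRing.isZmodMorphism.Build (G i) dsum (@inj i) (@inj_is_zmod_morphism i).

Lemma dliftE (H : zmodType) (g : forall i, G i -> H) i a :
  (forall i, zmod_morphism (g i)) -> dlift g (inj a) = g i a.
Proof.
move=> gB; apply: (pliftE (g := fun p => g (tag p) (tagged p))).
move=> _ [j x y]; rewrite !raddfB /= !fextU /=.
suff -> : g j (x + y) = g j x + g j y by rewrite -addrA -opprD subrr.
by apply/eqP; rewrite -subr_eq -gB addrK.
Qed.

Lemma dsum_ind (Q : dsum -> Prop) :
  Q 0 -> (forall u v, Q u -> Q v -> Q (u - v)) -> (forall i a, Q (@inj i a)) ->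
  forall u, Q u.
Proof. by move=> Q0 QB Qi; apply: pres_ind => // -[i a]; exact: Qi. Qed.

End DirectSum.

(* V^n is the kernel of the sum map Z^(n+1) -> Z. *)
Section KerSum.
Variable n : nat.

Definition ker_sum_pred : {pred {ffun 'I_n.+1 -> int}} := fun x => \sum_i x i == 0.

Lemma ker_sum_closed : zmod_closed ker_sum_pred.
Proof.
split=> [|x y /eqP x0 /eqP y0]; apply/eqP.
  by apply: big1 => i _; rewrite ffunE.
under eq_bigr => i _ do rewrite !ffunE.
by rewrite big_split /= sumrN x0 y0 subrr.
Qed.
HB.instance Definition _ :=
  GRing.isZmodClosed.Build {ffun 'I_n.+1 -> int} ker_sum_pred ker_sum_closed.

Record ker_sum := KerSum { ker_sum_val :> {ffun 'I_n.+1 -> int};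
                           ker_sumP : ker_sum_val \in ker_sum_pred }.
HB.instance Definition _ := [isSub for ker_sum_val].
HB.instance Definition _ := [Choice of ker_sum by <:].
HB.instance Definition _ := [SubChoice_isSubZmodule of ker_sum by <:].

Definition delta (k : 'I_n.+1) : {ffun 'I_n.+1 -> int} := [ffun i => (i == k)%:R].

Lemma sum_delta k : \sum_i delta k i = 1.
Proof.
rewrite (bigD1 k) //= big1 ?addr0 ?ffunE ?eqxx // => i ik.
by rewrite ffunE (negPf ik).
Qed.

Lemma vbasis_subproof k : delta k - delta ord0 \in ker_sum_pred.
Proof.
apply/eqP; rewrite (eq_bigr (fun i => delta k i - delta ord0 i));
  last by move=> i _; rewrite !ffunE.
by rewrite big_split /= sumrN !sum_delta subrr.
Qed.

(* v_k = e_k - e_0 *)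
Definition vbasis k : ker_sum := KerSum (vbasis_subproof k).

End KerSum.

Section KerSumMap.
Variables (n m : nat) (alpha : 'I_n.+1 -> 'I_m.+1).

Lemma ker_sum_map_subproof (x : ker_sum n) :
  [ffun j => \sum_(i | alpha i == j) x i] \in @ker_sum_pred m.
Proof.
have /eqP x0 := ker_sumP x; apply/eqP; rewrite -[RHS]x0.
under eq_bigr => j _ do rewrite ffunE.
by rewrite [RHS](partition_big alpha predT).
Qed.

(* The restriction of the map Z^(n+1) -> Z^(m+1) sending e_i to e_(alpha i). *)
Definition ker_sum_map (x : ker_sum n) : ker_sum m :=
  KerSum (ker_sum_map_subproof x).

Lemma ker_sum_map_is_zmod_morphism : zmod_morphism ker_sum_map.
Proof.
move=> x y; apply/val_inj/ffunP => j.
rewrite !ffunE -sumrB; apply: eq_bigr => i _.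
by rewrite !ffunE.
Qed.
HB.instance Definition _ := GRing.isZmodMorphism.Build (ker_sum n) (ker_sum m)
  ker_sum_map ker_sum_map_is_zmod_morphism.

Lemma ker_sum_map_vbasis k :
  ker_sum_map (vbasis k) = vbasis (alpha k) - vbasis (alpha ord0).
Proof.
apply/val_inj/ffunP => j; rewrite !ffunE /=.
under eq_bigr => i _ do rewrite !ffunE.
have E l : \sum_(i | alpha i == j) ((i == l)%:R : int) = (j == alpha l)%:R.
  have [jl|jl] := eqVneq j (alpha l).
    rewrite (bigD1 l) /= ?jl ?eqxx // big1 ?addr0 // => i /andP[_ il].
    by rewrite (negPf il).
  apply: big1 => i /eqP ij; case: eqVneq => // il.
  by move: jl; rewrite -ij il eqxx.
by rewrite sumrB !E opprB addrA subrK.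
Qed.

End KerSumMap.

Lemma additive_zmod_morphism (U W : zmodType) (g : U -> W) :
  {morph g : x y / x + y} -> zmod_morphism g.
Proof.
by move=> gD x y; apply/eqP; rewrite eq_sym subr_eq -gD subrK.
Qed.

Section FunctorK.
Variables (R : pzRingType) (A : nat -> bimodule R).

(* K^n A = (+)_i A^i (x) Lambda^i V^n *)
Definition K_summand n i : zmodType := ztensor (A i) (ext (ker_sum n) i).
Definition K n : Type := dsum (K_summand n).
HB.instance Definition _ n := GRing.Zmodule.on (K n).

Definition K_gen n i (a : A i) (x : ext (ker_sum n) i) : K n :=
  @inj (K_summand n) i (ztens a x).

Definition K_lift n (H : zmodType)
    (g : forall i, A i -> ext (ker_sum n) i -> H) : K n -> H :=
  dlift (fun i => zlift (g i) : K_summand n i -> H).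
HB.instance Definition _ n H g := GRing.Additive.on (@K_lift n H g).

Lemma K_liftE n H g i a x :
  (forall j, biadditive (g j)) -> @K_lift n H g (K_gen a x) = g i a x.
Proof.
by move=> gD; rewrite /K_lift /K_gen dliftE ?zliftE // => j; exact: raddfB.
Qed.

Lemma K_gen_biadditive n i : biadditive (@K_gen n i).
Proof.
have [tl tr] := @ztens_biadditive (A i) (ext (ker_sum n) i).
by split=> [x a b|a x y]; rewrite /K_gen (tl, tr) raddfD.
Qed.

Lemma K_ind n (Q : K n -> Prop) :
  Q 0 -> (forall u v, Q u -> Q v -> Q (u - v)) ->
  (forall i (a : A i) x, Q (K_gen a x)) -> forall u, Q u.
Proof.
move=> Q0 QB Qg; apply: dsum_ind => // i; apply: ztensor_ind => [|u v Qu Qv|a x].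
- by rewrite raddf0.
- by rewrite raddfB; exact: QB.
- exact: Qg.
Qed.

Definition K_lact n (a : R) : K n -> K n :=
  K_lift (fun i b x => K_gen (lact a b) x).
Definition K_ract n (u : K n) (a : R) : K n :=
  K_lift (fun i b x => K_gen (ract b a) x) u.
HB.instance Definition _ n a := GRing.Additive.on (@K_lact n a).

Lemma K_lactE n a i (b : A i) (x : ext (ker_sum n) i) :
  K_lact a (K_gen b x) = K_gen (lact a b) x.
Proof.
apply: K_liftE => j; have [gl gr] := @K_gen_biadditive n j.
by split=> [y c c'|c y y']; rewrite ?(lactDr (bimoduleP _)) ?gl ?gr.
Qed.

Lemma K_ractE n a i (b : A i) (x : ext (ker_sum n) i) :
  K_ract (K_gen b x) a = K_gen (ract b a) x.
Proof.
rewrite /K_ract; apply: K_liftE => j; have [gl gr] := @K_gen_biadditive n j.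
by split=> [y c c'|c y y']; rewrite ?(ractDl (bimoduleP _)) ?gl ?gr.
Qed.

Lemma K_bimoduleP n : bimodule_axioms (@K_lact n) (@K_ract n).
Proof.
have P := bimoduleP; have [gl gr] := (fun i => (@K_gen_biadditive n i).1,
  fun i => (@K_gen_biadditive n i).2).
have l0 a : @K_lact n a 0 = 0 by exact: raddf0.
have r0 a : @K_ract n 0 a = 0 by exact: raddf0.
have lB a : {morph @K_lact n a : u v / u - v} by exact: raddfB.
have rB a (u v : K n) : K_ract (u - v) a = K_ract u a - K_ract v a.
  exact: raddfB.
split.
- by move=> a; exact: raddfD.
- move=> u a b; elim/K_ind: u => [|u v hu hv|i c x]; rewrite ?l0 ?addr0 //.
    by rewrite !lB hu hv opprD addrACA.
  by rewrite !K_lactE (lactDl (P _ _)) gl.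
- move=> a b u; elim/K_ind: u => [|u v hu hv|i c x]; rewrite ?l0 //.
    by rewrite !lB hu hv.
  by rewrite !K_lactE (lactA (P _ _)).
- move=> u; elim/K_ind: u => [|u v hu hv|i c x]; rewrite ?l0 //.
    by rewrite lB hu hv.
  by rewrite K_lactE (lact1 (P _ _)).
- move=> u a b; elim/K_ind: u => [|u v hu hv|i c x]; rewrite ?r0 ?addr0 //.
    by rewrite !rB hu hv opprD addrACA.
  by rewrite !K_ractE (ractDr (P _ _)) gl.
- move=> a; exact: (raddfD (K_lift (fun i b x => K_gen (ract b a) x))).
- move=> a b u; elim/K_ind: u => [|u v hu hv|i c x]; rewrite ?r0 //.
    by rewrite !rB hu hv.
  by rewrite !K_ractE (ractA (P _ _)).
- move=> u; elim/K_ind: u => [|u v hu hv|i c x]; rewrite ?r0 //.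
    by rewrite rB hu hv.
  by rewrite K_ractE (ract1 (P _ _)).
- move=> a b u; elim/K_ind: u => [|u v hu hv|i c x]; rewrite ?(l0, r0) //.
    by rewrite !(lB, rB) hu hv.
  by rewrite K_lactE !K_ractE K_lactE (lractA (P _ _)).
Qed.

Definition K_bimodule n : bimodule R := Bimodule (@K_bimoduleP n).

End FunctorK.

Section FunctorKMaps.
Variables (R : pzRingType) (A : nat -> bimodule R).
Variable d : forall i, A i -> A i.+1.
Arguments d : clear implicits.

(* alpha (a (x) x) = a (x) alpha x + da (x) v_(alpha 0) /\ alpha x *)
Definition K_map n m (alpha : 'I_n.+1 -> 'I_m.+1) : K A n -> K A m :=
  K_lift (fun i a x =>
    K_gen a (ext_map (ker_sum_map alpha) x) +
    K_gen (d i a) (wedge (wedges (fun _ : 'I_1 => vbasis (alpha ord0)))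
                         (ext_map (ker_sum_map alpha) x))).

Lemma K_mapE n m (alpha : 'I_n.+1 -> 'I_m.+1) i (a : A i) x :
  (forall j, zmod_morphism (d j)) ->
  K_map alpha (K_gen a x) =
  K_gen a (ext_map (ker_sum_map alpha) x) +
  K_gen (d i a) (wedge (wedges (fun _ : 'I_1 => vbasis (alpha ord0)))
                       (ext_map (ker_sum_map alpha) x)).
Proof.
move=> dB; apply: K_liftE => j.
have dD u v : d j (u + v) = d j u + d j v by apply/eqP; rewrite -subr_eq -dB addrK.
have [gl gr] := K_gen_biadditive A m j.
have [gl' gr'] := K_gen_biadditive A m j.+1.
have [wl wr] := wedge_biadditive (ker_sum m) 1 j.
split=> [y b b'|b y y']; first by rewrite dD gl gl' addrACA.
by rewrite raddfD /= gr wr gr' addrACA.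
Qed.

Variable mul : forall i j, A i -> A j -> A (i + j).

(* (a (x) x)(b (x) y) = ab (x) x /\ y *)
Definition K_mul n (u v : K A n) : K A n :=
  K_lift (fun i a x => K_lift (fun j b y => K_gen (mul a b) (wedge x y)) v) u.

Definition K_one (one : A 0) n : K A n :=
  @K_gen R A n 0 one (wedges (fun _ : 'I_0 => 0)).

Lemma K_mulE n i j (a : A i) x (b : A j) y :
  (forall k l, biadditive (@mul k l)) ->
  K_mul (@K_gen R A n i a x) (@K_gen R A n j b y) = K_gen (mul a b) (wedge x y).
Proof.
move=> mD.
have E k (c : A k) z : K_lift (fun j b y => K_gen (mul c b) (wedge z y)) (@K_gen R A n j b y)
    = K_gen (mul c b) (wedge z y).
  apply: K_liftE => l; have [gl gr] := K_gen_biadditive A n (k + l).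
  have [ml mr] := mD k l; have [wl wr] := wedge_biadditive (ker_sum n) k l.
  by split=> [t e e'|e t t']; rewrite ?mr ?wr ?gl ?gr.
rewrite /K_mul K_liftE ?E // => k; have [gl gr] := K_gen_biadditive A n (k + j).
have [ml mr] := mD k j; have [wl wr] := wedge_biadditive (ker_sum n) k j.
by split=> [t e e'|e t t']; rewrite !E ?ml ?wl ?gl ?gr.
Qed.

End FunctorKMaps.

Section Cosimplicial.
Variable R : pzRingType.

Record bimodule_hom (M N : bimodule R) (g : M -> N) : Prop := BimoduleHom {
  homD : {morph g : x y / x + y};
  hom_lact : forall a x, g (lact a x) = lact a (g x);
  hom_ract : forall x a, g (ract x a) = ract (g x) a
}.

(* The coface coface n i : X^n -> X^(n+1) is meaningful for i <= n + 1, and the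
   codegeneracy codeg n j : X^(n+1) -> X^n for j <= n. *)
Record cosimplicial := Cosimplicial {
  cobj :> nat -> bimodule R;
  coface : forall n, nat -> cobj n -> cobj n.+1;
  codeg : forall n, nat -> cobj n.+1 -> cobj n
}.

Record is_cosimplicial_bimodule (X : cosimplicial) : Prop := IsCosimplicialBimodule {
  coface_hom : forall n i, (i <= n.+1)%N -> bimodule_hom (@coface X n i);
  codeg_hom : forall n j, (j <= n)%N -> bimodule_hom (@codeg X n j);
  coface_coface : forall n i j (x : X n), (i < j <= n.+2)%N ->
    coface j (coface i x) = coface i (coface j.-1 x);
  codeg_codeg : forall n i j (x : X n.+2), (i <= j <= n)%N ->
    codeg j (codeg i x) = codeg i (codeg j.+1 x);
  codeg_coface_lt : forall n i j (x : X n.+1), (i < j <= n.+1)%N ->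
    codeg j (coface i x) = coface i (codeg j.-1 x);
  codeg_coface_eq : forall n i j (x : X n), (j <= n)%N -> (i == j) || (i == j.+1) ->
    codeg j (coface i x) = x;
  codeg_coface_gt : forall n i j (x : X n.+1), (j.+1 < i <= n.+2)%N ->
    codeg j (coface i x) = coface i.-1 (codeg j x)
}.

Record cosimplicial_ring := CosimplicialRing {
  cring :> cosimplicial;
  cmul : forall n, cring n -> cring n -> cring n;
  cone : forall n, cring n
}.

Record ring_hom_laws (M N : zmodType) (mulM : M -> M -> M) (oneM : M)
    (mulN : N -> N -> N) (oneN : N) (g : M -> N) : Prop := RingHomLaws {
  ring_homD : {morph g : x y / x + y};
  ring_homM : {morph g : x y / mulM x y >-> mulN x y};
  ring_hom1 : g oneM = oneN
}.

Definition ring_hom (X Y : cosimplicial_ring) n m (g : X n -> Y m) : Prop :=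
  ring_hom_laws (@cmul X n) (cone X n) (@cmul Y m) (cone Y m) g.

Record is_cosimplicial_ring (X : cosimplicial_ring) : Prop := IsCosimplicialRing {
  cring_bimodule : is_cosimplicial_bimodule X;
  cmulA : forall n, associative (@cmul X n);
  cmul1l : forall n, left_id (cone X n) (@cmul X n);
  cmul1r : forall n, right_id (cone X n) (@cmul X n);
  cmulDl : forall n, left_distributive (@cmul X n) +%R;
  cmulDr : forall n, right_distributive (@cmul X n) +%R;
  coface_ring_hom : forall n i, (i <= n.+1)%N -> ring_hom (@coface X n i);
  codeg_ring_hom : forall n j, (j <= n)%N -> ring_hom (@codeg X n j)
}.

Section Morphisms.
Variables X Y : cosimplicial.
Implicit Type phi : forall n, X n -> Y n.

Definition commutes_cosimplicial phi : Prop :=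
  (forall n i x, (i <= n.+1)%N -> phi n.+1 (coface i x) = coface i (phi n x)) /\
  (forall n j x, (j <= n)%N -> phi n (codeg j x) = codeg j (phi n.+1 x)).

Definition cosimplicial_bimodule_iso phi : Prop :=
  [/\ forall n, bimodule_hom (phi n), forall n, bijective (phi n)
    & commutes_cosimplicial phi].

End Morphisms.

Definition cosimplicial_ring_iso (X Y : cosimplicial_ring)
    (phi : forall n, X n -> Y n) : Prop :=
  [/\ forall n, ring_hom (phi n), forall n, bijective (phi n)
    & commutes_cosimplicial phi].

(* N^n X = X^n / sum_(1 <= i <= n) coface i X^(n-1) *)
Definition degenerate (X : cosimplicial) n : X n -> Prop :=
  match n return X n -> Prop with
  | 0 => fun=> False
  | m.+1 => fun y => exists i (x : X m), (0 < i <= m.+1)%N /\ y = coface i x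
  end.

Definition norm (X : cosimplicial) n : zmodType := quotient (@degenerate X n).

Definition norm_cls (X : cosimplicial) n : X n -> norm X n := cls (@degenerate X n).

Definition norm_map (X Y : cosimplicial) (phi : forall n, X n -> Y n) n :
    norm X n -> norm Y n :=
  qlift (fun x => norm_cls (phi n x)).

End Cosimplicial.

Section Statement.
Variables (R S : pzRingType) (f : {rmorphism R -> S}).

Definition Amitsur : cosimplicial R := Cosimplicial (@am_coface R S f) (@am_codeg R S f).

Definition Amitsur_ring : cosimplicial_ring R :=
  @CosimplicialRing R Amitsur (@nuss_mul R S f) (@nuss_one R S f).

Definition ord_face n (i : nat) (k : 'I_n.+1) : 'I_n.+2 := inord (bump i k).
Definition ord_degen n (j : nat) (k : 'I_n.+2) : 'I_n.+1 := inord (unbump j k).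

Definition KOmega : cosimplicial R :=
  @Cosimplicial R (K_bimodule (omega f))
    (fun n i => K_map (@om_d R S f) (@ord_face n i))
    (fun n j => K_map (@om_d R S f) (@ord_degen n j)).

Definition KOmega_ring : cosimplicial_ring R :=
  @CosimplicialRing R KOmega (@K_mul R (omega f) (@om_mul R S f))
    (@K_one R (omega f) (om_one f)).

(* The identification N^n((x)_R S) = Omega^n. *)
Definition norm_Amitsur n : norm Amitsur n -> omega f n :=
  qlift (@am_lift R S f n _ (@form R S f n)).

(* The identification Omega^n = N^n(K Omega), a |-> a (x) v_1 /\ ... /\ v_n. *)
Definition norm_KOmega n (a : omega f n) : norm KOmega n :=
  @norm_cls R KOmega n
    (K_gen a (wedges (fun i : 'I_n => vbasis (fintype.lift ord0 i)))).

Lemma norm_AmitsurE n (s : 'I_n.+1 -> S) :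
  norm_Amitsur (@norm_cls R Amitsur n (am f s)) = form f s.
Proof.
have E m (t : 'I_m.+1 -> S) : @am_lift R S f m _ (@form R S f m) (am f t) = form f t.
  by rewrite am_liftE //; [exact: form_madd|exact: form_bal].
rewrite /norm_Amitsur /norm_cls qliftE ?E //; split; first exact: raddfB.
case: n {s} => [//|n] _ [i [x [/andP[i0 i_n] ->]]] /=.
elim/pres_ind: x => [|u v hu hv|x].
- by rewrite /am_coface !raddf0.
- by rewrite /am_coface raddfB /= raddfB /= hu hv subrr.
rewrite -[gen _ x]/(am f x) am_cofaceE // E.
suff -> : insert1 i x = upd (insert1 i x) (inord i) (f 1).
  by apply: form_vanish; rewrite inordK.
apply: funext => k; rewrite updE inordK // rmorph1.
by case: eqP => // ->; rewrite /insert1 ltnn eqxx.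
Qed.

Definition dold_kan (phi : forall n, Amitsur n -> KOmega n) : Prop :=
  cosimplicial_bimodule_iso phi /\
  forall n w, norm_map phi (n := n) w = norm_KOmega (norm_Amitsur w).

End Statement.

(* Main.v *)
(* Left multiplication by s + ds v_i on K^n Omega is an operator E_i(s), and the
   d-commutator identity [d, st] = s [d, t] + [d, s] t gives
     E_i(a) E_i(b) = E_i(ab),
     E_i(a) E_j(b) + E_j(a) E_i(b) = E_i(ab) + E_j(ab),
   while alpha E_i(s) = E_(alpha i)(s) alpha for the cosimplicial operators alpha.
   Since 1 generates K^n Omega under the E_i(s), the product of K Omega is
   associative and the operators alpha are multiplicative.  The Dold-Kan map is
   phi(s_0 (x) ... (x) s_n) = E_0(s_0) ... E_n(s_n) 1.  The second relation says
   that applying tau in positions j, j + 1 exchanges the indices of the j-th and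
   (j + 1)-th operators, so that undoing the shuffle turns Nuss' product into
   phi(u) phi(v).  Modulo the images of the cofaces of positive index,
   phi(s_0 (x) ... (x) s_n) is s_0 ds_1 ... ds_n (x) v_1 /\ ... /\ v_n; as an
   element killed by all codegeneracies and lying in the span of these images
   vanishes, phi is injective and is the only map inducing the identity. *)
Require Import Defs.
From HB Require Import structures.
From mathcomp Require Import all_boot all_order all_algebra.
From mathcomp Require Import boolp zify.
Set Implicit Arguments.
Unset Strict Implicit.
Unset Printing Implicit Defensive.
Import GRing.Theory Defs.
Local Open Scope ring_scope.

(** Associativity of the product of forms would compare double alternating sums, in degrees
    [i + (j + k)] and [i + j + k] that are not convertible. Working only with left multiplication by
    one element avoids both difficulties: E_i(s) commutes with right multiplications, and [i.+1 + j]
    is convertible to [(i + j).+1]. Two additive maps out of K^n Omega that intertwine the E_i(s) in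
    the same way are equal once they agree on 1; associativity, the right unit and functoriality all
    follow this pattern. On the Amitsur side, neither associativity nor compatibility with the
    cofaces is computed with tau: both are pulled back along phi, once phi is known to be injective.
    Injectivity rests on two facts about normalizations: a -> a (x) v_1 /\ ... /\ v_n is injective
    modulo degenerate elements, because a determinant reads off a, and the normalized class of s_0
    (x) ... (x) s_n is recovered from s_0 ds_1 ... ds_n. Surjectivity is a consequence of
    multiplicativity. *)

Lemma morphD0 (U W : zmodType) (g : U -> W) : {morph g : x y / x + y} -> g 0 = 0.
Proof. by move=> gD; apply: (addrI (g 0)); rewrite -gD !addr0. Qed.

Lemma morphDN (U W : zmodType) (g : U -> W) :
  {morph g : x y / x + y} -> {morph g : x / - x}.
Proof.
by move=> gD x; apply: (addrI (g x)); rewrite -gD !subrr (morphD0 gD).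
Qed.

Lemma morphDB (U W : zmodType) (g : U -> W) :
  {morph g : x y / x + y} -> {morph g : x y / x - y}.
Proof. exact: additive_zmod_morphism. Qed.

Lemma morphD_sum (U W : zmodType) (g : U -> W) (I : Type) (r : seq I) P (F : I -> U) :
  {morph g : x y / x + y} -> g (\sum_(i <- r | P i) F i) = \sum_(i <- r | P i) g (F i).
Proof. by move=> gD; rewrite (big_morph g gD (morphD0 gD)). Qed.

Lemma spanN (G : zmodType) (P : G -> Prop) x : span P x -> span P (- x).
Proof. by move=> Px; rewrite -sub0r; exact/spanB/Px/span0. Qed.

Lemma spanD (G : zmodType) (P : G -> Prop) x y :
  span P x -> span P y -> span P (x + y).
Proof. by move=> Px Py; rewrite -[y]opprK; exact/spanB/spanN. Qed.

(** * Normalization of cosimplicial bimodules *)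

Section Degenerate.
Variables (R : pzRingType) (X : cosimplicial R).
Hypothesis HX : is_cosimplicial_bimodule X.

Lemma coface0 n i : (i <= n.+1)%N -> @coface R X n i 0 = 0.
Proof. by move=> /(coface_hom HX) [D _ _]; exact: morphD0. Qed.

(** The image of each coface is a subgroup, so one summand per coface index is enough. *)
Lemma span_degenerateP n (y : X n.+1) : span (@degenerate R X n.+1) y ->
  exists g : nat -> X n, y = \sum_(1 <= i < n.+2) coface i (g i).
Proof.
elim=> [|_ [i [x [/andP[i0 i_n] ->]]]|y1 y2 _ [g1 ->] _ [g2 ->]].
- exists (fun=> 0); rewrite big_nat big1 // => i /andP[_ i_n].
  exact: coface0.
- exists (fun j => if j == i then x else 0).
  rewrite (bigD1_seq i) ?mem_index_iota ?iota_uniq //=; last by lia.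
  rewrite eqxx big_seq_cond big1 ?addr0 // => j; rewrite mem_index_iota.
  by move=> /andP[/andP[_ jn] /negPf ->]; exact: coface0.
exists (fun i => g1 i - g2 i); rewrite -sumrB !big_nat.
apply: eq_bigr => i /andP[_ i_n].
by rewrite (morphDB (homD (coface_hom HX _))).
Qed.

Lemma span_degenerate0 (y : X 0) : span (@degenerate R X 0) y -> y = 0.
Proof. by elim=> // x1 x2 _ -> _ ->; rewrite subrr. Qed.

(* Projecting along the codegeneracies removes the cofaces one at a time,
   starting from the first. *)
Lemma degenerate_codeg_eq0 n (y : X n.+1) : span (@degenerate R X n.+1) y ->
  (forall j, (j <= n)%N -> codeg j y = 0) -> y = 0.
Proof.
move=> yd y0.
have [g yE] := span_degenerateP yd.
suff main d k : (0 < k)%N -> (n.+2 - k = d)%N ->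
    (exists g : nat -> X n, y = \sum_(k <= i < n.+2) coface i (g i)) -> y = 0.
  by apply: (main n.+1 1%N) => //; exists g.
move=> + + + {g yd yE}; elim: d k => [|d IH] k k0 kd [g yE].
  by rewrite yE big_geq //; lia.
apply: (IH k.+1) => //; first by lia.
move: yE; rewrite big_ltn /=; last by lia.
move=> yE; case: n y y0 kd g yE IH => [|n] y y0 kd g yE _.
  have k1 : k = 1%N by lia.
  move: yE; rewrite k1 big_geq // addr0 => yE; exists g.
  rewrite big_geq // yE; have := y0 0%N isT.
  by rewrite yE (codeg_coface_eq HX) // => ->; exact: coface0.
(* Codegeneracy k - 1 kills y, is a left inverse of coface k, and passes each later coface i as
   coface i - 1; this determines g k. *)
have gE : g k = - \sum_(k.+1 <= i < n.+3) coface i.-1 (codeg k.-1 (g i)).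
  have := y0 k.-1; rewrite yE (homD (codeg_hom HX _)); last by lia.
  rewrite (codeg_coface_eq HX) ?prednK ?eqxx ?orbT //; last by lia.
  move=> /(_ ltac:(lia))/eqP; rewrite addr_eq0 => /eqP ->; congr (- _).
  rewrite (morphD_sum _ _ _ (homD (codeg_hom HX _))); last by lia.
  rewrite !big_nat; apply: eq_bigr => i ik.
  by rewrite (codeg_coface_gt HX) //; lia.
(* The identity coface k coface (i - 1) = coface i coface k absorbs the k-th summand into the later
   ones. *)
exists (fun i => g i - coface k (codeg k.-1 (g i))).
rewrite yE gE (morphDN (homD (coface_hom HX _))); last by lia.
rewrite (morphD_sum _ _ _ (homD (coface_hom HX _))); last by lia.
rewrite addrC -sumrB !big_nat; apply: eq_bigr => i ik.
rewrite (morphDB (homD (coface_hom HX _))); last by lia.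
by rewrite [in RHS](coface_coface HX) //; lia.
Qed.

End Degenerate.

(** * Exterior powers *)

Section VectorWedge.
Variable V : zmodType.

(** Exterior products are handled one vector at a time, so that [vwedgeC] is the only source of
    signs in them. *)
Definition vwedge i (v : V) (x : ext V i) : ext V i.+1 :=
  wedge (wedges (fun _ : 'I_1 => v)) x.

Lemma wedges1D : {morph (fun v : V => wedges (fun _ : 'I_1 => v)) : u v / u + v}.
Proof.
move=> u v; have [wD _] := @wedges_alternating V 1.
have E w : (fun=> w) = @dfwith 'I_1 (fun=> V) (fun=> 0) ord0 w.
  by apply: funext => k; rewrite (ord1 k) (@dfwith_in _ (fun=> V)).
by have := wD (fun=> 0) ord0 u v; rewrite -!E.
Qed.

Lemma vwedge_biadditive i : biadditive (@vwedge i).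
Proof.
have [wl wr] := @wedge_biadditive V 1 i.
by split=> [x u v|v x y]; rewrite /vwedge ?wedges1D ?wl ?wr.
Qed.

Lemma ext_ind i (Q : ext V i -> Prop) :
  Q 0 -> (forall u v, Q u -> Q v -> Q (u - v)) -> (forall x, Q (wedges x)) ->
  forall u, Q u.
Proof. exact: pres_ind. Qed.

Lemma vwedgeE i v (x : 'I_i -> V) :
  vwedge v (wedges x) =
  wedges (fun k : 'I_i.+1 => if unlift ord0 k is Some j then x j else v).
Proof.
rewrite /vwedge wedgeE; congr wedges; apply: funext => k; rewrite /fjuxt.
case: (split_ordP (m := 1) (n := i) k) => j ->.
  have -> : lshift i j = ord0 :> 'I_i.+1 by apply: val_inj; rewrite (ord1 j).
  by rewrite unlift_none.
have -> : rshift 1 j = fintype.lift ord0 j by apply: val_inj.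
by rewrite liftK.
Qed.

Lemma wedges_vwedge i (x : 'I_i.+1 -> V) :
  wedges x = vwedge (x ord0) (wedges (fun j => x (fintype.lift ord0 j))).
Proof.
rewrite vwedgeE; congr wedges; apply: funext => k.
by case: unliftP => [j|] ->.
Qed.

Lemma vwedgeK i v (x : ext V i) : vwedge v (vwedge v x) = 0.
Proof.
have [wl wr] := (@vwedge_biadditive i, @vwedge_biadditive i.+1).
elim/ext_ind: x => [|x y hx hy|x].
- by rewrite !(morphD0 (wl.2 v), morphD0 (wr.2 v)).
- by rewrite !(morphDB (wl.2 v), morphDB (wr.2 v)) hx hy subrr.
rewrite !vwedgeE; have [_ wa] := @wedges_alternating V i.+2.
apply: (wa _ ord0 (fintype.lift ord0 ord0)); first by [].
by rewrite unlift_none liftK unlift_none.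
Qed.

(** Polarization of [vwedgeK] at u + v. *)
Lemma vwedgeC i u v (x : ext V i) : vwedge u (vwedge v x) = - vwedge v (vwedge u x).
Proof.
have [wl wr] := (@vwedge_biadditive i, @vwedge_biadditive i.+1).
apply/eqP; rewrite -addr_eq0; apply/eqP.
have := vwedgeK (u + v) x.
by rewrite !(wl.1, wr.1, wr.2) !vwedgeK add0r addr0.
Qed.

(** The degrees [i.+1 + j] and [(i + j).+1] are convertible, so this case of associativity is stated
    without a cast. *)
Lemma wedge_vwedge i j v (x : ext V i) (y : ext V j) :
  wedge (vwedge v x) y = vwedge v (wedge x y).
Proof.
have [wl wr] := (@vwedge_biadditive i, @vwedge_biadditive (i + j)).
have [pl pr] := (@wedge_biadditive V i j, @wedge_biadditive V i.+1 j).
elim/ext_ind: x => [|x x' hx hx'|x].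
- by rewrite (morphD0 (wl.2 v)) (morphD0 (pl.1 y)) (morphD0 (pr.1 y)) (morphD0 (wr.2 v)).
- rewrite (morphDB (wl.2 v)) (morphDB (pl.1 y)) (morphDB (pr.1 y)).
  by rewrite (morphDB (wr.2 v)) hx hx'.
elim/ext_ind: y => [|y y' hy hy'|y].
- by rewrite (morphD0 (pl.2 _)) (morphD0 (pr.2 _)) (morphD0 (wr.2 v)).
- by rewrite (morphDB (pl.2 _)) (morphDB (pr.2 _)) (morphDB (wr.2 v)) hy hy'.
rewrite vwedgeE !wedgeE vwedgeE; congr wedges; apply: funext => k.
rewrite /fjuxt; case: (split_ordP (m := i.+1) (n := j) k) => l ->.
  case: (unliftP ord0 l) => [l' ->|->].
    have -> : lshift j (fintype.lift ord0 l') = fintype.lift ord0 (lshift j l').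
      exact: val_inj.
    by rewrite liftK (unsplitK (inl l')).
  have -> : lshift j (ord0 : 'I_i.+1) = ord0 by apply: val_inj.
  by rewrite unlift_none.
have -> : rshift i.+1 l = fintype.lift ord0 (rshift i l) by apply: val_inj.
by rewrite liftK (unsplitK (inr l)).
Qed.

Lemma wedge0l j (y : ext V j) (x : 'I_0 -> V) : wedge (wedges x) y = y.
Proof.
have pr := (@wedge_biadditive V 0 j).2 (wedges x).
elim/ext_ind: y => [|y y' hy hy'|y].
- exact: morphD0 pr.
- by rewrite (morphDB pr) hy hy'.
rewrite wedgeE; congr wedges; apply: funext => k; rewrite /fjuxt.
case: (split_ordP (m := 0) (n := j) k) => l kl; first by case: l {kl}.
by congr y; apply: val_inj; rewrite kl.
Qed.

End VectorWedge.

Lemma ext_map_vwedge (V W : zmodType) (h : {additive V -> W}) i v (x : ext V i) :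
  ext_map h (vwedge v x) = vwedge (h v) (ext_map h x).
Proof.
have [wl wr] := (@vwedge_biadditive V i, @vwedge_biadditive W i).
elim/ext_ind: x => [|x y hx hy|x].
- by rewrite (morphD0 (wl.2 v)) !raddf0 (morphD0 (wr.2 _)).
- by rewrite (morphDB (wl.2 v)) !raddfB /= (morphDB (wr.2 _)) hx hy.
rewrite vwedgeE !ext_mapE ?vwedgeE; try exact: raddfB.
by congr wedges; apply: funext => k /=; case: unlift.
Qed.

Lemma ext_map0 (V W : zmodType) (h : {additive V -> W}) (x : 'I_0 -> V) y :
  ext_map h (wedges x) = wedges y.
Proof.
by rewrite ext_mapE; [congr wedges; apply: funext => -[]|exact: raddfB].
Qed.

(** * Noncommutative forms *)

Lemma morphB_sum_mulrz (U W : zmodType) (g : U -> W) (I : finType) (F : I -> U)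
    (c : I -> int) : {morph g : x y / x - y} ->
  g (\sum_i F i *~ c i) = \sum_i g (F i) *~ c i.
Proof.
move=> gB; pose g' : {additive U -> W} := HB.pack g (GRing.isZmodMorphism.Build U W g gB).
rewrite -[g]/(g' : U -> W) raddf_sum; apply: eq_bigr => i _; exact: raddfMz.
Qed.

Section NatWords.
Variable S : pzRingType.
Implicit Types s t : nat -> S.

(* Words are handled as restrictions of functions on nat, so that no
   coercion to an ordinal is left inside the word operations. *)
Definition word n s : 'I_n -> S := fun k => s k.

Definition ninsert1 i s k : S :=
  if (k < i)%N then s k else if k == i then 1 else s k.-1.
Definition nmerge j s k : S :=
  if (k < j)%N then s k else if k == j then s k * s k.+1 else s k.+1.
Definition njuxt n s t k : S := if (k <= n)%N then s k else t (k - n.+1)%N.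
Definition nlmul x s k : S := if k == 0%N then x * s k else s k.
Definition lmul n x (s : 'I_n -> S) : 'I_n -> S :=
  fun k => if k == 0%N :> nat then x * s k else s k.

Lemma wordE n (s : 'I_n.+1 -> S) : s = word (fun k => s (inord k)).
Proof. by apply: funext => k; rewrite /word inord_val. Qed.

Lemma eq_word n s t : (forall k, (k < n)%N -> s k = t k) -> @word n s = word t.
Proof. by move=> st; apply: funext => k; apply: st. Qed.

Lemma insert1_word n i s : (i <= n.+1)%N ->
  insert1 i (@word n.+1 s) = word (ninsert1 i s).
Proof.
move=> i_n; apply: funext => k; have := ltn_ord k => kn.
rewrite /insert1 /word /ninsert1.
by repeat case: ifP => ?; rewrite ?inordK //; lia.
Qed.

Lemma merge_word n j s : (j <= n)%N ->
  merge j (@word n.+2 s) = word (nmerge j s).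
Proof.
move=> jn; apply: funext => k; have := ltn_ord k => kn.
rewrite /merge /word /nmerge.
by repeat case: ifP => ?; rewrite ?inordK //; lia.
Qed.

Lemma juxt_word n m s t : juxt (@word n.+1 s) (@word m.+1 t) = word (njuxt n s t).
Proof.
apply: funext => k; have := ltn_ord k => kn; rewrite /juxt /word /njuxt.
by repeat case: ifP => ?; rewrite ?inordK //; lia.
Qed.

Lemma lmul_word n x s : lmul x (@word n s) = word (nlmul x s).
Proof. by []. Qed.

Lemma mulpairs_word n s :
  mulpairs (@word (n + n).+2 s) = word (fun k => s k.*2 * s k.*2.+1).
Proof.
by apply: funext => k; have := ltn_ord k => kn; rewrite /mulpairs /word !inordK //; lia.
Qed.

Lemma lmul_upd n x (s : 'I_n -> S) i w :
  lmul x (upd s i w) = upd (lmul x s) i (if i == 0%N :> nat then x * w else w).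
Proof.
apply: funext => k; rewrite /lmul !updE.
by have [->|] := eqVneq (i : nat) k; case: ifP.
Qed.

End NatWords.
Arguments word {S} n s.

Ltac word_cases :=
  rewrite /ninsert1 /nmerge /njuxt /nlmul /=;
  repeat case: ifP => ?; try lia; rewrite ?(mul1r, mulr1, mulrA) //;
  repeat (f_equal; try lia).

Section FormOps.
Variables (R S : pzRingType) (f : {rmorphism R -> S}).
Local Notation om := (omega f).
Local Notation d := (@om_d R S f _).

Lemma om_d0 n : d (0 : om n) = 0. Proof. exact: raddf0. Qed.
Lemma om_dB n (u v : om n) : d (u - v) = d u - d v. Proof. exact: raddfB. Qed.

Lemma form_ind n (Q : om n -> Prop) :
  Q 0 -> (forall u v, Q u -> Q v -> Q (u - v)) ->
  (forall s : nat -> S, Q (form f (word n.+1 s))) -> forall u, Q u.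
Proof. by move=> Q0 QB Qf; apply: omega_ind => // s; rewrite (wordE s). Qed.

Lemma form_word_vanish n (s : nat -> S) k a : (0 < k <= n)%N -> s k = f a ->
  form f (word n.+1 s) = 0.
Proof.
move=> kn sk; have -> : word n.+1 s = upd (word n.+1 s) (inord k) (f a).
  apply: funext => l; rewrite updE inordK; last by lia.
  by case: eqP => // kl; rewrite -sk kl.
by apply: form_vanish; rewrite inordK; lia.
Qed.

Lemma ract_form n (s : 'I_n.+1 -> S) a :
  ract (form f s) a = form f (upd s ord_max (s ord_max * f a)).
Proof.
rewrite [LHS]tensor_ractE; congr tens.
by rewrite -om_clsr -om_cls_upd.
Qed.

Lemma lact_form n (s : 'I_n.+1 -> S) a : lact a (form f s) = form f (lmul (f a) s).
Proof.
rewrite [LHS]tensor_lactE; congr tens.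
rewrite -om_clsl -om_cls_upd; apply: functional_extensionality_dep => k.
rewrite updE /lmul eq_sym; case: eqP => //= k0.
by congr (om_cls f k (_ * s _)); apply: val_inj.
Qed.

(** The product with a form of degree 0, defined directly on the first entry and not through the
    alternating sum of [om_mul]. *)
Definition om_l n (x : S) : om n -> om n := om_lift (fun s => form f (lmul x s)).
Lemma om_l0 n x : om_l x (0 : om n) = 0. Proof. exact: raddf0. Qed.
Lemma om_lB n x (u v : om n) : om_l x (u - v) = om_l x u - om_l x v.
Proof. exact: raddfB. Qed.

Lemma om_l_form n x (s : 'I_n.+1 -> S) : om_l x (form f s) = form f (lmul x s).
Proof.
apply: om_liftE => [t i u v|t i j a ij|t i a /= i0]; rewrite !lmul_upd.
- by case: ifP => _; rewrite ?mulrDr form_madd.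
- have -> : (j == 0%N :> nat) = false by rewrite ij.
  transitivity (form f (upd (lmul x t) i (lmul x t i * f a))).
    by rewrite /lmul; case: ifP => _; rewrite ?mulrA.
  by rewrite (@form_bal R S f n _ _ _ a ij) /lmul ij.
by rewrite eqn0Ngt i0; exact: form_vanish.
Qed.

Lemma om_lM n x y (w : om n) : om_l (x * y) w = om_l x (om_l y w).
Proof.
elim/form_ind: w => [|u v hu hv|s]; rewrite ?(om_l0, om_d0) //; first by rewrite !(om_lB, om_dB) hu hv.
by rewrite !om_l_form !lmul_word; congr form; apply: eq_word => k kn; word_cases.
Qed.

Lemma om_lD n (w : om n) : {morph (fun x => om_l x w) : x y / x + y}.
Proof.
move=> x y; elim/omega_ind: w => [|u v hu hv|s]; rewrite ?om_l0 ?addr0 //.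
  by rewrite !(om_lB, om_dB) hu hv opprD addrACA.
rewrite !om_l_form.
have E z : lmul z s = upd s ord0 (z * s ord0).
  apply: funext => k; rewrite /lmul updE eq_sym; case: eqP => //= k0.
  by congr (_ * s _); apply: val_inj.
by rewrite !E mulrDl form_madd.
Qed.

Lemma om_d_word n s : d (form f (word n.+1 s)) = form f (word n.+2 (ninsert1 0 s)).
Proof. by rewrite om_dE insert1_word. Qed.

Lemma om_l_word n x s : om_l x (form f (word n.+1 s)) = form f (word n.+1 (nlmul x s)).
Proof. exact: om_l_form. Qed.

Lemma om_dd n (w : om n) : d (d w) = 0.
Proof.
elim/form_ind: w => [|u v hu hv|s]; rewrite ?(om_l0, om_d0) //.
  by rewrite !(om_lB, om_dB) hu hv subrr.
rewrite !om_d_word; apply: (@form_word_vanish _ _ 1%N 1) => //.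
by rewrite rmorph1.
Qed.

Lemma om_dD n (u v : om n) : d (u + v) = d u + d v. Proof. exact: raddfD. Qed.

(* The commutator of d with the left multiplication by x, which is the left
   multiplication by dx. *)
Definition om_dl n (x : S) (w : om n) : om n.+1 := d (om_l x w) - om_l x (d w).

Lemma om_dlB n x (u v : om n) : om_dl x (u - v) = om_dl x u - om_dl x v.
Proof. by rewrite /om_dl om_lB !om_dB om_lB !opprD !opprK addrACA. Qed.

Lemma om_dl0 n x : om_dl x (0 : om n) = 0.
Proof. by rewrite /om_dl om_l0 !om_d0 om_l0 subrr. Qed.

Lemma om_dlD n (w : om n) : {morph (fun x => om_dl x w) : x y / x + y}.
Proof. by move=> x y; rewrite /om_dl !om_lD om_dD opprD addrACA. Qed.

Lemma om_dlM n x y (w : om n) :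
  om_dl (x * y) w = om_l x (om_dl y w) + om_dl x (om_l y w).
Proof. by rewrite /om_dl !om_lM om_lB [RHS]addrC subrKA. Qed.

Lemma om_d_dl n x (w : om n) : d (om_dl x w) = - om_dl x (d w).
Proof. by rewrite /om_dl om_dB !om_dd om_l0 subr0 sub0r. Qed.

(** In 1 (x) (f a) s_0 (x) ... the factor f a slides across the tensor sign onto the inserted 1, so
    d is left R-linear. *)
Lemma om_dl_base n a (w : om n) : om_dl (f a) w = 0.
Proof.
rewrite /om_dl; apply/eqP; rewrite subr_eq0; apply/eqP.
elim/form_ind: w => [|u v hu hv|s]; rewrite ?(om_l0, om_d0) //.
  by rewrite !(om_lB, om_dB) hu hv.
rewrite om_l_word !om_d_word om_l_word.
pose t := ninsert1 0 s.
have [i0 i1] : (inord 0 : 'I_n.+2) = 0%N :> nat /\ (inord 1 : 'I_n.+2) = 1%N :> nat.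
  by rewrite !inordK.
have := @form_bal R S f _ (word n.+2 t) (inord 0) (inord 1) a.
rewrite i0 i1 => /(_ erefl) E.
transitivity (form f (upd (word n.+2 t) (inord 1) (f a * word n.+2 t (inord 1)))).
  congr form; apply: funext => k; rewrite updE /word /t i1.
  by word_cases.
rewrite -E; congr form; apply: funext => k; rewrite updE /word /t i0.
by word_cases.
Qed.

Lemma om_lact n a (w : om n) : lact a w = om_l (f a) w.
Proof.
have [D _ _ _ _ _ _ _ _] := bimoduleP (om n).
elim/omega_ind: w => [|u v hu hv|s].
- by rewrite om_l0 (morphD0 (D a)).
- by rewrite om_lB (morphDB (D a)) hu hv.
by rewrite om_l_form lact_form.
Qed.

Lemma om_l_ract n x (w : om n) a : om_l x (ract w a) = ract (om_l x w) a.
Proof.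
have [_ _ _ _ _ D _ _ _] := bimoduleP (om n).
elim/omega_ind: w => [|u v hu hv|s].
- by rewrite (morphD0 (D a)) om_l0 (morphD0 (D a)).
- by rewrite (morphDB (D a)) !om_lB (morphDB (D a)) hu hv.
rewrite !(ract_form, om_l_form) lmul_upd; congr (form f (upd _ _ _)).
by rewrite /lmul; case: ifP => _; rewrite ?mulrA.
Qed.

Lemma om_d_ract n (w : om n) a : d (ract w a) = ract (d w) a.
Proof.
have [_ _ _ _ _ D _ _ _] := bimoduleP (om n).
have [_ _ _ _ _ D' _ _ _] := bimoduleP (om n.+1).
elim/omega_ind: w => [|u v hu hv|s].
- by rewrite (morphD0 (D a)) om_d0 (morphD0 (D' a)).
- by rewrite (morphDB (D a)) !om_dB (morphDB (D' a)) hu hv.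
rewrite ract_form !om_dE insert1_upd // ract_form.
have -> : ord_max = inord (bump 0 (ord_max : 'I_n.+1)) :> 'I_n.+2.
  by apply: val_inj; rewrite /= inordK.
by rewrite insert1_at.
Qed.

Lemma om_dl_ract n x (w : om n) a : om_dl x (ract w a) = ract (om_dl x w) a.
Proof.
have [_ _ _ _ _ D _ _ _] := bimoduleP (om n.+1).
by rewrite /om_dl om_l_ract !om_d_ract om_l_ract (morphDB (D a)).
Qed.

Lemma om_mul_word n m s t :
  om_mul (form f (word n.+1 s)) (form f (word m.+1 t)) =
  \sum_(i < n.+1) form f (word (n + m).+1 (nmerge i (njuxt n s t))) *~ (-1) ^+ (n - i).
Proof.
rewrite om_mulE juxt_word /om_mul_form; apply: eq_bigr => i _.
by rewrite merge_word //; have := ltn_ord i; lia.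
Qed.

Lemma om_mul_l n m x (w : om n) (z : om m) : om_mul (om_l x w) z = om_l x (om_mul w z).
Proof.
have [ml mr] := @om_mul_biadditive R S f n m.
elim/form_ind: w => [|u v hu hv|s].
- by rewrite om_l0 (morphD0 (ml z)) om_l0.
- by rewrite om_lB !(morphDB (ml z)) hu hv om_lB.
elim/form_ind: z => [|u v hu hv|t].
- by rewrite !(morphD0 (mr _)) om_l0.
- by rewrite !(morphDB (mr _)) hu hv om_lB.
rewrite om_l_word !om_mul_word (morphB_sum_mulrz _ _ (om_lB x)); apply: eq_bigr => i _.
rewrite om_l_word; congr (form f _ *~ _); apply: eq_word => k kn.
by word_cases.
Qed.

(** In degree n + 1 the product has n + 2 summands. Those of index 0 for d(xw) and x dw both merge
    to x s_0 and cancel; those of index i + 1 form the commutator applied to the summand of index i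
    of wz, with the same sign. This takes the place of the Leibniz rule. *)
Lemma om_mul_dl n m x (w : om n) (z : om m) :
  om_mul (om_dl x w) z = om_dl x (om_mul w z).
Proof.
have [ml mr] := @om_mul_biadditive R S f n m.
have [ml' mr'] := @om_mul_biadditive R S f n.+1 m.
elim/form_ind: w => [|u v hu hv|s].
- by rewrite om_dl0 (morphD0 (ml z)) (morphD0 (ml' z)) om_dl0.
- by rewrite om_dlB (morphDB (ml z)) (morphDB (ml' z)) hu hv om_dlB.
elim/form_ind: z => [|u v hu hv|t].
- by rewrite (morphD0 (mr _)) (morphD0 (mr' _)) om_dl0.
- by rewrite (morphDB (mr _)) (morphDB (mr' _)) hu hv om_dlB.
rewrite {1}/om_dl !(om_l_word, om_d_word) (morphDB (ml' _)) !om_mul_word -sumrB.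
rewrite big_ord_recl /= -mulrzBl [X in X *~ _](_ : _ = 0) ?mul0rz ?add0r; last first.
  apply/eqP; rewrite subr_eq0; apply/eqP; congr form; apply: eq_word => k kn.
  by word_cases.
rewrite (morphB_sum_mulrz _ _ (om_dlB x)); apply: eq_bigr => i _; rewrite /om_dl.
rewrite !(om_l_word, om_d_word) -mulrzBl /bump /= add1n subSS.
by congr ((form f _ - form f _) *~ _); apply: eq_word => k kn; word_cases.
Qed.

Lemma om_mul1l m (z : om m) : om_mul (om_one f) z = z.
Proof.
have [ml mr] := @om_mul_biadditive R S f 0 m.
elim/form_ind: z => [|u v hu hv|t].
- by rewrite (morphD0 (mr _)).
- by rewrite (morphDB (mr _)) hu hv.
have -> : om_one f = form f (word 1 (fun=> 1)) by [].
rewrite om_mul_word big_ord1 mulr1z; congr form; apply: eq_word => k kn.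
by word_cases.
Qed.

Lemma om_d_l n x (w : om n) : d (om_l x w) = om_dl x w + om_l x (d w).
Proof. by rewrite /om_dl subrK. Qed.

(** Peels off s_0 ds_1: in the commutator defining ds_1, the subtracted term contains d1 and
    vanishes. *)
Lemma form_word_cons n s :
  form f (word n.+2 s) =
  om_l (s 0%N) (om_dl (s 1%N) (form f (word n.+1 (fun k => if k == 0%N then 1 else s k.+1)))).
Proof.
rewrite /om_dl om_l_word !om_d_word !om_l_word.
rewrite [X in _ - X](@form_word_vanish _ _ 1%N 1) ?rmorph1 // subr0 om_l_word.
by congr form; apply: eq_word => k kn; word_cases.
Qed.

End FormOps.

(** * The ring K Omega *)

(** Bookkeeping for [K_op_exchange]: e is the term carrying both v and w, which occurs with opposite
    signs. *)
Lemma exchange_addr (G : zmodType) (a b b' c c' e : G) :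
  a + b + (c - e) + (a + b' + (c' + e)) = a + (c' + b) + (a + (c + b')).
Proof.
rewrite addrACA [c' + e]addrC subrKA.
by rewrite (AC (2*2*2) ((1*(6*2))*(3*(5*4)))) /=.
Qed.

(** Bookkeeping for [K_map_op]: b is the dx term at v_(alpha 0), coming once from d(xa) and once,
    with a minus sign, from alpha v_k = v_(alpha k) - v_(alpha 0). *)
Lemma shear_addr (G : zmodType) (a b b' c e : G) :
  a + (b + c) + (b' - b + e) = a + b' + (c + e).
Proof.
rewrite -addrA (addrC b c) -(addrA c) (addrA b) [b + _]addrC subrK.
by rewrite (addrCA c) addrA.
Qed.

Lemma additive_morphD (U W : zmodType) (g : U -> W) :
  {morph g : x y / x - y} -> {morph g : x y / x + y}.
Proof.
move=> gB x y; have g0 : g 0 = 0 by rewrite -(subrr 0) gB subrr.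
by rewrite -[y in LHS]opprK gB -[- y]sub0r gB g0 sub0r opprK.
Qed.

Lemma subgroup_mulrz (V : zmodType) (Q : V -> Prop) :
  Q 0 -> (forall u v, Q u -> Q v -> Q (u - v)) -> forall v (m : int), Q v -> Q (v *~ m).
Proof.
move=> Q0 QB v m Qv.
have QN u : Q u -> Q (- u) by move=> Qu; rewrite -sub0r; exact: QB.
have Qn k : Q (v *+ k).
  elim: k => [//|k IH]; rewrite mulrS -[X in _ + X]opprK; exact/QB/QN.
case: m => m; first by rewrite -pmulrn.
by rewrite NegzE mulrNz -pmulrn; exact/QN.
Qed.

Section KerSumBasis.
Variable n : nat.

Lemma vbasis0 : vbasis (ord0 : 'I_n.+1) = 0.
Proof. by apply/val_inj/ffunP => i; rewrite !ffunE subrr. Qed.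

(** The coordinates of v sum to 0, so e_k may be replaced by e_k - e_0. *)
Lemma ker_sum_expand (v : ker_sum n) :
  v = \sum_(k < n.+1) vbasis k *~ v k.
Proof.
pose g : {additive ker_sum n -> {ffun 'I_n.+1 -> int}} := val.
apply: val_inj; rewrite -![val _]/(g _) raddf_sum; apply/ffunP => i.
rewrite sum_ffunE (eq_bigr (fun k => ((i == k)%:R - (i == ord0)%:R) * v k)); last first.
  by move=> k _; rewrite raddfMz /= ffunMzE !ffunE mulrzz.
under eq_bigr do rewrite mulrBl.
rewrite sumrB -mulr_sumr (eqP (ker_sumP v)) mulr0 subr0 (bigD1 i) //= eqxx mul1r.
by rewrite big1 ?addr0 // => k /negPf; rewrite eq_sym => ->; rewrite mul0r.
Qed.

Lemma ker_sum_ind (Q : ker_sum n -> Prop) :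
  Q 0 -> (forall u v, Q u -> Q v -> Q (u - v)) -> (forall k, Q (vbasis k)) ->
  forall v, Q v.
Proof.
move=> Q0 QB Qb v; rewrite (ker_sum_expand v); apply: (big_ind Q) => // [x y Qx Qy|k _].
  by rewrite -[y]opprK; apply: (QB) => //; rewrite -sub0r; exact: QB.
exact: subgroup_mulrz.
Qed.

End KerSumBasis.

Section KOps.
Variables (R S : pzRingType) (f : {rmorphism R -> S}).
Local Notation om := (omega f).
Local Notation d := (@om_d R S f _).
Local Notation KO := (K om).
Local Notation KB := (K_bimodule om).

Lemma om_lDr n x (a b : om n) : om_l x (a + b) = om_l x a + om_l x b.
Proof. exact: additive_morphD (om_lB x) _ _. Qed.
Lemma om_dlDr n x (a b : om n) : om_dl x (a + b) = om_dl x a + om_dl x b.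
Proof. exact: additive_morphD (om_dlB x) _ _. Qed.

Lemma K_gen0l n i (y : ext (ker_sum n) i) : K_gen (0 : om i) y = 0 :> KO n.
Proof. exact: morphD0 ((K_gen_biadditive om n i).1 y). Qed.
Lemma K_gen0r n i (a : om i) : K_gen a (0 : ext (ker_sum n) i) = 0 :> KO n.
Proof. exact: morphD0 ((K_gen_biadditive om n i).2 a). Qed.
Lemma K_genBl n i (a b : om i) (y : ext (ker_sum n) i) :
  K_gen (a - b) y = K_gen a y - K_gen b y :> KO n.
Proof. exact: morphDB ((K_gen_biadditive om n i).1 y) _ _. Qed.
Lemma K_genDl n i (a b : om i) (y : ext (ker_sum n) i) :
  K_gen (a + b) y = K_gen a y + K_gen b y :> KO n.
Proof. exact: (K_gen_biadditive om n i).1. Qed.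
Lemma K_genNl n i (a : om i) (y : ext (ker_sum n) i) :
  K_gen (- a) y = - K_gen a y :> KO n.
Proof. exact: morphDN ((K_gen_biadditive om n i).1 y) _. Qed.
Lemma K_genBr n i (a : om i) (x y : ext (ker_sum n) i) :
  K_gen a (x - y) = K_gen a x - K_gen a y :> KO n.
Proof. exact: morphDB ((K_gen_biadditive om n i).2 a) _ _. Qed.
Lemma K_genDr n i (a : om i) (x y : ext (ker_sum n) i) :
  K_gen a (x + y) = K_gen a x + K_gen a y :> KO n.
Proof. exact: (K_gen_biadditive om n i).2. Qed.
Lemma K_genNr n i (a : om i) (y : ext (ker_sum n) i) :
  K_gen a (- y) = - K_gen a y :> KO n.
Proof. exact: morphDN ((K_gen_biadditive om n i).2 a) _. Qed.

End KOps.

(* Left multiplication by x, by dx (x) v, and by their sum. They are sealed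
   because conversion would otherwise unfold them, at a prohibitive cost. *)
HB.lock Definition K_l (R S : pzRingType) (f : {rmorphism R -> S}) n (x : S) :
    K (omega f) n -> K (omega f) n :=
  K_lift (fun i (a : omega f i) y => K_gen (om_l x a) y : K (omega f) n).
HB.lock Definition K_dl (R S : pzRingType) (f : {rmorphism R -> S}) n (x : S)
    (v : ker_sum n) : K (omega f) n -> K (omega f) n :=
  K_lift (fun i (a : omega f i) y => K_gen (om_dl x a) (vwedge v y) : K (omega f) n).
HB.lock Definition K_op (R S : pzRingType) (f : {rmorphism R -> S}) n (x : S)
  (v : ker_sum n) (u : K (omega f) n) : K (omega f) n := K_l x u + K_dl x v u.

Section KOps.
Variables (R S : pzRingType) (f : {rmorphism R -> S}).
Local Notation om := (omega f).
Local Notation d := (@om_d R S f _).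
Local Notation KO := (K om).
Local Notation KB := (K_bimodule om).


Lemma K_lB n x (u w : KO n) : K_l x (u - w) = K_l x u - K_l x w.
Proof. rewrite K_l.unlock; exact: raddfB. Qed.
Lemma K_l0 n x : K_l x (0 : KO n) = 0. Proof. rewrite K_l.unlock; exact: raddf0. Qed.
Lemma K_dlB n x v (u w : KO n) : K_dl x v (u - w) = K_dl x v u - K_dl x v w.
Proof. rewrite K_dl.unlock; exact: raddfB. Qed.
Lemma K_dl0 n x v : K_dl x v (0 : KO n) = 0. Proof. rewrite K_dl.unlock; exact: raddf0. Qed.

Lemma K_lE n x i (a : om i) (y : ext (ker_sum n) i) :
  K_l x (K_gen a y) = K_gen (om_l x a) y.
Proof.
rewrite K_l.unlock; apply: K_liftE => j.
split=> [z b c|b z z']; last by rewrite K_genDr.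
by rewrite om_lDr K_genDl.
Qed.

Lemma K_dlE n x v i (a : om i) (y : ext (ker_sum n) i) :
  K_dl x v (K_gen a y) = K_gen (om_dl x a) (vwedge v y).
Proof.
rewrite K_dl.unlock; apply: K_liftE => j; have [wl wr] := @vwedge_biadditive (ker_sum n) j.
split=> [z b c|b z z']; last by rewrite wr K_genDr.
by rewrite om_dlDr K_genDl.
Qed.

Lemma K_opB n x v (u w : KO n) : K_op x v (u - w) = K_op x v u - K_op x v w.
Proof. by rewrite !K_op.unlock K_lB K_dlB opprD addrACA. Qed.

Lemma K_op0 n x v : K_op x v (0 : KO n) = 0.
Proof. by rewrite !K_op.unlock K_l0 K_dl0 addr0. Qed.

Lemma K_opD n x v (u w : KO n) : K_op x v (u + w) = K_op x v u + K_op x v w.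
Proof. exact: additive_morphD (K_opB x v) _ _. Qed.

Lemma K_opE n x v i (a : om i) (y : ext (ker_sum n) i) :
  K_op x v (K_gen a y) = K_gen (om_l x a) y + K_gen (om_dl x a) (vwedge v y).
Proof. by rewrite !K_op.unlock K_lE K_dlE. Qed.

Lemma K_op_lD n (v : ker_sum n) (u : KO n) :
  {morph (fun x => K_op x v u) : x y / x + y}.
Proof.
move=> x y; elim/K_ind: u => [|u w hu hw|i a z].
- by rewrite !K_op0 addr0.
- by rewrite !K_opB hu hw opprD addrACA.
by rewrite !K_opE om_lD om_dlD !K_genDl addrACA.
Qed.

Lemma K_dl_vB n x (v w : ker_sum n) (u : KO n) :
  K_dl x (v - w) u = K_dl x v u - K_dl x w u.
Proof.
elim/K_ind: u => [|u u' hu hu'|i a z].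
- by rewrite !K_dl0 subr0.
- by rewrite !K_dlB hu hu' !opprB addrACA [in RHS]addrACA [- _ + _]addrC.
by rewrite !K_dlE (morphDB ((@vwedge_biadditive _ i).1 z)) K_genBr.
Qed.

(** As v_0 = 0, left multiplication by x is E_0(x); with [K_dl_op], the operators at basis vectors
    thus recover x and dx (x) v_k separately. *)
Lemma K_l_op n x (u : KO n) : K_l x u = K_op x (vbasis ord0) u.
Proof.
have d0 : K_dl x (vbasis ord0) u = 0 by rewrite vbasis0 -(subrr 0) K_dl_vB subrr.
by rewrite K_op.unlock d0 addr0.
Qed.

Lemma K_dl_op n x v (u : KO n) : K_dl x v u = K_op x v u - K_op x (vbasis ord0) u.
Proof. by rewrite -K_l_op K_op.unlock addrAC subrr add0r. Qed.

(** The term dx dy (x) v /\ v vanishes, and [om_dlM] collects the two terms linear in v. *)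
Lemma K_opM n x y v (u : KO n) : K_op x v (K_op y v u) = K_op (x * y) v u.
Proof.
elim/K_ind: u => [|u w hu hw|i a z].
- by rewrite !K_op0.
- by rewrite !K_opB hu hw.
rewrite !K_opE K_opD !K_opE vwedgeK K_gen0r addr0 om_lM om_dlM K_genDl.
by rewrite -addrA [X in _ + X]addrC.
Qed.

(** The terms in v /\ w and w /\ v share the same form factor and cancel. *)
Lemma K_op_exchange n x y v w (u : KO n) :
  K_op x v (K_op y w u) + K_op x w (K_op y v u) = K_op (x * y) v u + K_op (x * y) w u.
Proof.
elim/K_ind: u => [|u u' hu hu'|i a z].
- by rewrite !K_op0.
- by rewrite !K_opB [LHS]addrACA -[X in _ + X]opprD hu hu' opprD [RHS]addrACA.
rewrite ![K_op y _ _]K_opE !K_opD !K_opE om_lM om_dlM ![K_gen (om_l x _ + _) _]K_genDl (vwedgeC v) K_genNr.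
exact: exchange_addr.
Qed.

Lemma lact_gen n r i (a : om i) (y : ext (ker_sum n) i) :
  @lact R (KB n) r (K_gen a y) = K_gen (lact r a) y.
Proof. exact: K_lactE. Qed.

Lemma lact0 (M : bimodule R) r : lact r (0 : M) = 0.
Proof. exact: morphD0 (lactDr (bimoduleP M) r). Qed.
Lemma lactB (M : bimodule R) r (u v : M) : lact r (u - v) = lact r u - lact r v.
Proof. exact: morphDB (lactDr (bimoduleP M) r) _ _. Qed.
Lemma ract0 (M : bimodule R) r : ract (0 : M) r = 0.
Proof. exact: morphD0 (ractDl (bimoduleP M) r). Qed.
Lemma ractB (M : bimodule R) r (u v : M) : ract (u - v) r = ract u r - ract v r.
Proof. exact: morphDB (ractDl (bimoduleP M) r) _ _. Qed.

(** Since [d, f r] = 0, the vector v does not matter. This independence is what makes phi balanced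
    over R. *)
Lemma K_op_base n r v (u : KB n) : K_op (f r) v u = lact r u.
Proof.
elim/K_ind: u => [|u w hu hw|i a z].
- by rewrite K_op0 lact0.
- by rewrite K_opB lactB hu hw.
by rewrite K_opE om_dl_base K_gen0l addr0 lact_gen om_lact.
Qed.

Lemma K_op1 n v (u : KB n) : K_op 1 v u = u.
Proof. by rewrite -(rmorph1 f) K_op_base (lact1 (bimoduleP _)). Qed.

Lemma K_op_lact n x v r (u : KB n) : lact r (K_op x v u : KB n) = K_op (f r * x) v u.
Proof. by rewrite -(K_op_base _ v) K_opM. Qed.

Lemma K_op_ract n x v r (u : KB n) : K_op x v (ract u r) = ract (K_op x v u : KB n) r.
Proof.
have rE i (a : om i) (y : ext (ker_sum n) i) :
  @ract R (KB n) (K_gen a y) r = K_gen (ract a r) y by exact: K_ractE.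
elim/K_ind: u => [|u w hu hw|i a z].
- by rewrite ract0 K_op0 ract0.
- by rewrite ractB !K_opB hu hw ractB.
rewrite rE !K_opE om_l_ract om_dl_ract -!rE.
by rewrite (ractDl (bimoduleP _)).
Qed.

Local Notation Kmul := (K_mul (@om_mul R S f)).
Local Notation K1 := (@K_one R om (om_one f)).

Let om_mulD := @om_mul_biadditive R S f.

Let K_mul_gen_l n i (a : om i) (y : ext (ker_sum n) i) : KO n -> KO n :=
  K_lift (fun j (b : om j) z => K_gen (om_mul a b) (wedge y z) : KO n).

Let K_mul_gen_lE n i (a : om i) (y : ext (ker_sum n) i) j (b : om j) z :
  K_mul_gen_l a y (K_gen b z) = K_gen (om_mul a b) (wedge y z).
Proof.
apply: K_liftE => k; have [wl wr] := wedge_biadditive (ker_sum n) i k.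
have [ml mr] := om_mulD i k.
by split=> [t c c'|c t t'] /=; rewrite ?mr ?wr ?K_genDl ?K_genDr.
Qed.

(** A lift computes only on maps that respect the relations, so biadditivity in the left argument
    has to be known for an arbitrary right argument v before the outer lift can be unfolded. *)
Let K_mul_genE n i (a : om i) (y : ext (ker_sum n) i) v :
  Kmul (K_gen a y) v = K_mul_gen_l a y v.
Proof.
have H k : biadditive (fun (c : om k) t => K_mul_gen_l c t v).
  elim/K_ind: v => [|u u' [hl hr] [hl' hr']|j b z].
  - by split=> [t c c'|c t t']; rewrite /K_mul_gen_l !raddf0 addr0.
  - have E c t : K_mul_gen_l c t (u - u') = K_mul_gen_l c t u - K_mul_gen_l c t u'.
      exact: raddfB.
    by split=> [t c c'|c t t']; rewrite !E (hl, hr) (hl', hr') opprD addrACA.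
  have [pl pr] := wedge_biadditive (ker_sum n) k j; have [ml mr] := om_mulD k j.
  split=> [t c c'|c t t']; rewrite !K_mul_gen_lE.
    by rewrite ml K_genDl.
  by rewrite pl K_genDr.
by rewrite /K_mul (K_liftE _ _ H).
Qed.

Lemma K_mulBl n (u v w : KO n) : Kmul (u - v) w = Kmul u w - Kmul v w.
Proof. exact: raddfB. Qed.

Lemma K_mul0l n (w : KO n) : Kmul 0 w = 0.
Proof. exact: raddf0. Qed.

Lemma K_mulBr n (u v w : KO n) : Kmul u (v - w) = Kmul u v - Kmul u w.
Proof.
elim/K_ind: u => [|u u' hu hu'|i a z].
- by rewrite !K_mul0l subrr.
- by rewrite !K_mulBl hu hu' !opprB addrACA [in RHS]addrACA [- _ + _]addrC.
by rewrite !K_mul_genE; exact: raddfB.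
Qed.

Lemma K_mul0r n (w : KO n) : Kmul w 0 = 0.
Proof. by rewrite -[in LHS](subrr 0) K_mulBr subrr. Qed.

Lemma K_mulDl n (u v w : KO n) : Kmul (u + v) w = Kmul u w + Kmul v w.
Proof. exact: raddfD. Qed.

Lemma K_mulDr n (u v w : KO n) : Kmul u (v + w) = Kmul u v + Kmul u w.
Proof. exact: additive_morphD (K_mulBr u) _ _. Qed.

Lemma K_mul_op n x v (u w : KO n) : Kmul (K_op x v u) w = K_op x v (Kmul u w).
Proof.
elim/K_ind: u => [|u u' hu hu'|i a y].
- by rewrite K_op0 !K_mul0l K_op0.
- by rewrite K_opB !K_mulBl hu hu' K_opB.
elim/K_ind: w => [|w w' hw hw'|j b z].
- by rewrite !K_mul0r K_op0.
- by rewrite !K_mulBr hw hw' K_opB.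
rewrite K_opE K_mulDl !K_mulE // K_opE om_mul_l om_mul_dl.
by rewrite wedge_vwedge.
Qed.

Lemma K_mul1l n (u : KO n) : Kmul (K1 n) u = u.
Proof.
elim/K_ind: u => [|u u' hu hu'|i a y]; first exact: K_mul0r.
  by rewrite K_mulBr hu hu'.
by rewrite K_mulE // om_mul1l wedge0l.
Qed.

Section Map.
Variables (n m : nat) (alpha : 'I_n.+1 -> 'I_m.+1).
Local Notation Kmap := (K_map (@om_d R S f) alpha).

Lemma K_mapB (u v : KO n) : Kmap (u - v) = Kmap u - Kmap v.
Proof. exact: raddfB. Qed.

Lemma K_map0 : Kmap 0 = 0.
Proof. exact: raddf0. Qed.

Lemma K_mapD (u v : KO n) : Kmap (u + v) = Kmap u + Kmap v.
Proof. exact: raddfD. Qed.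

Lemma K_map_gen i (a : om i) (y : ext (ker_sum n) i) :
  Kmap (K_gen a y) = K_gen a (ext_map (ker_sum_map alpha) y) +
    K_gen (d a) (vwedge (vbasis (alpha ord0)) (ext_map (ker_sum_map alpha) y)).
Proof. by apply: K_mapE => j; exact: om_dB. Qed.

(** The term in da (x) v_(alpha 0) of alpha compensates the shift of alpha v_k by v_(alpha 0); in
    the quadratic term, the sign of d dx = - dx d cancels that of exchanging two vectors. *)
Lemma K_map_op x k (u : KO n) :
  Kmap (K_op x (vbasis k) u) = K_op x (vbasis (alpha k)) (Kmap u).
Proof.
elim/K_ind: u => [|u u' hu hu'|i a y]; first by rewrite K_op0 K_map0 K_op0.
  by rewrite K_opB !K_mapB K_opB hu hu'.
rewrite K_opE K_mapD !K_map_gen K_opD !K_opE ext_map_vwedge /= ker_sum_map_vbasis.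
move: (vbasis (alpha k)) (vbasis (alpha ord0)) (ext_map _ y) => v w z.
have wB p (t : ext (ker_sum m) p) : vwedge (v - w) t = vwedge v t - vwedge w t.
  exact: morphDB ((@vwedge_biadditive _ _).1 t) _ _.
have wBr : vwedge w (vwedge v z - vwedge w z) = vwedge w (vwedge v z).
  by rewrite (morphDB ((@vwedge_biadditive _ _).2 _)) vwedgeK subr0.
rewrite !wB wBr om_d_dl K_genBr. rewrite om_d_l K_genDl [X in _ = _ + (_ + X)](_ : _ = K_gen (- om_dl x (d a)) (vwedge w (vwedge v z))).
  exact: shear_addr.
by rewrite vwedgeC K_genNr K_genNl.
Qed.

End Map.

Lemma K_map_one n m (alpha : 'I_n.+1 -> 'I_m.+1) :
  K_map (@om_d R S f) alpha (K1 n) = K1 m.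
Proof.
rewrite K_map_gen.
have -> : d (om_one f) = 0.
  have -> : om_one f = form f (word 1 (fun=> 1)) by [].
  rewrite om_d_word; apply: (@form_word_vanish _ _ _ _ _ 1%N 1) => //.
  by rewrite rmorph1.
rewrite K_gen0l addr0; congr K_gen; exact: ext_map0.
Qed.

(** A generator s_0 ds_1 ... ds_i (x) x_1 /\ ... /\ x_i is obtained from 1 by the operators ds_k (x)
    x_k, followed by s_0; expanding each x_k in the basis leaves only differences E_k - E_0. *)
Lemma K_op_ind n (Q : KO n -> Prop) :
  Q 0 -> (forall u v, Q u -> Q v -> Q (u - v)) -> Q (K1 n) ->
  (forall x k u, Q u -> Q (K_op x (vbasis k) u)) -> forall u, Q u.
Proof.
move=> Q0 QB Q1 Qop; apply: K_ind => // i a x.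
have Ql y u : Q u -> Q (K_l y u) by rewrite K_l_op; exact: Qop.
have Qdl y v u : Q u -> Q (K_dl y v u).
  move=> Qu; elim/ker_sum_ind: v => [|v w Qv Qw|k].
  - by rewrite -(subrr 0) K_dl_vB subrr.
  - by rewrite K_dl_vB; exact: QB.
  by rewrite K_dl_op; apply: (QB); exact: Qop.
elim/form_ind: a => [|a b Qa Qb|s]; first by rewrite K_gen0l.
  by rewrite K_genBl; exact: QB.
elim/ext_ind: x => [|y z Qy Qz|x]; first by rewrite K_gen0r.
  by rewrite K_genBr; exact: QB.
elim: i s x => [|i IH] s x.
  have -> : form f (word 1 s) = om_l (s 0%N) (om_one f).
    rewrite [om_one f](_ : _ = form f (word 1 (fun=> 1))) // om_l_word.
    by congr form; apply: eq_word => -[|//] _; rewrite /nlmul mulr1.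
  rewrite -K_lE; apply: Ql; move: Q1; congr (Q (K_gen _ (wedges _))).
  by apply: funext => -[].
by rewrite form_word_cons wedges_vwedge -K_lE -K_dlE; apply/Ql/Qdl/IH.
Qed.

End KOps.

Section KRing.
Variables (R S : pzRingType) (f : {rmorphism R -> S}).
Local Notation om := (omega f).
Local Notation KO := (K om).
Local Notation KB := (K_bimodule om).
Local Notation Kmap := (K_map (@om_d R S f)).
Local Notation Kmul := (K_mul (@om_mul R S f)).
Local Notation K1 := (@K_one R om (om_one f)).

Lemma K_mulA n (u v w : KO n) : Kmul u (Kmul v w) = Kmul (Kmul u v) w.
Proof.
elim/K_op_ind: u => [|u u' hu hu'||x k u hu].
- by rewrite !K_mul0l.
- by rewrite !K_mulBl hu hu'.
- by rewrite !K_mul1l.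
- by rewrite !K_mul_op hu.
Qed.

Lemma K_mul1r n (u : KO n) : Kmul u (K1 n) = u.
Proof.
elim/K_op_ind: u => [|u u' hu hu'||x k u hu].
- by rewrite K_mul0l.
- by rewrite K_mulBl hu hu'.
- by rewrite K_mul1l.
- by rewrite K_mul_op hu.
Qed.

(** Both sides intertwine E_k with E_(gamma k) and preserve 1. As [gamma] is compared pointwise, the
    cosimplicial identities come down to identities between maps of ordinals. *)
Lemma K_map_comp n m p (alpha : 'I_m.+1 -> 'I_p.+1) (beta : 'I_n.+1 -> 'I_m.+1) gamma
    (u : KO n) : (forall k, alpha (beta k) = gamma k) ->
  Kmap alpha (Kmap beta u) = Kmap gamma u.
Proof.
move=> abg; elim/K_op_ind: u => [|u u' hu hu'||x k u hu].
- by rewrite !K_map0.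
- by rewrite !K_mapB hu hu'.
- by rewrite !K_map_one.
- by rewrite !K_map_op hu abg.
Qed.

Lemma K_map_square n m m' p (alpha : 'I_m.+1 -> 'I_p.+1) (beta : 'I_n.+1 -> 'I_m.+1)
    (gamma : 'I_m'.+1 -> 'I_p.+1) (delta : 'I_n.+1 -> 'I_m'.+1) (u : KO n) :
  (forall k, alpha (beta k) = gamma (delta k)) ->
  Kmap alpha (Kmap beta u) = Kmap gamma (Kmap delta u).
Proof.
move=> E; transitivity (Kmap (gamma \o delta) u); first exact: K_map_comp.
by symmetry; apply: K_map_comp.
Qed.

Lemma K_map_id n (alpha : 'I_n.+1 -> 'I_n.+1) (u : KO n) :
  (forall k, alpha k = k) -> Kmap alpha u = u.
Proof.
move=> aid; elim/K_op_ind: u => [|u u' hu hu'||x k u hu].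
- by rewrite !K_map0.
- by rewrite !K_mapB hu hu'.
- by rewrite !K_map_one.
- by rewrite !K_map_op hu aid.
Qed.

Lemma K_map_mul n m (alpha : 'I_n.+1 -> 'I_m.+1) (u v : KO n) :
  Kmap alpha (Kmul u v) = Kmul (Kmap alpha u) (Kmap alpha v).
Proof.
elim/K_op_ind: u => [|u u' hu hu'||x k u hu].
- by rewrite K_mul0l !K_map0 K_mul0l.
- by rewrite K_mulBl !K_mapB hu hu' K_mulBl.
- by rewrite K_map_one !K_mul1l.
- by rewrite K_mul_op !K_map_op K_mul_op hu.
Qed.

(** The right action of R is not among the E_i(s), but it commutes with them and agrees with the
    left action on 1, which is enough for inductions from 1. *)
Lemma K_one_ract n r : @ract R (KB n) (K1 n) r = lact r (K1 n : KB n).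
Proof.
rewrite [LHS]K_ractE [RHS]K_lactE; congr K_gen; rewrite ract_form lact_form.
congr form; apply: funext => k; rewrite updE /lmul (ord1 k) /= mul1r.
by rewrite mulr1.
Qed.

Lemma K_map_hom n m (alpha : 'I_n.+1 -> 'I_m.+1) :
  bimodule_hom (Kmap alpha : KB n -> KB m).
Proof.
split=> [u v|r u|u r]; first exact: K_mapD.
  by rewrite -(K_op_base r (vbasis ord0)) K_map_op K_op_base.
elim/K_op_ind: u => [|u u' hu hu'||x k u hu].
- by rewrite !(ract0, K_map0).
- by rewrite ractB !K_mapB hu hu' ractB.
- rewrite K_map_one !K_one_ract -(K_op_base r (vbasis ord0)) K_map_op.
  by rewrite K_op_base K_map_one.
- by rewrite -K_op_ract !K_map_op hu -K_op_ract.
Qed.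

Lemma ord_face_face n i j (k : 'I_n.+1) : (i < j <= n.+2)%N ->
  ord_face j (ord_face i k) = ord_face i (ord_face j.-1 k).
Proof.
move=> ij; have := ltn_ord k => kn; apply: val_inj.
by rewrite /ord_face /= !inordK /bump; lia.
Qed.

Lemma ord_degen_degen n i j (k : 'I_n.+3) : (i <= j <= n)%N ->
  ord_degen j (ord_degen i k) = ord_degen i (ord_degen j.+1 k).
Proof.
move=> ij; have := ltn_ord k => kn; apply: val_inj.
by rewrite /ord_degen /= !inordK /unbump; lia.
Qed.

Lemma ord_degen_face_lt n i j (k : 'I_n.+2) : (i < j <= n.+1)%N ->
  ord_degen j (ord_face i k) = ord_face i (ord_degen j.-1 k).
Proof.
move=> ij; have := ltn_ord k => kn; apply: val_inj.
by rewrite /ord_face /ord_degen /= !inordK /bump /unbump; lia.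
Qed.

Lemma ord_degen_face_eq n i j (k : 'I_n.+1) : (j <= n)%N -> (i == j) || (i == j.+1) ->
  ord_degen j (ord_face i k) = k.
Proof.
move=> jn ij; have := ltn_ord k => kn; apply: val_inj.
by rewrite /ord_face /ord_degen /= !inordK /bump /unbump; lia.
Qed.

Lemma ord_degen_face_gt n i j (k : 'I_n.+2) : (j.+1 < i <= n.+2)%N ->
  ord_degen j (ord_face i k) = ord_face i.-1 (ord_degen j k).
Proof.
move=> ij; have := ltn_ord k => kn; apply: val_inj.
by rewrite /ord_face /ord_degen /= !inordK /bump /unbump; lia.
Qed.

Lemma KOmega_cosimplicial : is_cosimplicial_bimodule (KOmega f).
Proof.
split=> [n i _|n j _|n i j x ij|n i j x ij|n i j x ij|n i j x jn ij|n i j x ij] /=.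
- exact: K_map_hom.
- exact: K_map_hom.
- by apply: K_map_square => k; exact: ord_face_face.
- by apply: K_map_square => k; exact: ord_degen_degen.
- by apply: K_map_square => k; exact: ord_degen_face_lt.
- by rewrite (@K_map_comp _ _ _ _ _ id) ?K_map_id // => k; exact: ord_degen_face_eq.
- by apply: K_map_square => k; exact: ord_degen_face_gt.
Qed.

Lemma KOmega_is_cosimplicial_ring : is_cosimplicial_ring (KOmega_ring f).
Proof.
split=> [|n u v w|n u|n u|n u v w|n u v w|n i _|n j _].
- exact: KOmega_cosimplicial.
- exact: K_mulA.
- exact: K_mul1l.
- exact: K_mul1r.
- exact: K_mulDl.
- exact: K_mulDr.
- by split; [exact: K_mapD|exact: K_map_mul|exact: K_map_one].
- by split; [exact: K_mapD|exact: K_map_mul|exact: K_map_one].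
Qed.

End KRing.

(** * The Amitsur object *)

Section AmitsurWords.
Variables (R S : pzRingType) (f : {rmorphism R -> S}).
Local Notation Am := (amitsur f).

Lemma am_ind n (Q : Am n -> Prop) :
  Q 0 -> (forall u v, Q u -> Q v -> Q (u - v)) ->
  (forall s : nat -> S, Q (am f (word n.+1 s))) -> forall u, Q u.
Proof.
by move=> Q0 QB Qs; apply: pres_ind => // x; rewrite (wordE (x : 'I_n.+1 -> S)); exact: Qs.
Qed.

Lemma am_coface0 n i : am_coface i (0 : Am n) = 0. Proof. exact: raddf0. Qed.
Lemma am_cofaceB n i (u v : Am n) : am_coface i (u - v) = am_coface i u - am_coface i v.
Proof. exact: raddfB. Qed.
Lemma am_codeg0 n i : am_codeg i (0 : Am n.+1) = 0. Proof. exact: raddf0. Qed.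
Lemma am_codegB n i (u v : Am n.+1) : am_codeg i (u - v) = am_codeg i u - am_codeg i v.
Proof. exact: raddfB. Qed.

Lemma am_coface_word n i s : (i <= n.+1)%N ->
  am_coface i (am f (word n.+1 s)) = am f (word n.+2 (ninsert1 i s)).
Proof. by move=> i_n; rewrite am_cofaceE // insert1_word. Qed.

Lemma am_codeg_word n j s : (j <= n)%N ->
  am_codeg j (am f (word n.+2 s)) = am f (word n.+1 (nmerge j s)).
Proof. by move=> jn; rewrite am_codegE // merge_word. Qed.

Definition nupd (k : nat) (x : S) (s : nat -> S) (l : nat) : S := if l == k then x else s l.

Lemma am_lact_word n a s :
  lact a (am f (word n.+1 s)) = am f (word n.+1 (nupd 0 (f a * s 0%N) s)).
Proof.
rewrite [LHS]tensor_lactE; congr tens; apply: functional_extensionality_dep => k.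
rewrite /nupd /word; have [->|k0] := eqVneq k ord0; first by rewrite dfwith_in.
by rewrite dfwith_out 1?eq_sym //; case: eqP => // k0'; case/eqP: k0; apply: val_inj.
Qed.

Lemma am_ract_word n a s :
  ract (am f (word n.+1 s)) a = am f (word n.+1 (nupd n (s n * f a) s)).
Proof.
rewrite [LHS]tensor_ractE; congr tens; apply: functional_extensionality_dep => k.
rewrite /nupd /word; have [->|k0] := eqVneq k ord_max; first by rewrite dfwith_in eqxx.
by rewrite dfwith_out 1?eq_sym //; case: eqP => // k0'; case/eqP: k0; apply: val_inj.
Qed.

Lemma bal_word (H : zmodType) n (g : ('I_n.+1 -> S) -> H) k a s : bal f g -> (k < n)%N ->
  g (word n.+1 (nupd k (s k * f a) s)) = g (word n.+1 (nupd k.+1 (f a * s k.+1) s)).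
Proof.
move=> gb kn; have [k1 k2] : (inord k : 'I_n.+1) = k :> nat /\ (inord k.+1 : 'I_n.+1) = k.+1 :> nat.
  by rewrite !inordK //; lia.
have := @gb (word n.+1 s) (inord k) (inord k.+1) a.
rewrite k1 k2 /word => /(_ erefl); rewrite k1 k2 => E.
transitivity (g (upd (word n.+1 s) (inord k) (s k * f a))).
  by congr g; apply: funext => l; rewrite updE /nupd /word k1 eq_sym.
by rewrite E; congr g; apply: funext => l; rewrite updE /nupd /word k2 eq_sym.
Qed.

Ltac am_cases := congr am; apply: eq_word => k kn; rewrite /nupd; word_cases.

Lemma am_coface_hom n i : (i <= n.+1)%N -> bimodule_hom (@am_coface R S f n i).
Proof.
move=> i_n; split=> [u v|a u|u a]; first exact: raddfD.
  elim/am_ind: u => [|u v hu hv|s].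
  - by rewrite lact0 am_coface0 lact0.
  - by rewrite lactB !am_cofaceB hu hv lactB.
  rewrite am_lact_word !am_coface_word // am_lact_word.
  (* For i = 0 the left action falls on the inserted 1, and balancedness carries f a to the next
     entry. *)
  case: i i_n => [|i] i_n; last by am_cases.
  transitivity (am f (word n.+2 (nupd 1 (f a * ninsert1 0 s 1%N) (ninsert1 0 s)))); first by am_cases.
  by rewrite -(bal_word _ _ (@am_bal R S f n.+1)) //; am_cases.
elim/am_ind: u => [|u v hu hv|s].
- by rewrite ract0 am_coface0 ract0.
- by rewrite ractB !am_cofaceB hu hv ractB.
rewrite am_ract_word !am_coface_word // am_ract_word.
(* For i = n + 1 the inserted 1 is the last entry, and f a has to cross the last tensor sign. *)
have [i_n1|i_n1] := eqVneq i n.+1; last by am_cases.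
transitivity (am f (word n.+2 (nupd n (ninsert1 i s n * f a) (ninsert1 i s)))); first by am_cases.
by rewrite (bal_word _ _ (@am_bal R S f n.+1)) //; am_cases.
Qed.

Lemma am_codeg_hom n j : (j <= n)%N -> bimodule_hom (@am_codeg R S f n j).
Proof.
move=> jn; split=> [u v|a u|u a]; first exact: raddfD.
  elim/am_ind: u => [|u v hu hv|s].
  - by rewrite lact0 am_codeg0 lact0.
  - by rewrite lactB !am_codegB hu hv lactB.
  by rewrite am_lact_word !am_codeg_word // am_lact_word; am_cases.
elim/am_ind: u => [|u v hu hv|s].
- by rewrite ract0 am_codeg0 ract0.
- by rewrite ractB !am_codegB hu hv ractB.
by rewrite am_ract_word !am_codeg_word // am_ract_word; am_cases.
Qed.

Lemma Amitsur_cosimplicial : is_cosimplicial_bimodule (Amitsur f).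
Proof.
split=> [n i|n j|n i j x ij|n i j x ij|n i j x ij|n i j x jn ij|n i j x ij] /=.
- exact: am_coface_hom.
- exact: am_codeg_hom.
- elim/am_ind: x => [|u v hu hv|s]; first by rewrite !am_coface0.
    by rewrite !am_cofaceB hu hv.
  by rewrite !am_coface_word; try lia; am_cases.
- elim/am_ind: x => [|u v hu hv|s]; first by rewrite !am_codeg0.
    by rewrite !am_codegB hu hv.
  by rewrite !am_codeg_word; try lia; am_cases.
- elim/am_ind: x => [|u v hu hv|s]; first by rewrite !(am_coface0, am_codeg0).
    by rewrite !(am_codegB, am_cofaceB) hu hv.
  rewrite am_coface_word ?am_codeg_word ?am_coface_word; try lia.
  by am_cases.
- elim/am_ind: x => [|u v hu hv|s]; first by rewrite !(am_coface0, am_codeg0).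
    by rewrite !(am_codegB, am_cofaceB) hu hv.
  rewrite am_coface_word ?am_codeg_word; try lia.
  by am_cases.
elim/am_ind: x => [|u v hu hv|s]; first by rewrite !(am_coface0, am_codeg0).
  by rewrite !(am_codegB, am_cofaceB) hu hv.
rewrite am_coface_word ?am_codeg_word ?am_coface_word; try lia.
by am_cases.
Qed.

End AmitsurWords.

(** * The Dold-Kan map *)

Lemma subrACA (G : zmodType) (a b c e : G) : a - b - (c - e) = a - c - (b - e).
Proof. by rewrite !opprD !opprK addrACA. Qed.

Section Phi.
Variables (R S : pzRingType) (f : {rmorphism R -> S}).
Local Notation om := (omega f).
Local Notation KO := (K om).
Local Notation KB := (K_bimodule om).
Local Notation Kmap := (K_map (@om_d R S f)).
Local Notation Kmul := (K_mul (@om_mul R S f)).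
Local Notation K1 := (@K_one R om (om_one f)).
Local Notation Am := (amitsur f).

(** The vectors [p] are independent of the positions in the word, so that tau can be expressed as a
    change of [p] alone. *)
Definition K_ops n (p : nat -> ker_sum n) (s : nat -> S) (r : seq nat) (u : KO n) : KO n :=
  foldr (fun k w => K_op (s k) (p k) w) u r.

Section Ops.
Variable n : nat.
Implicit Types (p q : nat -> ker_sum n) (s t : nat -> S) (r : seq nat) (u v : KO n).

Lemma eq_K_ops p q s t r u :
  (forall k, k \in r -> p k = q k /\ s k = t k) -> K_ops p s r u = K_ops q t r u.
Proof.
elim: r => [//|k r IH] H; have [pk sk] := H k (mem_head _ _).
have {}IH : K_ops p s r u = K_ops q t r u by apply: IH => l lr; apply: H; rewrite inE lr orbT.
by move: IH; rewrite /K_ops /= pk sk => ->.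
Qed.

Lemma K_ops_cons p s k r u : K_ops p s (k :: r) u = K_op (s k) (p k) (K_ops p s r u).
Proof. by []. Qed.

Lemma K_ops_nil p s u : K_ops p s [::] u = u.
Proof. by []. Qed.

Lemma K_ops_cat p s r r' u : K_ops p s (r ++ r') u = K_ops p s r (K_ops p s r' u).
Proof. exact: foldr_cat. Qed.

Lemma K_ops_shift p s a m u c :
  K_ops p s (iota (c + a) m) u = K_ops (fun k => p (c + k)%N) (fun k => s (c + k)%N) (iota a m) u.
Proof. by rewrite iotaDl /K_ops foldr_map. Qed.

Lemma K_opsD p s r u v : K_ops p s r (u + v) = K_ops p s r u + K_ops p s r v.
Proof. by elim: r => //= k r ->; rewrite K_opD. Qed.

Lemma K_opsB p s r u v : K_ops p s r (u - v) = K_ops p s r u - K_ops p s r v.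
Proof. by elim: r => //= k r ->; rewrite K_opB. Qed.

Lemma K_ops_mul p s r u v : Kmul (K_ops p s r u) v = K_ops p s r (Kmul u v).
Proof. by elim: r => //= k r IH; rewrite K_mul_op IH. Qed.

Lemma K_ops_split p s N i u : (i < N)%N ->
  K_ops p s (iota 0 N) u =
  K_ops p s (iota 0 i) (K_op (s i) (p i) (K_ops p s (iota i.+1 (N - i.+1)) u)).
Proof.
move=> iN; have -> : N = (i + (N - i.+1).+1)%N by lia.
rewrite iotaD K_ops_cat /= add0n; congr (K_ops _ _ _ (K_op _ _ (K_ops _ _ (iota _ _) _))).
by lia.
Qed.

Lemma K_ops_split2 p s N i u : (i.+1 < N)%N ->
  K_ops p s (iota 0 N) u =
  K_ops p s (iota 0 i) (K_op (s i) (p i) (K_op (s i.+1) (p i.+1)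
    (K_ops p s (iota i.+2 (N - i.+2)) u))).
Proof.
move=> iN; have -> : N = (i + (N - i.+2).+2)%N by lia.
rewrite iotaD K_ops_cat /= add0n.
by congr (K_ops _ _ _ (K_op _ _ (K_op _ _ (K_ops _ _ (iota _ _) _)))); lia.
Qed.

End Ops.

Lemma K_map_ops n m (alpha : 'I_n.+1 -> 'I_m.+1) (q : nat -> 'I_n.+1) s r u :
  Kmap alpha (K_ops (fun k => vbasis (q k)) s r u) =
  K_ops (fun k => vbasis (alpha (q k))) s r (Kmap alpha u).
Proof. by elim: r => //= k r <-; rewrite K_map_op. Qed.

Section Word.
Variables (n N : nat).
Implicit Types (p q : nat -> ker_sum n).

(** The word length N + 1 is separate from the degree n, because Nuss' product passes through words
    of length 2n + 2. *)
Definition am_ops p : Am N -> KO n :=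
  am_lift (fun s => K_ops p (fun k => s (inord k)) (iota 0 N.+1) (K1 n)).

Lemma am_ops0 p : am_ops p 0 = 0. Proof. exact: raddf0. Qed.
Lemma am_opsB p u v : am_ops p (u - v) = am_ops p u - am_ops p v.
Proof. exact: raddfB. Qed.
Lemma am_opsD p u v : am_ops p (u + v) = am_ops p u + am_ops p v.
Proof. exact: raddfD. Qed.

Lemma am_ops_word p s : am_ops p (am f (word N.+1 s)) = K_ops p s (iota 0 N.+1) (K1 n).
Proof.
rewrite /am_ops am_liftE.
- by apply: eq_K_ops => k; rewrite mem_iota /word => kN; rewrite inordK.
- move=> t i x y; have iN := ltn_ord i.
  rewrite !(K_ops_split _ _ _ iN) !updE inord_val eqxx.
  have E z : forall l : nat, l != i -> (l < N.+1)%N -> upd t i z (inord l) = t (inord l).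
    by move=> l li lN; rewrite updE inordK // eq_sym (negPf li).
  have El z w : K_ops p (fun k => upd t i z (inord k)) (iota 0 i) w =
      K_ops p (fun k => t (inord k)) (iota 0 i) w.
    by apply: eq_K_ops => k; rewrite mem_iota => ki; rewrite E //; lia.
  have Er z w : K_ops p (fun k => upd t i z (inord k)) (iota i.+1 (N.+1 - i.+1)) w =
      K_ops p (fun k => t (inord k)) (iota i.+1 (N.+1 - i.+1)) w.
    by apply: eq_K_ops => k; rewrite mem_iota => ki; rewrite E //; lia.
  by rewrite !El !Er K_op_lD K_opsD.
move=> t i j a ij; have jN := ltn_ord j; have iN : (i.+1 < N.+1)%N by rewrite -ij.
rewrite !(K_ops_split2 _ _ _ iN) !updE !inordK ?eqxx ?ij ?eqxx; try lia.
have -> : (i == i.+1 :> nat) = false by lia.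
have -> : (i.+1 == i :> nat) = false by lia.
rewrite inord_val (inord_at t (i := j)); last by rewrite ij.
have E z w (l : nat) : (l < N.+1)%N -> l != i -> l != i.+1 -> upd t i z (inord l) = upd t j w (inord l).
  by move=> lN li lj; rewrite !updE inordK // ij eq_sym (negPf li) eq_sym (negPf lj).
(* On the right of t_i, f a becomes the left action of a, which the next operator absorbs whatever
   its vector. *)
rewrite -K_opM -K_op_lact K_op_base.
have El w z1 z2 : K_ops p (fun k => upd t i z1 (inord k)) (iota 0 i) w =
      K_ops p (fun k => upd t j z2 (inord k)) (iota 0 i) w.
  by apply: eq_K_ops => k; rewrite mem_iota => ki; rewrite (E _ z2) //; lia.
have Er w z1 z2 : K_ops p (fun k => upd t i z1 (inord k)) (iota i.+2 (N.+1 - i.+2)) w =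
      K_ops p (fun k => upd t j z2 (inord k)) (iota i.+2 (N.+1 - i.+2)) w.
  by apply: eq_K_ops => k; rewrite mem_iota => ki; rewrite (E _ z2) //; lia.
by rewrite (El _ _ (f a * t j)) (Er _ _ (f a * t j)).
Qed.

Lemma eq_am_ops p q u : (forall k, (k <= N)%N -> p k = q k) -> am_ops p u = am_ops q u.
Proof.
move=> pq; elim/am_ind: u => [|u v hu hv|s]; first by rewrite !am_ops0.
  by rewrite !am_opsB hu hv.
by rewrite !am_ops_word; apply: eq_K_ops => k; rewrite mem_iota => kN; rewrite pq.
Qed.

End Word.

Definition nswap T (j : nat) (p : nat -> T) k : T :=
  if k == j then p j.+1 else if k == j.+1 then p j else p k.

Lemma am_ops_tau n N (p : nat -> ker_sum n) j (u : Am N.+1) : (j <= N)%N ->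
  am_ops p (nuss_tau j u) = am_ops (nswap j p) u.
Proof.
move=> jN; rewrite /nuss_tau; elim/am_ind: u => [|u v hu hv|s].
- by rewrite am_codeg0 !am_coface0 addr0 subr0 !am_ops0.
- rewrite am_codegB !am_cofaceB [am_ops (nswap _ _) _]am_opsB -hu -hv -am_opsB; congr am_ops.
  by rewrite [X in X - _ = _]addrACA -opprD subrACA.
rewrite am_codeg_word // !am_coface_word; try lia.
have jN2 : (j.+1 < N.+2)%N by lia.
rewrite am_opsB am_opsD !am_ops_word !(K_ops_split2 _ _ _ jN2).
set m := (N.+2 - j.+2)%N.
have E (q : nat -> ker_sum n) t t' (r : seq nat) (w : KO n) : (forall k, k \in r -> t k = t' k) -> K_ops q t r w = K_ops q t' r w.
  by move=> tt'; apply: eq_K_ops => k /tt'.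
rewrite !(E _ (ninsert1 _ _) s (iota 0 j)); try by move=> k; rewrite mem_iota => ?; word_cases.
rewrite !(E _ (ninsert1 _ _) s (iota j.+2 m)); try by move=> k; rewrite mem_iota => ?; word_cases.
rewrite -!K_opsD -K_opsB.
have El w : K_ops (nswap j p) s (iota 0 j) w = K_ops p s (iota 0 j) w.
  by apply: eq_K_ops => k; rewrite mem_iota /nswap => ?; split=> //; repeat case: ifP => ?; (lia || done).
have Er w : K_ops (nswap j p) s (iota j.+2 m) w = K_ops p s (iota j.+2 m) w.
  by apply: eq_K_ops => k; rewrite mem_iota /nswap => ?; split=> //; repeat case: ifP => ?; (lia || done).
rewrite El Er; congr (K_ops p s (iota 0 j)).
have -> : nswap j p j = p j.+1 by rewrite /nswap eqxx.
have -> : nswap j p j.+1 = p j by rewrite /nswap eqxx; case: ifP => ?; (lia || done).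
have i1 : ninsert1 j.+1 (nmerge j s) j = s j * s j.+1 by word_cases.
have i2 : ninsert1 j.+1 (nmerge j s) j.+1 = 1 by word_cases.
have i3 : ninsert1 j (nmerge j s) j = 1 by word_cases.
have i4 : ninsert1 j (nmerge j s) j.+1 = s j * s j.+1 by word_cases.
(* What remains is E(st) at [p j] plus E(st) at [p j.+1] minus E(s) E(t), which the exchange
   relation turns into the product with exchanged vectors. *)
rewrite i1 i2 i3 i4 !K_op1.
by rewrite -K_op_exchange [X in X - _]addrC addrK.
Qed.

(** The last tau applied to the tensor is the first to act on [p], hence [foldl] against [foldr]. *)
Lemma am_ops_taus n N (p : nat -> ker_sum n) l (u : Am N.+1) :
  all (fun j => j <= N)%N l ->
  am_ops p (foldl (fun v j => nuss_tau j v) u l) = am_ops (foldr (@nswap _) p l) u.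
Proof.
elim: l u => [//|j l IH] u /= /andP[jN lN].
by rewrite IH // am_ops_tau.
Qed.

(** A block of the shuffle is a cycle: it moves the factor in position a + m to position a. *)
Lemma nswap_block T (p : nat -> T) a m k :
  foldr (@nswap T) p (rev (iota a m)) k =
  if (a <= k < a + m)%N then p k.+1 else if k == (a + m)%N then p a else p k.
Proof.
elim: m k => [|m IH] k.
  by rewrite addn0 /=; case: ifP => [?|_]; [lia|case: eqP => [->|]].
rewrite -addn1 iotaD rev_cat /= /nswap !IH.
by repeat case: ifP => ?; try lia; congr p; lia.
Qed.

(* The position of the factor which sits in position i once the blocks
   k, ..., n of adjacent transpositions remain to be undone. *)
Lemma nswap_shuffle T (p : nat -> T) n k m i : (k + m = n.+1)%N -> (i < n.+1.*2)%N ->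
  foldr (@nswap T) (fun i => p i./2)
    (flatten [seq rev (iota k.*2.+1 (n - k)) | k <- iota k m]) i =
  p (if i < k.*2 then i./2 else if i <= n + k then i - k else i - n.+1)%N.
Proof.
elim: m k i => [|m IH] k i km i_n.
  by rewrite /=; case: ifP => // ?; lia.
rewrite /= foldr_cat nswap_block.
by repeat case: ifP => ?; rewrite IH; try lia; congr p; repeat case: ifP => ?; lia.
Qed.

Lemma shuffle_bound n : all (fun j => j <= n + n)%N (shuffle n).
Proof.
apply/allP => j /flattenP[s /mapP[k]]; rewrite mem_iota => kn ->.
by rewrite mem_rev mem_iota; lia.
Qed.

Definition am_phi n : Am n -> KO n := am_ops (fun k => vbasis (inord k)).

Lemma am_juxt_word n m s (v : Am m) :
  am_juxt (am f (word n.+1 s)) v = am_lift (fun t => am f (juxt (word n.+1 s) t)) v.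
Proof.
have E s' (t : 'I_m.+1 -> S) :
    am_lift (fun t' => am f (@juxt S n m s' t')) (am f t) = am f (juxt s' t).
  by apply: am_liftE; [exact/madd_juxtr/am_madd|exact/bal_juxtr/am_bal].
have LB s' (u u' : Am m) : am_lift (fun t => am f (@juxt S n m s' t)) (u - u') =
    am_lift (fun t => am f (juxt s' t)) u - am_lift (fun t => am f (juxt s' t)) u'.
  exact: raddfB.
rewrite /am_juxt; apply: (am_liftE (g := fun s' => am_lift _ v)) => [t i x y|t i j a ij].
  elim/am_ind: v => [|u v hu hv|t']; first by rewrite !raddf0 addr0.
    by rewrite !LB hu hv opprD addrACA.
  by rewrite !E; exact: (madd_juxtl _ (@am_madd _ _ _ _)).
elim/am_ind: v => [|u v hu hv|t']; first by rewrite !raddf0.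
  by rewrite !LB hu hv.
by rewrite !E; exact: (bal_juxtl _ (@am_bal _ _ _ _)).
Qed.

(** The operators of u applied to phi(v) give phi(u) phi(v), since they commute with right
    multiplication by phi(v) and phi(u) is their value at 1. *)
Lemma am_ops_juxt n (u v : Am n) :
  am_ops (fun k => vbasis (inord (if k <= n then k else k - n.+1)%N)) (am_juxt u v) =
  Kmul (am_phi u) (am_phi v).
Proof.
elim/am_ind: u => [|u u' hu hu'|s].
- by rewrite [am_juxt _ _]raddf0 /am_phi !am_ops0 K_mul0l.
- by rewrite [am_juxt _ _]raddfB [am_phi _]am_opsB K_mulBl -hu -hu' -am_opsB.
elim/am_ind: v => [|v v' hv hv'|t].
- by rewrite am_juxt_word raddf0 /am_phi !am_ops0 K_mul0r.
- rewrite [am_phi (_ - _)]am_opsB K_mulBr -hv -hv' -am_opsB !am_juxt_word.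
  by congr am_ops; exact: raddfB.
rewrite am_juxtE juxt_word /am_phi !am_ops_word.
have -> : (n + n).+2 = (n.+1 + n.+1)%N by lia.
rewrite iotaD K_ops_cat K_ops_mul K_mul1l -[(0 + n.+1)%N]addnC (K_ops_shift _ _ 0 _ _ n.+1).
rewrite [K_ops _ (fun k => njuxt n s t (n.+1 + k)%N) _ _](@eq_K_ops _ _ (fun k => vbasis (inord k)) _ t (iota 0 n.+1)); last first.
  move=> k; rewrite mem_iota => kn; split; last first.
    by rewrite /njuxt; case: ifP => ?; [lia|congr t; lia].
  by congr (vbasis (inord _)); case: ifP; lia.
apply: eq_K_ops => k; rewrite mem_iota => kn; split; last first.
  by rewrite /njuxt; case: ifP => ?; [|lia].
by congr (vbasis (inord _)); case: ifP; lia.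
Qed.

(** Positions 2k and 2k + 1 carry the same vector, so [K_opM] merges their operators. *)
Lemma am_ops_mulpairs n (p : nat -> ker_sum n) (u : Am (n + n).+1) :
  am_ops p (am_mulpairs u) = am_ops (fun k => p k./2) u.
Proof.
have mB (v w : Am (n + n).+1) : am_mulpairs (v - w) = am_mulpairs v - am_mulpairs w.
  exact: raddfB.
elim/am_ind: u => [|u v hu hv|s]; first by rewrite am_ops0 /am_mulpairs raddf0 am_ops0.
  by rewrite mB !am_opsB hu hv.
rewrite am_mulpairsE mulpairs_word !am_ops_word.
have -> : (n + n).+2 = n.+1.*2 by lia.
suff H m a : K_ops p (fun k => s k.*2 * s k.*2.+1) (iota a m) (K1 n) =
    K_ops (fun k => p k./2) s (iota a.*2 m.*2) (K1 n) by exact: H.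
elim: m a => [//|m IH] a; rewrite doubleS /= IH -K_opM.
have -> : a.*2./2 = a by lia.
by have -> : uphalf a.*2 = a by lia.
Qed.

Lemma am_phi_mul n (u v : Am n) : am_phi (nuss_mul u v) = Kmul (am_phi u) (am_phi v).
Proof.
rewrite /nuss_mul /nuss_shuffle /am_phi am_ops_mulpairs am_ops_taus; last exact: shuffle_bound.
rewrite -am_ops_juxt; apply: eq_am_ops => i i_n.
rewrite (@nswap_shuffle _ (fun k => vbasis (inord k))); try lia.
by rewrite ltn0 addn0 subn0.
Qed.

End Phi.

(** * Linearity, naturality and surjectivity of phi *)

Section PhiMorphism.
Variables (R S : pzRingType) (f : {rmorphism R -> S}).
Local Notation om := (omega f).
Local Notation KO := (K om).
Local Notation KB := (K_bimodule om).
Local Notation Kmap := (K_map (@om_d R S f)).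
Local Notation Kmul := (K_mul (@om_mul R S f)).
Local Notation K1 := (@K_one R om (om_one f)).
Local Notation Am := (amitsur f).
Local Notation vb := (fun k => vbasis (inord k)).

Lemma K_ops_ract n (p : nat -> ker_sum n) s r (u : KB n) a :
  K_ops p s r (ract u a) = ract (K_ops p s r u : KB n) a.
Proof. by elim: r => //= k r ->; rewrite K_op_ract. Qed.

Lemma K_ops_1 n (p : nat -> ker_sum n) (s : nat -> S) r (u : KO n) :
  (forall k, k \in r -> s k = 1) -> K_ops p s r u = u.
Proof.
elim: r => //= k r IH H; rewrite H ?mem_head // K_op1 IH // => l lr.
by apply: H; rewrite inE lr orbT.
Qed.

Lemma am_phi0 n : am_phi (0 : Am n) = 0. Proof. exact: am_ops0. Qed.
Lemma am_phiB n (u v : Am n) : am_phi (u - v) = am_phi u - am_phi v.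
Proof. exact: am_opsB. Qed.

Lemma am_phiD n (u v : Am n) : am_phi (u + v) = am_phi u + am_phi v.
Proof. exact: am_opsD. Qed.

Lemma am_phi_word n s : am_phi (am f (word n.+1 s)) = K_ops vb s (iota 0 n.+1) (K1 n).
Proof. exact: am_ops_word. Qed.

Lemma am_phi_one n : am_phi (nuss_one f n) = K1 n.
Proof.
have -> : nuss_one f n = am f (word n.+1 (fun=> 1)) by [].
by rewrite am_phi_word; exact: K_ops_1.
Qed.

Lemma am_phi_hom n : bimodule_hom (@am_phi R S f n : Am n -> KB n).
Proof.
split=> [u v|a u|u a]; first exact: am_opsD.
  elim/am_ind: u => [|u v hu hv|s]; first by rewrite lact0 am_phi0 lact0.
    by rewrite lactB !am_phiB hu hv lactB.
  rewrite am_lact_word !am_phi_word -[iota 0 n.+1]/(0%N :: iota 1 n) !K_ops_cons K_op_lact.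
  have -> : nupd 0 (f a * s 0%N) s 0 = f a * s 0%N by [].
  rewrite [X in K_op _ _ X = _](_ : _ = K_ops vb s (iota 1 n) (K1 n)) //.
  apply: eq_K_ops => k; rewrite mem_iota => k1.
  by split=> //; rewrite /nupd; case: eqP => // k0; lia.
elim/am_ind: u => [|u v hu hv|s]; first by rewrite ract0 am_phi0 ract0.
  by rewrite ractB !am_phiB hu hv ractB.
rewrite am_ract_word !am_phi_word -addn1 iotaD !K_ops_cat -![iota _ 1]/[:: _] !K_ops_cons !K_ops_nil !add0n.
(* The last operator is next to 1, where the left action of a is also the right action, and the
   latter commutes with all operators. *)
rewrite {2}/nupd eqxx -K_opM K_op_base -K_one_ract K_op_ract -K_ops_ract.
apply: eq_K_ops => k; rewrite mem_iota => kn.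
by split=> //; rewrite /nupd; case: eqP => // k0; lia.
Qed.

(** The inserted factor acts as E_i(1) = id, and the face renumbers the other operators. *)
Lemma am_phi_coface n i (u : Am n) : (i <= n.+1)%N ->
  am_phi (am_coface i u) = Kmap (@ord_face n i) (am_phi u).
Proof.
move=> i_n; elim/am_ind: u => [|u v hu hv|s].
- by rewrite am_coface0 !am_phi0 K_map0.
- by rewrite am_cofaceB !am_phiB hu hv K_mapB.
rewrite am_coface_word // !am_phi_word K_map_ops K_map_one.
rewrite (@K_ops_split _ _ _ _ _ _ _ i) // {2}/ninsert1 ltnn eqxx K_op1.
have -> : iota 0 n.+1 = iota 0 i ++ iota i (n.+1 - i).
  by rewrite -iotaD; congr iota; lia.
rewrite K_ops_cat (K_ops_shift _ _ i _ _ 1) [(n.+2 - i.+1)%N]subSS.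
rewrite [K_ops _ (fun k => ninsert1 i s (1 + k)) _ _](@eq_K_ops _ _ _ _ _
  (fun k => vbasis (ord_face i (inord k : 'I_n.+1))) _ s); last first.
  move=> k; rewrite mem_iota => kn; split; last by word_cases.
  by congr vbasis; apply: val_inj; rewrite /ord_face /= !inordK /bump; lia.
apply: eq_K_ops => k; rewrite mem_iota => kn; split; last by word_cases.
by congr vbasis; apply: val_inj; rewrite /ord_face /= !inordK /bump; lia.
Qed.

(** The degeneracy gives the operators j and j + 1 the same index, and [K_opM] multiplies their
    entries. *)
Lemma am_phi_codeg n j (u : Am n.+1) : (j <= n)%N ->
  am_phi (am_codeg j u) = Kmap (@ord_degen n j) (am_phi u).
Proof.
move=> jn; elim/am_ind: u => [|u v hu hv|s].
- by rewrite am_codeg0 !am_phi0 K_map0.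
- by rewrite am_codegB !am_phiB hu hv K_mapB.
rewrite am_codeg_word // !am_phi_word K_map_ops K_map_one.
rewrite (@K_ops_split _ _ _ _ _ _ n.+1 j) // (@K_ops_split2 _ _ _ _ _ _ n.+2 j) //.
have -> : ord_degen j (inord j : 'I_n.+2) = inord j.
  by apply: val_inj; rewrite /ord_degen /= !inordK /unbump; lia.
have -> : ord_degen j (inord j.+1 : 'I_n.+2) = inord j.
  by apply: val_inj; rewrite /ord_degen /= !inordK /unbump; lia.
rewrite K_opM (K_ops_shift _ _ j.+1 _ _ 1) [(n.+2 - j.+2)%N]subSS.
have -> : nmerge j s j = s j * s j.+1 by word_cases.
rewrite [K_ops _ (fun k => s (1 + k)%N) _ _](@eq_K_ops _ _ _ _ _ vb _ (nmerge j s)); last first.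
  move=> k; rewrite mem_iota => kn; split; last by word_cases.
  by congr vbasis; apply: val_inj; rewrite /ord_degen /= !inordK /unbump; lia.
apply: eq_K_ops => k; rewrite mem_iota => kn; split; last by word_cases.
by congr vbasis; apply: val_inj; rewrite /ord_degen /= !inordK /unbump; lia.
Qed.

(** The image contains 1 and is stable under E_k(s): E_k(s) phi(x) is phi of the Nuss product of x,
    on the left, by the tensor with s in position k and 1 elsewhere. *)
Lemma am_phi_surj n (u : KO n) : exists x : Am n, am_phi x = u.
Proof.
elim/K_op_ind: u => [|_ _ [x <-] [y <-]||s k _ [x <-]].
- by exists 0; rewrite am_phi0.
- by exists (x - y); rewrite am_phiB.
- by exists (nuss_one f n); rewrite am_phi_one.
exists (nuss_mul (am f (word n.+1 (nupd k s (fun=> 1)))) x).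
rewrite am_phi_mul am_phi_word (@K_ops_split _ _ _ _ _ _ _ k) // /nupd eqxx inord_val.
rewrite !K_ops_1 ?K_mul_op ?K_mul1l // => l; rewrite mem_iota => lk.
  by case: eqP => // lk'; lia.
by case: eqP => // lk'; lia.
Qed.

End PhiMorphism.

(** * Phi on normalized complexes *)

Section Normalized.
Variables (R S : pzRingType) (f : {rmorphism R -> S}).
Local Notation om := (omega f).
Local Notation KO := (K om).
Local Notation Kmap := (K_map (@om_d R S f)).
Local Notation K1 := (@K_one R om (om_one f)).
Local Notation Am := (amitsur f).
Local Notation vb := (fun k => vbasis (inord k)).

Definition K_dls n (y : nat -> ker_sum n) (s : nat -> S) (r : seq nat) (u : KO n) : KO n :=
  foldr (fun k w => K_dl (s k) (y k) w) u r.

Lemma eq_K_dls n (y y' : nat -> ker_sum n) s s' r u :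
  (forall k, k \in r -> y k = y' k /\ s k = s' k) -> K_dls y s r u = K_dls y' s' r u.
Proof.
elim: r => [//|k r IH] H; have [yk sk] := H k (mem_head _ _).
by rewrite /= yk sk IH // => l lr; apply: H; rewrite inE lr orbT.
Qed.

Lemma K_dls_shift n (y : nat -> ker_sum n) s a m u c :
  K_dls y s (iota (c + a) m) u =
  K_dls (fun k => y (c + k)%N) (fun k => s (c + k)%N) (iota a m) u.
Proof. by rewrite iotaDl /K_dls foldr_map. Qed.

Lemma K_gen_form_word n m (s : nat -> S) (y : nat -> ker_sum m) :
  K_gen (form f (word n.+1 s)) (wedges (fun k : 'I_n => y k.+1)) =
  K_l (s 0%N) (K_dls y s (iota 1 n) (K1 m)).
Proof.
elim: n s y => [|n IH] s y.
  have -> : form f (word 1 s) = om_l (s 0%N) (om_one f).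
    rewrite [om_one f](_ : _ = form f (word 1 (fun=> 1))) // om_l_word.
    by congr form; apply: eq_word => -[|//] _; rewrite /nlmul mulr1.
  rewrite K_lE; congr (K_gen _ (wedges _)); by apply: funext => -[].
rewrite form_word_cons wedges_vwedge -K_lE -K_dlE.
have l1 (u : KO m) : K_l 1 u = u by rewrite K_l_op K_op1.
rewrite (IH _ (fun k => y k.+1)) l1.
rewrite /= (K_dls_shift _ _ 1 _ _ 1); congr (K_l _ (K_dl _ _ _)).
by apply: eq_K_dls => -[|k]; rewrite mem_iota.
Qed.

Section Face.
Variables (n i : nat).
Hypothesis i_n : (0 < i <= n.+1)%N.

Let img (u : KO n.+1) := exists w : KO n, u = Kmap (@ord_face n i) w.

Let imgB u v : img u -> img v -> img (u - v).
Proof. by move=> [w ->] [w' ->]; exists (w - w'); rewrite K_mapB. Qed.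

(** A vertex k other than i is hit by the i-th face, so E_k(s) lifts through the coface. *)
Let img_op s k u : k != i -> (k <= n.+1)%N -> img u -> img (K_op s (vbasis (inord k)) u).
Proof.
move=> ki kn [w ->]; exists (K_op s (vbasis (inord (unbump i k))) w).
rewrite K_map_op; congr (K_op _ (vbasis _) _); apply: val_inj.
by rewrite /ord_face /= !inordK /bump /unbump; lia.
Qed.

(** Left multiplication is E_0(s), and 0 differs from i because i > 0. *)
Let img_l s u : img u -> img (K_l s u).
Proof.
rewrite K_l_op -[ord0]inord_val; apply: img_op => //=.
by rewrite eq_sym; lia.
Qed.

Let img_dl s k u : k != i -> (k <= n.+1)%N -> img u -> img (K_dl s (vbasis (inord k)) u).
Proof.
move=> ki kn iu; rewrite K_dl_op; apply: imgB; first exact: img_op.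
by rewrite -K_l_op; exact: img_l.
Qed.

Let img_ops s r u : all (fun k => (k != i) && (k <= n.+1)%N) r -> img u ->
  img (K_ops vb s r u).
Proof.
by elim: r => //= k r IH /andP[/andP[ki kn] rn] iu; apply: img_op => //; exact: IH.
Qed.

Let img_dls s r u : all (fun k => (k != i) && (k <= n.+1)%N) r -> img u ->
  img (K_dls vb s r u).
Proof.
by elim: r => //= k r IH /andP[/andP[ki kn] rn] iu; apply: img_dl => //; exact: IH.
Qed.

(* Dropping the i-th of the factors s_0 + ds_0 v_0, ..., s_(n+1) + ds_(n+1) v_(n+1)
   leaves a product in the image of the i-th coface. *)
Lemma K_ops_dls_degenerate s x :
  span (@degenerate R (KOmega f) n.+1)
    (K_ops vb s (iota 0 i) (K_l x (K_dls vb s (iota i.+1 (n.+1 - i)) (K1 n.+1)))).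
Proof.
apply: span_mem; rewrite /degenerate.
have [w E] : img (K_ops vb s (iota 0 i)
    (K_l x (K_dls vb s (iota i.+1 (n.+1 - i)) (K1 n.+1)))).
  apply: img_ops.
    by apply/allP => k; rewrite mem_iota; lia.
  apply/img_l/img_dls; first by apply/allP => k; rewrite mem_iota; lia.
  by exists (K1 n); rewrite K_map_one.
by exists i, w.
Qed.

End Face.

(** Telescoping from the right: E_k(s_k) is replaced by ds_k (x) v_k for k = n, ..., 1, each time
    modulo a degenerate element, until only E_0(s_0) = s_0 is left. *)
Lemma am_phi_top n s : span (@degenerate R (KOmega f) n)
  (am_phi (am f (word n.+1 s)) -
   K_gen (form f (word n.+1 s)) (wedges (fun i : 'I_n => vbasis (fintype.lift ord0 i)))).
Proof.
have -> : (fun i : 'I_n => vbasis (fintype.lift ord0 i)) =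
    (fun k : 'I_n => (fun k => vbasis (inord k : 'I_n.+1)) k.+1).
  apply: funext => k; congr vbasis; apply: val_inj.
  by rewrite /= inordK // ltnS ltn_ord.
rewrite (K_gen_form_word n s (fun k => vbasis (inord k : 'I_n.+1))) am_phi_word.
suff H j : (j <= n)%N -> span (@degenerate R (KOmega f) n)
    (K_ops vb s (iota 0 n.+1) (K1 n) -
     K_ops vb s (iota 0 (n - j).+1) (K_dls vb s (iota (n - j).+1 j) (K1 n))).
  have := H n (leqnn n); rewrite subnn -[iota 0 1]/[:: 0%N] K_ops_cons K_ops_nil.
  have -> : inord 0 = ord0 :> 'I_n.+1 by apply: val_inj; rewrite /= inordK.
  by rewrite -K_l_op.
elim: j => [|j IH] jn; first by rewrite subn0 subrr; exact: span0.
move: (IH (ltnW jn)); set u := K_ops _ _ _ (K_dls _ _ _ _); set v := K_ops _ _ _ (K_dls _ _ _ _).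
move=> Hu; rewrite -(subrKA u); apply: spanD => //.
(* E_k - ds_k (x) v_k is left multiplication by s_k, so the difference no longer involves v_k for k
   = n - j. *)
have -> : u - v = K_ops vb s (iota 0 (n - j))
    (K_l (s (n - j)%N) (K_dls vb s (iota (n - j).+1 j) (K1 n))).
  rewrite /u /v; have -> : (n - j.+1).+1 = (n - j)%N by lia.
  rewrite -addn1 iotaD K_ops_cat add0n -[iota _ 1]/[:: _] K_ops_cons K_ops_nil.
  rewrite addn1 -K_opsB -[iota (n - j) j.+1]/((n - j)%N :: iota (n - j).+1 j) /=.
  by rewrite K_dl_op opprB addrC subrK -K_l_op.
clear IH u v Hu; case: n jn => [//|n] jn.
have i_n : (0 < n.+1 - j <= n.+1)%N by lia.
by have := K_ops_dls_degenerate i_n s (s (n.+1 - j)%N); rewrite subKn // ltnW.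
Qed.

(* For i = n, the coefficient of v_1 /\ ... /\ v_n. *)
Definition ext_det n i : ext (ker_sum n) i -> int :=
  ext_lift (fun x : 'I_i -> ker_sum n =>
    \det (\matrix_(r < i, c < i) (x r : {ffun _}) (inord c.+1))).

Lemma ext_detE n i (x : 'I_i -> ker_sum n) : ext_det (wedges x) =
  \det (\matrix_(r < i, c < i) (x r : {ffun _}) (inord c.+1)).
Proof.
apply: ext_liftE; split=> [y k u v|y k l kl ykl]; last first.
  apply: (determinant_alternate kl) => c; by rewrite !mxE ykl.
rewrite -[X in _ = X + _]mul1r -[X in _ = _ + X]mul1r.
have E w l : @dfwith _ (fun=> ker_sum n) y k w l = if k == l then w else y l.
  by case: (@dfwithP _ (fun=> ker_sum n) y k w l) => [|l' kl]; rewrite ?eqxx // (negPf kl).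
apply: (determinant_multilinear (i0 := k)).
- by apply/rowP => c; rewrite !mxE !E eqxx !mul1r !ffunE.
- by apply/matrixP => r c; rewrite !mxE !E (negPf (neq_lift _ _)).
- by apply/matrixP => r c; rewrite !mxE !E (negPf (neq_lift _ _)).
Qed.

Lemma ext_detD n i : {morph @ext_det n i : x y / x + y}.
Proof. exact: raddfD. Qed.

Lemma ecast_om (i n : nat) (e : i = n) (a b : om i) :
  ecast k (om k) e (a + b) = ecast k (om k) e a + ecast k (om k) e b.
Proof. by case: n / e. Qed.

(** A retraction of a -> a (x) v_1 /\ ... /\ v_n vanishing on the summands with i <> n; it shows
    that [norm_KOmega] is injective. *)
Definition K_top n : KO n -> om n := K_lift (fun i (a : om i) x =>
  match @eqP _ i n with
  | ReflectT e => ecast k (om k) e a *~ ext_det x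
  | ReflectF _ => 0
  end).

Lemma K_topB n (u v : KO n) : K_top (u - v) = K_top u - K_top v.
Proof. exact: raddfB. Qed.

Lemma K_topE n i (a : om i) (x : ext (ker_sum n) i) : K_top (K_gen a x) =
  match @eqP _ i n with
  | ReflectT e => ecast k (om k) e a *~ ext_det x
  | ReflectF _ => 0
  end.
Proof.
apply: K_liftE => j; split=> [y b c|b y z] /=; case: eqP => [e|_]; rewrite ?addr0 //.
  by rewrite ecast_om mulrzDl.
by rewrite ext_detD mulrzDr.
Qed.

Lemma K_top_gen n (a : om n) :
  K_top (K_gen a (wedges (fun i : 'I_n => vbasis (fintype.lift ord0 i)))) = a.
Proof.
rewrite K_topE; case: eqP => // e; rewrite (eq_irrelevance e erefl) /= ext_detE.
rewrite (_ : \matrix_(r, c) _ = 1%:M) ?det1 ?mulr1z //.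
apply/matrixP => r c; rewrite !mxE !ffunE.
have E : (inord c.+1 : 'I_n.+1) = fintype.lift ord0 c.
  by apply: val_inj; rewrite /= inordK // ltnS.
by rewrite E (inj_eq lift_inj) eq_sym; case: eqP => //=; rewrite subr0.
Qed.

Lemma K_top_degenerate n (u : KO n) : span (@degenerate R (KOmega f) n) u -> K_top u = 0.
Proof.
elim=> [|{}u|{}u v _ hu _ hv]; last by rewrite K_topB hu hv subrr.
  exact: raddf0.
case: n u => [//|n] _ [i [w [/andP[i0 i_n] ->]]] /=.
elim/K_ind: w => [|w w' hw hw'|j a x].
- by rewrite K_map0 /K_top raddf0.
- by rewrite K_mapB K_topB hw hw' subrr.
rewrite K_map_gen.
(* As i > 0, the face fixes 0, and v_0 = 0 removes the term in da. *)
have -> : ord_face i ord0 = ord0 :> 'I_n.+2.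
  by apply: val_inj; rewrite /ord_face /= inordK /bump; lia.
rewrite vbasis0 (morphD0 ((@vwedge_biadditive _ _).1 _)) K_gen0r addr0 K_topE.
case: eqP => // e; suff -> : ext_det (ext_map (ker_sum_map (ord_face i)) x) = 0 by rewrite mulr0z.
elim/ext_ind: x => [|y z hy hz|y].
- by rewrite raddf0 (morphD0 (@ext_detD _ _)).
- by rewrite raddfB (morphDB (@ext_detD _ _)) hy hz subrr.
rewrite ext_mapE ?ext_detE; last exact: raddfB.
(* Column c holds the coordinate c + 1, and the i-th face misses i, so column i - 1 is zero. *)
have ij : (i.-1 < j)%N by rewrite e; lia.
rewrite (expand_det_col _ (Ordinal ij)) big1 // => r _; rewrite mxE /= ffunE big1 ?mul0r // => k.
move=> /eqP/(congr1 val); rewrite /ord_face /= !inordK ?prednK //; last first.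
  by have := ltn_ord k; rewrite /bump; case: leqP; lia.
by move=> ik; have := neq_bump i k; rewrite ik eqxx.
Qed.

Lemma norm_clsB (X : cosimplicial R) n (x y : X n) :
  norm_cls (x - y) = norm_cls x - norm_cls y.
Proof. exact: raddfB. Qed.

Lemma norm_cls0 (X : cosimplicial R) n : norm_cls (0 : X n) = 0.
Proof. exact: raddf0. Qed.

Lemma norm_cls_eq0 (X : cosimplicial R) n (x : X n) :
  norm_cls x = 0 <-> span (@degenerate R X n) x.
Proof.
by rewrite -(norm_cls0 X n); split=> [/cls_eq|H]; [|apply/cls_eq]; rewrite subr0.
Qed.

Lemma norm_KOmegaB n (a b : om n) : norm_KOmega (a - b) = norm_KOmega a - norm_KOmega b.
Proof. by rewrite /norm_KOmega K_genBl norm_clsB. Qed.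

Lemma norm_KOmega_eq0 n (a : om n) : norm_KOmega a = 0 -> a = 0.
Proof. by move=> /norm_cls_eq0 /K_top_degenerate; rewrite K_top_gen. Qed.

Lemma norm_AmitsurB n (u v : norm (Amitsur f) n) :
  norm_Amitsur (u - v) = norm_Amitsur u - norm_Amitsur v.
Proof. exact: raddfB. Qed.

Lemma norm_Amitsur_cls_word n s :
  norm_Amitsur (norm_cls (am f (word n.+1 s) : Amitsur f n)) = form f (word n.+1 s).
Proof. exact: norm_AmitsurE. Qed.

Let om_norm n : om n -> norm (Amitsur f) n :=
  om_lift (fun s => norm_cls (am f s : Amitsur f n)).

(** The inverse of [norm_Amitsur] is well defined because a word with f a in position i > 0 is
    degenerate: moving f a to position i - 1 leaves a 1 in position i, the mark of coface i. *)
Let om_norm_form n (s : nat -> S) :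
  om_norm (form f (word n.+1 s)) = norm_cls (am f (word n.+1 s) : Amitsur f n).
Proof.
apply: om_liftE => [t i u v|t i j a ij|t i a i0].
- by rewrite am_madd; exact: raddfD.
- by rewrite (@am_bal _ _ _ _ _ _ _ a ij).
apply/norm_cls_eq0; case: n s t i i0 => [|n] s t i i0; first by move: i0; rewrite (ord1 i).
apply: span_mem; exists i.
pose t' k : S := if k == i :> nat then 1 else t (inord k).
exists (am f (word n.+1 (fun k => if k == i.-1 then t' k * f a else t' (bump i k)))).
split; first by have := ltn_ord i; lia.
have i_n := ltn_ord i; rewrite /= am_coface_word; last by lia.
transitivity (am f (word n.+2 (nupd i.-1.+1 (f a * t' i.-1.+1) t'))).
  congr am; apply: funext => k; rewrite updE /word /nupd /t' prednK // eqxx mulr1 inord_val.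
  by rewrite [in RHS]eq_sym; case: eqP => // ?; rewrite ifF //; apply/eqP; lia.
rewrite -(bal_word _ _ (@am_bal R S f n.+1)); last by lia.
congr am; apply: eq_word => k kn; rewrite /nupd /ninsert1 /bump.
by repeat case: ifP => ?; try lia; rewrite /t'; repeat case: ifP => ?; try lia; do ?f_equal; lia.
Qed.

Lemma norm_Amitsur_eq0 n (x : Am n) :
  norm_Amitsur (norm_cls (x : Amitsur f n)) = 0 -> span (@degenerate R (Amitsur f) n) x.
Proof.
have E : om_norm (norm_Amitsur (norm_cls (x : Amitsur f n))) = norm_cls (x : Amitsur f n).
  have n0 : om_norm (0 : om n) = 0 by exact: raddf0.
  have nB (u v : om n) : om_norm (u - v) = om_norm u - om_norm v by exact: raddfB.
  have a0 : norm_Amitsur (0 : norm (Amitsur f) n) = 0 by exact: raddf0.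
  elim/am_ind: x => [|u v hu hv|s]; first by rewrite norm_cls0 a0 n0.
    by rewrite norm_clsB norm_AmitsurB nB hu hv.
  by rewrite norm_Amitsur_cls_word om_norm_form.
by move=> x0; apply/norm_cls_eq0; rewrite -E x0; exact: raddf0.
Qed.

End Normalized.

(** * Bijectivity of phi, transport of the ring laws and uniqueness *)

Section DoldKan.
Variables (R S : pzRingType) (f : {rmorphism R -> S}).
Local Notation Kmap := (K_map (@om_d R S f)).
Local Notation phi := (fun n => @am_phi R S f n : Amitsur f n -> KOmega f n).

Lemma am_phi_degenerate n (x : amitsur f n) :
  @degenerate R (Amitsur f) n x -> @degenerate R (KOmega f) n (am_phi x).
Proof.
case: n x => [//|n] x [i [y [i_n ->]]]; exists i, (am_phi y); split=> //.
by rewrite /= am_phi_coface //; case/andP: i_n.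
Qed.

Lemma norm_map_am_phi n (x : amitsur f n) :
  norm_map phi (norm_cls (x : Amitsur f n)) = norm_cls (am_phi x : KOmega f n).
Proof.
apply: (qliftE (g := fun x => norm_cls (am_phi x : KOmega f n))); split=> [u v|u du].
  by rewrite am_phiB norm_clsB.
by apply/norm_cls_eq0/span_mem/am_phi_degenerate.
Qed.

Lemma norm_am_phi n (x : amitsur f n) :
  norm_cls (am_phi x : KOmega f n) = norm_KOmega (norm_Amitsur (norm_cls (x : Amitsur f n))).
Proof.
have N0 : norm_KOmega (0 : omega f n) = 0 by rewrite -(subrr 0) norm_KOmegaB subrr.
have A0 : norm_Amitsur (0 : norm (Amitsur f) n) = 0 by exact: raddf0.
elim/am_ind: x => [|u v hu hv|s].
- by rewrite am_phi0 !norm_cls0 A0 N0.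
- by rewrite am_phiB !norm_clsB norm_AmitsurB norm_KOmegaB hu hv.
rewrite norm_Amitsur_cls_word; apply/eqP; rewrite -subr_eq0 -norm_clsB; apply/eqP.
by apply/norm_cls_eq0/am_phi_top.
Qed.

(** By induction on n: an element of the kernel is degenerate by the comparison of normalizations,
    and its codegeneracies lie in the kernel one degree lower, hence vanish. *)
Lemma am_phi_inj n : injective (@am_phi R S f n).
Proof.
suff H (x : amitsur f n) : am_phi x = 0 -> x = 0.
  by move=> x y xy; apply/eqP; rewrite -subr_eq0; apply/eqP/H; rewrite am_phiB xy subrr.
have xd m (y : amitsur f m) : am_phi y = 0 -> span (@degenerate R (Amitsur f) m) y.
  by move=> y0; apply/norm_Amitsur_eq0/norm_KOmega_eq0; rewrite -norm_am_phi y0 norm_cls0.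
elim: n x => [|n IH] x x0; first exact: (span_degenerate0 (xd _ _ x0)).
apply: (degenerate_codeg_eq0 (Amitsur_cosimplicial f) (xd _ _ x0)) => j jn.
apply: IH; transitivity (Kmap (@ord_degen n j) (am_phi x)); first exact: am_phi_codeg.
rewrite x0; exact: K_map0.
Qed.

Lemma am_phi_bij n : bijective (@am_phi R S f n).
Proof.
have [g gK] := choice (@am_phi_surj R S f n).
by exists g => // x; apply: am_phi_inj; rewrite gK.
Qed.

Lemma am_phi_commutes : commutes_cosimplicial phi.
Proof. by split=> n i x i_n; [exact: am_phi_coface|exact: am_phi_codeg]. Qed.

Lemma am_phi_dold_kan : dold_kan phi.
Proof.
split; first split.
- exact: am_phi_hom.
- exact: am_phi_bij.
- exact: am_phi_commutes.
by move=> n w; have [x ->] := cls_surj w; rewrite norm_map_am_phi norm_am_phi.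
Qed.

(** Pulled back from K Omega along the injective multiplicative phi, without the Yang-Baxter
    equation. *)
Lemma nuss_mulA n : associative (@nuss_mul R S f n).
Proof. by move=> u v w; apply: am_phi_inj; rewrite !am_phi_mul K_mulA. Qed.

Lemma nuss_mul1l n : left_id (nuss_one f n) (@nuss_mul R S f n).
Proof. by move=> u; apply: am_phi_inj; rewrite am_phi_mul am_phi_one K_mul1l. Qed.

Lemma nuss_mul1r n : right_id (nuss_one f n) (@nuss_mul R S f n).
Proof. by move=> u; apply: am_phi_inj; rewrite am_phi_mul am_phi_one K_mul1r. Qed.

Lemma nuss_mulDl n : left_distributive (@nuss_mul R S f n) +%R.
Proof.
move=> u v w; apply: am_phi_inj.
rewrite [LHS]am_phi_mul [RHS]am_phiD [am_phi (u + v)]am_phiD K_mulDl.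
by congr (_ + _); symmetry; exact: am_phi_mul.
Qed.

Lemma nuss_mulDr n : right_distributive (@nuss_mul R S f n) +%R.
Proof.
move=> u v w; apply: am_phi_inj.
rewrite [LHS]am_phi_mul [RHS]am_phiD [am_phi (v + w)]am_phiD K_mulDr.
by congr (_ + _); symmetry; exact: am_phi_mul.
Qed.

Lemma nuss_mul_morph n m (alpha : 'I_n.+1 -> 'I_m.+1) (g : amitsur f n -> amitsur f m) :
  (forall u, am_phi (g u) = Kmap alpha (am_phi u)) ->
  {morph g : u v / nuss_mul u v}.
Proof.
move=> gE u v; apply: am_phi_inj; rewrite gE [am_phi (nuss_mul u v)]am_phi_mul K_map_mul.
by rewrite -!gE; symmetry; exact: am_phi_mul.
Qed.

Lemma nuss_one_morph n m (alpha : 'I_n.+1 -> 'I_m.+1) (g : amitsur f n -> amitsur f m) :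
  (forall u, am_phi (g u) = Kmap alpha (am_phi u)) -> g (nuss_one f n) = nuss_one f m.
Proof.
by move=> gE; apply: am_phi_inj; rewrite gE !am_phi_one K_map_one.
Qed.

Lemma Amitsur_is_cosimplicial_ring : is_cosimplicial_ring (Amitsur_ring f).
Proof.
split=> [|n|n|n|n|n|n i i_n|n j jn].
- exact: Amitsur_cosimplicial.
- exact: nuss_mulA.
- exact: nuss_mul1l.
- exact: nuss_mul1r.
- exact: nuss_mulDl.
- exact: nuss_mulDr.
- have E u := @am_phi_coface R S f n i u i_n.
  by split; [exact: raddfD|exact: nuss_mul_morph E|exact: nuss_one_morph E].
- have E u := @am_phi_codeg R S f n j u jn.
  by split; [exact: raddfD|exact: nuss_mul_morph E|exact: nuss_one_morph E].
Qed.

Lemma am_phi_ring_iso :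
  @cosimplicial_ring_iso R (Amitsur_ring f) (KOmega_ring f) phi.
Proof.
split; [|exact: am_phi_bij|exact: am_phi_commutes].
by move=> n; split; [exact: am_opsD|exact: am_phi_mul|exact: am_phi_one].
Qed.

End DoldKan.

(** [norm_map] is a [qlift], so it computes only after psi has been shown to preserve degenerate
    elements. *)
Lemma dold_kan_norm (R S : pzRingType) (f : {rmorphism R -> S})
    (psi : forall n, Amitsur f n -> KOmega f n) n (x : Amitsur f n) : dold_kan psi ->
  norm_cls (psi n x) = norm_KOmega (norm_Amitsur (norm_cls x)).
Proof.
move=> [[hom _ [cof _]] <-]; symmetry.
apply: (qliftE (g := fun x => norm_cls (psi n x))).
have psiB m := morphDB (homD (hom m)).
split=> [u v|u du]; first by rewrite (psiB n u v); exact: norm_clsB.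
apply/norm_cls_eq0/span_mem; case: n x u du => [//|n] _ _ [i [y [i_n ->]]].
by exists i, (psi n y); split=> //; rewrite cof //; case/andP: i_n.
Qed.

(** The difference of the two maps takes degenerate values, whose codegeneracies vanish by induction
    on the degree. *)
Lemma dold_kan_unique (R S : pzRingType) (f : {rmorphism R -> S})
    (psi phi : forall n, Amitsur f n -> KOmega f n) :
  dold_kan psi -> dold_kan phi -> forall n, psi n =1 phi n.
Proof.
move=> dpsi dphi.
have d m (x : Amitsur f m) : span (@degenerate R (KOmega f) m) (psi m x - phi m x).
  by apply/norm_cls_eq0; rewrite norm_clsB !dold_kan_norm // subrr.
elim=> [|n IH] x; apply/eqP; rewrite -subr_eq0; apply/eqP.
  exact: (span_degenerate0 (d _ x)).
apply: (degenerate_codeg_eq0 (KOmega_cosimplicial f) (d _ x)) => j jn.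
have [[[_ _ [_ psi_codeg]] _] [[_ _ [_ phi_codeg]] _]] := (dpsi, dphi).
rewrite (morphDB (homD (codeg_hom (KOmega_cosimplicial f) jn))).
by rewrite -psi_codeg // -phi_codeg // IH subrr.
Qed.

Theorem proposition8p1 (R S : pzRingType) (f : {rmorphism R -> S}) :
  [/\ is_cosimplicial_ring (Amitsur_ring f),
      is_cosimplicial_ring (KOmega_ring f)
    & exists phi : forall n, Amitsur_ring f n -> KOmega_ring f n,
        [/\ dold_kan phi,
            forall psi, dold_kan psi -> forall n, psi n =1 phi n
          & cosimplicial_ring_iso phi]].
Proof.
split; [exact: Amitsur_is_cosimplicial_ring|exact: KOmega_is_cosimplicial_ring|].
exists (fun n => @am_phi R S f n); split; first exact: am_phi_dold_kan.
  by move=> psi dpsi; apply: dold_kan_unique => //; exact: am_phi_dold_kan.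
exact: am_phi_ring_iso.
Qed.
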